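(* Let $G=(V,E,\omega)$ be a weighted directed graph with $V=\{1,\dots,N\}$ and adjacency matrix $A\in\mathbb R_+^{N\times N}$, and let $\tilde G$ be the graph on the same node set $V$, with adjacency matrix $\tilde A\in\mathbb R_+^{N\times N}$, obtained from $G$ by adding, erasing, or modifying the weights of the edges contained in a set $\delta E\subset V\times V$. Let $S=\{s : (s,t)\in\delta E\}$ and $T=\{t : (s,t)\in\delta E\}$ be the sets of sources and tips of $\delta E$. Let $k,\ell\in V$ and $\delta=d_G(k,S)+d_G(T,\ell)$. Let $\Omega\subset\mathbb C$ be a convex continuum containing the fields of values $\mathcal F(A)$ and $\mathcal F(\tilde A)$, let $\phi$ be the conformal map sending the exterior of $\Omega$ onto the exterior of the closed unit disk, normalized by $\phi(\infty)=\infty$ and $\lim_{z\to\infty}\phi(z)/z=d>0$, and let $\psi=\phi^{-1}$. Given $\tau>1$, if $f$ is analytic in the level set $G_\tau$, defined as the complement of $\{\psi(z) : |z|>\tau\}$, then $$\left|\left(f(A)-f(\tilde A)\right)_{k\ell}\right|\le \mu_\tau(f)\,\frac{2}{\pi}\,\frac{\tau}{\tau-1}\left(\frac1\tau\right)^{\delta+2},\qquad \mu_\tau(f)=\int_{|z|=\tau}|f(\psi(z))|\,|\mathrm dz| .$$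
   Context: A weighted directed graph $G=(V,E,\omega)$ has edge set $E\subseteq V\times V$ and weights $\omega:E\to(0,\infty)$; its adjacency matrix has entries $a_{ij}=\omega(ij)$ if $(i,j)\in E$ and $a_{ij}=0$ otherwise (undirected graphs are the case of symmetric $A$). $d_G(k,\ell)$ is the length (number of edges) of a shortest walk from $k$ to $\ell$ in $G$, with $d_G(k,k)=0$ and $d_G(k,\ell)=+\infty$ if no walk exists; $d_G(k,S)=\min_{s\in S}d_G(k,s)$ and $d_G(T,\ell)=\min_{t\in T}d_G(t,\ell)$. If $\delta=+\infty$ the right-hand side is read as $0$. The field of values of $A\in\mathbb C^{N\times N}$ is $\mathcal F(A)=\{x^*Ax : x\in\mathbb C^N,\ \|x\|_2=1\}$. A continuum is a compact connected subset of $\mathbb C$ with more than one point. ''Analytic in'' a closed set means analytic in an open neighborhood of it. $f(A)$ is the usual matrix function (analytic functional calculus). *)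

(* Defs.v *)
From HB Require Import structures.
From mathcomp Require Import all_boot all_order all_algebra.
From mathcomp Require Import all_classical all_reals all_analysis.
From mathcomp Require Import complex.

Set Implicit Arguments.
Unset Strict Implicit.
Unset Printing Implicit Defensive.

Import Order.TTheory GRing.Theory Num.Theory.
Import numFieldNormedType.Exports.

Local Open Scope classical_set_scope.
Local Open Scope ring_scope.
Local Open Scope complex_scope.

(* The carrier is R[i]^o so that C is a normed module over itself: [derivable]
   below is then complex differentiability, and the scalars of [convex_set],
   being elements t of C with 0 <= t <= 1, are the reals of the unit interval.
   The library norm on R[i] is R[i]-valued; [cabs] is the R-valued modulus. *)
Notation Cplx R := (R[i]^o).

Definition cabs (R : realType) (z : Cplx R) : R := Normc.normc z.

Definition expi (R : realType) (t : R) : Cplx R := cos t +i* sin t.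

Section Graphs.
Variables (R : realType) (N : nat).

(* Only the values of [weight] on [edges] are meaningful. *)
Record wdigraph := WDigraph {
  edges : {set 'I_N * 'I_N};
  weight : 'I_N * 'I_N -> R;
  weight_gt0 : forall e, e \in edges -> 0 < weight e
}.

Definition adjacency (G : wdigraph) : 'M[R]_N :=
  \matrix_(i, j) (if (i, j) \in edges G then weight G (i, j) else 0).

Definition edge_rel (G : wdigraph) : rel 'I_N := [rel i j | (i, j) \in edges G].

(* [edited_within dE G G'] : G' arises from G by adding, erasing or reweighting
   edges that all lie in dE. *)
Definition edited_within (dE : {set 'I_N * 'I_N}) (G G' : wdigraph) : Prop :=
  forall e, e \notin dE ->
    (e \in edges G') = (e \in edges G) /\
    (e \in edges G -> weight G' e = weight G e).

Definition sources (dE : {set 'I_N * 'I_N}) : {set 'I_N} :=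
  [set e.1 | e in dE]%SET.

Definition tips (dE : {set 'I_N * 'I_N}) : {set 'I_N} :=
  [set e.2 | e in dE]%SET.

(* A walk is k :: p, so its length is size p; the infimum of the empty set
   is +oo. *)
Definition dist (G : wdigraph) (k l : 'I_N) : \bar R :=
  ereal_inf [set (size p)%:R%:E | p in
    [set p : seq 'I_N | path (edge_rel G) k p /\ last k p = l]].

Definition dist_to_set (G : wdigraph) (k : 'I_N) (S : {set 'I_N}) : \bar R :=
  \big[Order.min/+oo%E]_(s in S) dist G k s.

Definition dist_from_set (G : wdigraph) (T : {set 'I_N}) (l : 'I_N) : \bar R :=
  \big[Order.min/+oo%E]_(t in T) dist G t l.

End Graphs.

(* (1 / tau) ^ (delta + 2), read as 0 for delta = +oo. *)
Definition decay (R : realType) (tau : R) (delta : \bar R) : R :=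
  if delta is r%:E then (1 / tau) `^ (r + 2) else 0.

Section ComplexAnalysis.
Variable R : realType.
Local Notation C := (Cplx R).
Local Notation mu := (@lebesgue_measure R).

Definition holomorphic_on (U : set C) (f : C -> C) : Prop :=
  forall z, U z -> derivable f z 1.

Definition analytic_in (K : set C) (f : C -> C) : Prop :=
  exists U : set C, [/\ open U, K `<=` U & holomorphic_on U f].

Definition continuum (K : set C) : Prop :=
  [/\ compact K, connected K & exists x y, [/\ K x, K y & x <> y]].

(* Neighbourhoods of the point at infinity of the Riemann sphere, without the
   point itself. *)
Definition cinfty : set_system C :=
  [set P | exists M : R, forall z, M < cabs z -> P z].

Definition conformal_exterior (Omega : set C) (phi : C -> C) : Prop :=
  [/\ holomorphic_on (~` Omega) phi,
      set_bij (~` Omega) [set w | 1 < cabs w] phi,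
      phi @ cinfty --> cinfty &
      exists2 d : R, 0 < d & (fun z => phi z / z) @ cinfty --> (d%:C : C)].

Definition level_set (psi : C -> C) (tau : R) : set C :=
  ~` [set psi z | z in [set z | tau < cabs z]].

Definition level_integral (f psi : C -> C) (tau : R) : R :=
  \int[mu]_(t in `[0, 2 * pi]) (cabs (f (psi (tau%:C * expi t))) * tau).

Definition cintegral (D : set R) (g : R -> C) : C :=
  (\int[mu]_(t in D) complex.Re (g t)) +i* (\int[mu]_(t in D) complex.Im (g t)).

Definition circle_integral (c : C) (r : R) (g : C -> C) : C :=
  cintegral `[0, 2 * pi]
    (fun t => g (c + r%:C * expi t) * ('i * r%:C * expi t)).

End ComplexAnalysis.

Section Matrices.
Variables (R : realType) (N : nat).
Local Notation C := (Cplx R).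

Definition field_of_values (A : 'M[R[i]]_N) : set C :=
  [set z | exists2 x : 'cV[R[i]]_N,
     Num.sqrt (\sum_i cabs (x i 0) ^+ 2) = 1 &
     z = ((map_mx conjc x)^T *m A *m x) 0 0].

(* f(A) = 1 / (2 pi i) \oint_Gamma f(z) (z I - A)^-1 dz, where Gamma consists
   of one circle of radius r around each eigenvalue of A.  For f analytic in a
   neighbourhood of the spectrum the integral does not depend on r as soon as
   the closed disks are disjoint and contained in that neighbourhood, so the
   limit below is this common value. *)
Definition mxfun (f : C -> C) (A : 'M[R[i]]_N) : 'M[R[i]]_N :=
  \matrix_(k, l) lim ((fun r : R =>
    (2 * pi%:C * 'i)^-1 *
    \sum_(lambda \in [set a : C | eigenvalue A a])
      circle_integral lambda r
        (fun z => f z * invmx ((z : R[i])%:M - A) k l) : C) @ 0^'+).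

End Matrices.

(* Main.v *)
(** With [s = 1 / w], the kernel [H_A(s) = w psi'(w) (psi(w) - A)^-1] extends
    holomorphically to the unit disc with [H_A(0) = 1], and shrinking the contour
    [psi(|w| = tau)] towards each eigenvalue (level sets are star-shaped about
    every point of Omega) gives
      [f(A) = (2 pi)^-1 \int_0^(2 pi) f(psi(tau e^(it))) H_A(e^(-it) / tau) dt].
    The Schwarz lemma for [w |-> phi (z + t (psi w - z))], [z] in Omega, shows that
    [|phi|] does not decrease along rays issued from [z]; hence the field of values
    of [H_A(s)] lies in the right half-plane.  As in Caratheodory's coefficient
    estimate (which yields Beckermann's bound [||F_n(A)|| <= 2] for Faber
    polynomials), a difference of two such kernels whose [(k, l)] entry vanishes
    to order [n] at 0 is at most [4 |s|^n / (1 - |s|)] there.  Powers of [A] up to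
    the exponent delta are insensitive, in position [(k, l)], to the edited edges,
    so [n = delta + 1] is allowed. *)

Require Import Defs.
From HB Require Import structures.
From mathcomp Require Import all_boot all_order all_algebra.
From mathcomp Require Import all_classical all_reals all_analysis.
From mathcomp Require Import complex.
From mathcomp Require Import ring lra.

Set Implicit Arguments.
Unset Strict Implicit.
Unset Printing Implicit Defensive.

Import Order.TTheory GRing.Theory Num.Theory.
Import numFieldNormedType.Exports.

Local Open Scope classical_set_scope.
Local Open Scope ring_scope.
Local Open Scope complex_scope.

(** * Complex numbers and derivatives *)

(** Accretivity controls only the Hermitian part of a kernel, hence the combination
    [H k l + conjc (H l k)], which is not holomorphic in [s]. The entry [(k, l)] is separated from
    the conjugated one by averaging over a circle against a kernel that reproduces functions
    vanishing to order [n > 0] and annihilates conjugates of holomorphic functions. The majorant is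
    the real part of the sum of the [(k, k)] and [(l, l)] entries of both kernels; each of these
    four entries is 1 at the origin, whence the constant 4. As [|dz| = tau dt] on the circle,
    [mu_tau(f)] is multiplied by [4 / (2 pi tau)] times [tau^-n / (1 - 1 / tau)], which for
    [n = delta + 1] is the stated factor. Boundary values on Omega are never taken: circles stay
    strictly inside the unit disc of the variable [s], and the radius tends to 1 only in the final
    inequality of the coefficient estimate. The contours are circles and level curves star-shaped
    about every point of Omega, so Cauchy's theorem is proved as invariance under radial
    contraction, and everything else about holomorphic functions is derived from that. *)

Section Modulus.
Variable R : realType.
Local Notation C := (Cplx R).
Implicit Types (x y z : C) (a b : R).

Lemma normCE z : `|z| = (cabs z)%:C.
Proof. by []. Qed.

Lemma cabs_ge0 z : 0 <= cabs z.
Proof. by case: z => a b; rewrite /cabs /= sqrtr_ge0. Qed.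

Lemma cabsM x y : cabs (x * y) = cabs x * cabs y.
Proof. exact: Normc.normcM. Qed.

Lemma cabsV x : cabs x^-1 = (cabs x)^-1.
Proof. exact: Normc.normcV. Qed.

Lemma cabsN x : cabs (- x) = cabs x.
Proof. exact: normcN. Qed.

Lemma cabsD x y : cabs (x + y) <= cabs x + cabs y.
Proof. exact: le_normcD. Qed.

Lemma cabs0 : cabs (0 : C) = 0.
Proof. exact: Normc.normc0. Qed.

Lemma cabs1 : cabs (1 : C) = 1.
Proof. exact: Normc.normc1. Qed.

Lemma cabs_eq0 x : (cabs x == 0) = (x == 0).
Proof.
apply/eqP/eqP => [|->]; last exact: cabs0.
exact: Normc.eq0_normc.
Qed.

Lemma cabs_gt0 x : (0 < cabs x) = (x != 0).
Proof. by rewrite lt_def cabs_ge0 andbT cabs_eq0. Qed.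

Lemma cabsB x y : cabs (x - y) = cabs (y - x).
Proof. by rewrite -cabsN opprB. Qed.

Lemma cabsX x n : cabs (x ^+ n) = cabs x ^+ n.
Proof.
by elim: n => [|n IH]; rewrite ?cabs1 // !exprS cabsM IH.
Qed.

Lemma cabsR a : cabs (a%:C : C) = `|a|.
Proof. by rewrite /cabs /= expr0n /= addr0 sqrtr_sqr. Qed.

Lemma cabsR_ge0 a : 0 <= a -> cabs (a%:C : C) = a.
Proof. by move=> a0; rewrite cabsR ger0_norm. Qed.

Lemma cabs_i : cabs ('i : C) = 1.
Proof. by rewrite /cabs /= expr0n /= expr1n add0r sqrtr1. Qed.

Lemma cabsJ x : cabs (conjc x) = cabs x.
Proof. by case: x => a b; rewrite /cabs /= sqrrN. Qed.

Lemma le_cabsB x y : cabs x - cabs y <= cabs (x - y).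
Proof. by rewrite lerBlDr; apply: le_trans (cabsD _ _); rewrite subrK. Qed.

Lemma ler_cabsB x y : cabs (x - y) <= cabs x + cabs y.
Proof. by apply: le_trans (cabsD _ _) _; rewrite cabsN. Qed.

Lemma cabs_sqr x : cabs x ^+ 2 = complex.Re x ^+ 2 + complex.Im x ^+ 2.
Proof.
by case: x => a b; rewrite /cabs /= sqr_sqrtr // addr_ge0 ?sqr_ge0.
Qed.

Lemma normr_Re_le x : `|complex.Re x| <= cabs x.
Proof.
rewrite -(@ler_pXn2r _ 2%N) ?nnegrE ?normr_ge0 ?cabs_ge0 // cabs_sqr.
by rewrite real_normK ?num_real // lerDl sqr_ge0.
Qed.

Lemma normr_Im_le x : `|complex.Im x| <= cabs x.
Proof.
rewrite -(@ler_pXn2r _ 2%N) ?nnegrE ?normr_ge0 ?cabs_ge0 // cabs_sqr.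
by rewrite real_normK ?num_real // lerDr sqr_ge0.
Qed.

Lemma Re_le x : complex.Re x <= cabs x.
Proof. exact: le_trans (ler_norm _) (normr_Re_le x). Qed.

Lemma cabs_le_ReIm x : cabs x <= `|complex.Re x| + `|complex.Im x|.
Proof.
rewrite -(@ler_pXn2r _ 2%N) ?nnegrE ?addr_ge0 ?cabs_ge0 // cabs_sqr.
by rewrite sqrrD !real_normK ?num_real // lerD2r lerDl mulrn_wge0.
Qed.

Lemma mulcJ x : x * conjc x = (cabs x ^+ 2)%:C.
Proof.
rewrite cabs_sqr; case: x => a b /=.
by apply/eqP; rewrite eq_complex /=; apply/andP; split; apply/eqP; ring.
Qed.

Lemma cReM x y : complex.Re (x * y) =
  complex.Re x * complex.Re y - complex.Im x * complex.Im y.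
Proof. by case: x; case: y. Qed.

Lemma cImM x y : complex.Im (x * y) =
  complex.Re x * complex.Im y + complex.Im x * complex.Re y.
Proof. by case: x; case: y. Qed.

Lemma cReD x y : complex.Re (x + y) = complex.Re x + complex.Re y.
Proof. by case: x; case: y. Qed.

Lemma cImD x y : complex.Im (x + y) = complex.Im x + complex.Im y.
Proof. by case: x; case: y. Qed.

Lemma cReN x : complex.Re (- x) = - complex.Re x.
Proof. by case: x. Qed.

Lemma cImN x : complex.Im (- x) = - complex.Im x.
Proof. by case: x. Qed.

Lemma cReJ x : complex.Re (conjc x) = complex.Re x.
Proof. by case: x. Qed.

Lemma cReZ a x : complex.Re (a%:C * x) = a * complex.Re x.
Proof. by case: x => b c /=; rewrite mul0r subr0. Qed.

Lemma nbhsCP z (P : set C) :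
  nbhs z P <-> exists2 e, 0 < e & forall y, cabs (y - z) < e -> P y.
Proof.
split=> [/nbhs_ballP[e /= e0 eP]|[e e0 eP]].
  have eE : e = (complex.Re e)%:C.
    by move: e0; rewrite ltcE /=; case: (e) => a b /= /andP[/eqP -> _].
  exists (complex.Re e) => [|y yz]; first by move: e0; rewrite {1}eE ltcR.
  by apply: eP; rewrite /ball /= distrC eE normCE ltcR.
apply/nbhs_ballP; exists e%:C => /=; first by rewrite ltcR.
by move=> y; rewrite /ball /= distrC normCE ltcR; apply: eP.
Qed.

Lemma continuousCP (T : topologicalType) (f : T -> C) (t : T) :
  {for t, continuous f} <->
  forall e, 0 < e -> \forall u \near t, cabs (f u - f t) < e.
Proof.
split=> [cf e e0|cf P /nbhsCP[e e0 eP]].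
  by apply: (cf [set y | cabs (y - f t) < e]); apply/nbhsCP; exists e.
by apply: filterS (cf e e0) => u /eP.
Qed.

Lemma continuousRP (T : topologicalType) (f : T -> R) (t : T) :
  {for t, continuous f} <->
  forall e, 0 < e -> \forall u \near t, `|f u - f t| < e.
Proof.
split=> [/cvgrPdist_lt cf e e0|cf].
  by apply: filterS (cf _ e0) => u; rewrite distrC.
by apply/cvgrPdist_lt => e e0; apply: filterS (cf _ e0) => u; rewrite distrC.
Qed.

Lemma continuous_cabs : continuous (@cabs R).
Proof.
move=> z; apply/continuousRP => e e0; apply/nbhsCP; exists e => // y yz.
apply: le_lt_trans yz; rewrite ler_norml; apply/andP; split.
  by have := le_cabsB z y; rewrite cabsB; lra.
exact: le_cabsB.
Qed.

Lemma continuous_Re : continuous (@complex.Re R : C -> R).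
Proof.
move=> z; apply/continuousRP => e e0; apply/nbhsCP; exists e => // y yz.
by apply: le_lt_trans yz; rewrite -cReN -cReD normr_Re_le.
Qed.

Lemma continuous_Im : continuous (@complex.Im R : C -> R).
Proof.
move=> z; apply/continuousRP => e e0; apply/nbhsCP; exists e => // y yz.
by apply: le_lt_trans yz; rewrite -cImN -cImD normr_Im_le.
Qed.

Lemma continuous_conjc : continuous (@conjc R : C -> C).
Proof.
move=> z; apply/continuousCP => e e0; apply/nbhsCP; exists e => // y yz.
by rewrite -rmorphB cabsJ.
Qed.

Lemma continuous_ReIm (T : topologicalType) (f g : T -> R) (t : T) :
  {for t, continuous f} -> {for t, continuous g} ->
  {for t, continuous (fun u => f u +i* g u : C)}.
Proof.
move=> cf cg; apply/continuousCP => e e0.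
have e20 : 0 < e / 2 by rewrite divr_gt0.
have /continuousRP/(_ _ e20) h1 := cf.
have /continuousRP/(_ _ e20) h2 := cg.
apply: filterS2 h1 h2 => u h1 h2.
apply: le_lt_trans (cabs_le_ReIm _) _ => /=.
by rewrite (splitr e) ltrD.
Qed.

(* An inductive wrapper: it keeps unification from unfolding continuity down to
   the neighbourhood filters of R[i]. *)
Variant ccont (T : topologicalType) (f : T -> C) (t : T) : Prop :=
  CCont of {for t, continuous f}.

Lemma ccontP (T : topologicalType) (f : T -> C) (t : T) :
  ccont f t <-> forall e, 0 < e -> \forall u \near t, cabs (f u - f t) < e.
Proof.
split; first by case=> /continuousCP.
by move=> h; split; apply/continuousCP.
Qed.

Section ContinuousAlgebra.
Variables (T : topologicalType) (t : T).
Implicit Types f g : T -> C.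

Lemma ccont_cst (k : C) : ccont (fun _ : T => k) t.
Proof. split; exact: cst_continuous. Qed.

Lemma ccontD f g : ccont f t -> ccont g t -> ccont (fun u => f u + g u) t.
Proof. by case=> cf [cg]; split; exact: (continuousD cf cg). Qed.

Lemma ccontN f : ccont f t -> ccont (fun u => - f u) t.
Proof. by case=> cf; split; exact: (continuousN cf). Qed.

Lemma ccontB f g : ccont f t -> ccont g t -> ccont (fun u => f u - g u) t.
Proof. by case=> cf [cg]; split; exact: (continuousB cf cg). Qed.

Lemma ccontM f g : ccont f t -> ccont g t -> ccont (fun u => f u * g u) t.
Proof. by case=> cf [cg]; split; exact: (continuousM cf cg). Qed.

Lemma ccontV f : f t != 0 -> ccont f t -> ccont (fun u => (f u)^-1) t.
Proof. by move=> f0 [cf]; split; exact: (continuousV f0 cf). Qed.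

Lemma ccontX f n : ccont f t -> ccont (fun u => f u ^+ n) t.
Proof.
move=> cf; elim: n => [|n IH]; first exact: ccont_cst.
have -> : (fun u => f u ^+ n.+1) = (fun u => f u * f u ^+ n).
  by apply/funext => u; rewrite exprS.
exact: ccontM.
Qed.

Lemma ccontJ f : ccont f t -> ccont (fun u => conjc (f u)) t.
Proof.
by case=> cf; split; exact: (continuous_comp cf (@continuous_conjc _)).
Qed.

Lemma ccont_comp f (h : C -> C) :
  ccont f t -> ccont h (f t) -> ccont (fun u => h (f u)) t.
Proof. by case=> cf [ch]; split; exact: (continuous_comp cf ch). Qed.

Lemma ccont_RtoC (f : T -> R) :
  {for t, continuous f} -> ccont (fun u => (f u)%:C) t.
Proof.
by move=> cf; split; apply: continuous_ReIm => //; exact: cst_continuous.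
Qed.

Lemma ccont_near f g : (\forall u \near t, f u = g u) ->
  ccont f t -> ccont g t.
Proof.
move=> fg /ccontP cf; have fgt := nbhs_singleton fg.
apply/ccontP => e e0; have := cf e e0.
by apply: filterS2 fg => u <-; rewrite fgt.
Qed.

End ContinuousAlgebra.

Lemma ccont_id (z : C) : ccont id z.
Proof. by split. Qed.

End Modulus.

(** * Derivatives through slope functions *)

Section Caratheodory.
Variable R : realType.
Local Notation C := (Cplx R).

(** Caratheodory's form of the derivative. The slope [q] is defined everywhere, so the rules of
    calculus become ring identities between slopes, and the quotient [(f x - f z) / (x - z)],
    extended to [z], is at hand when functions are factored. *)
Definition is_cder (f : C -> C) (z l : C) := exists q : C -> C,
  [/\ ccont q z, q z = l & forall x, f x = f z + (x - z) * q x].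

Definition is_rder (f : R -> C) (t : R) (l : C) := exists q : R -> C,
  [/\ ccont q t, q t = l & forall x, f x = f t + (x - t)%:C * q x].

Implicit Types (f g : C -> C) (c d : R -> C) (z l m : C) (t : R).

Lemma is_cder_ccont f z l : is_cder f z l -> ccont f z.
Proof.
case=> q [cq ql fE].
have -> : f = (fun x => f z + (x - z) * q x) by apply/funext.
apply: ccontD; first exact: ccont_cst.
by apply: ccontM cq; apply: ccontB; [exact: ccont_id|exact: ccont_cst].
Qed.

Lemma is_rder_ccont c t l : is_rder c t l -> ccont c t.
Proof.
case=> q [cq ql fE].
have -> : c = (fun x => c t + (x - t)%:C * q x) by apply/funext.
apply: ccontD; first exact: ccont_cst.
apply: ccontM cq; apply: ccont_RtoC.
by apply: continuousB; [exact: id|exact: cst_continuous].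
Qed.

Lemma is_cder_near f g z l : (\forall x \near z, f x = g x) ->
  is_cder f z l -> is_cder g z l.
Proof.
move=> fg [q [cq ql fE]]; have fgz := nbhs_singleton fg.
pose p x := if x == z then l else (g x - g z) / (x - z).
exists p; split.
- apply: ccont_near cq; apply: filterS fg => x fgx.
  rewrite /p; case: eqP => [->//|/eqP xz].
  rewrite -fgx -fgz (fE x) addrC addKr.
  by rewrite mulrC mulKf // subr_eq0.
- by rewrite /p eqxx.
- move=> x; rewrite /p; case: eqP => [->|/eqP xz]; first by rewrite subrr mul0r addr0.
  by rewrite mulrC divfK ?subr_eq0 // addrC subrK.
Qed.

Lemma is_cder_unique f z l m : is_cder f z l -> is_cder f z m -> l = m.
Proof.
move=> [p [cp <- pE]] [q [cq <- qE]]; apply/eqP; rewrite -subr_eq0 -cabs_eq0.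
apply: contraT => /negPf d0.
have d0' : 0 < cabs (p z - q z) by rewrite lt_def d0 cabs_ge0.
have /ccontP/(_ _ d0')/nbhsCP[e e0 eP] := ccontB cp cq.
have /eP : cabs (z + (e / 2)%:C - z) < e.
  by rewrite addrC addKr cabsR_ge0; lra.
set x := z + _.
have xz : x - z != 0.
  by rewrite /x addrC addKr -cabs_eq0 cabsR_ge0; lra.
have -> : p x = q x.
  by have := pE x; rewrite qE => /addrI /(mulfI xz).
by rewrite subrr sub0r cabsN ltxx.
Qed.

Lemma is_cder_cst k z : is_cder (fun=> k) z 0.
Proof.
exists (fun=> 0); split; [exact: ccont_cst|by []|move=> x].
by rewrite mulr0 addr0.
Qed.

Lemma is_cder_id z : is_cder id z 1.
Proof.
exists (fun=> 1); split; [exact: ccont_cst|by []|move=> x].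
by rewrite mulr1 addrC subrK.
Qed.

Lemma is_cderD f g z l m : is_cder f z l -> is_cder g z m ->
  is_cder (fun x => f x + g x) z (l + m).
Proof.
move=> [p [cp <- pE]] [q [cq <- qE]]; exists (fun x => p x + q x).
split; [exact: ccontD|by []|move=> x].
by rewrite pE qE; ring.
Qed.

Lemma is_cderM f g z l m : is_cder f z l -> is_cder g z m ->
  is_cder (fun x => f x * g x) z (l * g z + f z * m).
Proof.
move=> [p [cp <- pE]] dg; have cg := is_cder_ccont dg.
case: dg => [q [cq <- qE]].
exists (fun x => p x * g x + f z * q x); split; [|by []|move=> x].
  by apply: ccontD; apply: ccontM => //; exact: ccont_cst.
by rewrite pE qE; ring.
Qed.

Lemma is_cderV f z l : f z != 0 -> is_cder f z l ->
  is_cder (fun x => (f x)^-1) z (- l / f z ^+ 2).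
Proof.
move=> fz0 df; have cf := is_cder_ccont df.
have nf : \forall x \near z, f x != 0.
  have := cf; move=> /ccontP/(_ (cabs (f z))); rewrite cabs_gt0.
  move=> /(_ fz0); apply: filterS => x; apply: contraTneq => ->.
  by rewrite sub0r cabsN ltxx.
case: df => [p [cp <- pE]].
(* Far from [z] the function [f] may vanish and the slope identity for the inverse fails; [g]
   satisfies it by construction and equals the inverse only near [z]. *)
pose g x := (f z)^-1 + (x - z) * (- p x / (f x * f z)).
apply: (@is_cder_near g).
  apply: filterS nf => x fx0; rewrite /g.
  have xp : (x - z) * p x = f x - f z by rewrite (pE x) [f z + _]addrC addrK.
  have -> : (x - z) * (- p x / (f x * f z)) = - (f x - f z) / (f x * f z).
    by rewrite -xp; ring.
  by field; rewrite fx0 fz0.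
exists (fun x => - p x / (f x * f z)); split.
- apply: ccontM; first exact: ccontN.
  apply: ccontV; first by rewrite mulf_neq0.
  by apply: ccontM => //; exact: ccont_cst.
- by rewrite expr2.
- by move=> x; rewrite /g subrr mul0r addr0.
Qed.

Lemma is_cder_comp f g z l m : is_cder f z l -> is_cder g (f z) m ->
  is_cder (fun x => g (f x)) z (m * l).
Proof.
move=> df; have cf := is_cder_ccont df.
case: df => [p [cp <- pE]] [q [cq <- qE]].
exists (fun x => q (f x) * p x); split; [|by []|move=> x].
  by apply: ccontM cp; exact: ccont_comp.
rewrite qE; congr (_ + _); rewrite mulrCA mulrC; congr (_ * _).
by rewrite (pE x) [X in X - _]addrC addrK.
Qed.

Lemma is_rder_comp g c t l m : is_rder c t l -> is_cder g (c t) m ->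
  is_rder (fun x => g (c x)) t (m * l).
Proof.
move=> dc; have cc := is_rder_ccont dc.
case: dc => [p [cp <- pE]] [q [cq <- qE]].
exists (fun x => q (c x) * p x); split; [|by []|move=> x].
  by apply: ccontM cp; exact: ccont_comp.
rewrite qE; congr (_ + _); rewrite mulrCA mulrC; congr (_ * _).
by rewrite (pE x) [X in X - _]addrC addrK.
Qed.

Lemma is_cderP f z l : is_cder f z l <-> is_derive z 1 f l.
Proof.
split=> [[q [cq <- qE]]|[df fl]].
  have h : (fun h : C => h^-1 *: ((f \o shift z) (h *: (1 : C)) - f z)) @ (0 : C)^' --> q z.
    have cq0 : ccont (fun h : C => q (h + z)) 0.
      apply: (@ccont_comp _ _ 0 (fun h : C => h + z)); last by rewrite add0r.
      by apply: ccontD; [exact: ccont_id|exact: ccont_cst].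
    move=> P /nbhsCP[e e0 eP].
    have /ccontP/(_ _ e0)/nbhsCP[d d0 dP] := cq0.
    apply/nbhsCP; exists d => // h hd h0.
    apply: eP; have := dP h hd; rewrite add0r.
    rewrite /= /shift /= -[h *: 1]/(h * 1) mulr1 (qE (h + z)) !addrK.
    by rewrite (addrC (f z)) addrK -[_ *: _]/(h^-1 * (h * q (h + z))) mulKf.
  split; first by apply/cvg_ex; exists (q z).
  exact: cvg_lim.
have : (fun h : C => h^-1 *: ((f \o shift z) (h *: (1 : C)) - f z)) @ (0 : C)^' --> l.
  by rewrite -fl.
rewrite /= => cfl.
exists (fun x => if x == z then l else (f x - f z) / (x - z)); split.
- apply/ccontP => e e0; rewrite eqxx.
  have : nbhs l [set y | cabs (y - l) < e] by apply/nbhsCP; exists e.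
  move=> /cfl; rewrite /nbhs /= => /nbhsCP[d d0 dP].
  apply/nbhsCP; exists d => // y yz; case: eqP => [_|/eqP yz0].
    by rewrite subrr cabs0.
  have := dP (y - z); rewrite subr0 subr_eq0 => /(_ yz yz0) /=.
  rewrite -[(y - z) *: 1]/((y - z) * 1) mulr1 /shift /= subrK.
  by rewrite -[_ *: _]/((y - z)^-1 * (f y - f z)) mulrC.
- by rewrite eqxx.
- move=> x; case: eqP => [->|/eqP xz]; first by rewrite subrr mul0r addr0.
  by rewrite mulrC divfK ?subr_eq0 // addrC subrK.
Qed.

Lemma derivable_is_cder f z : derivable f z 1 <-> exists l, is_cder f z l.
Proof.
split=> [df|[l /is_cderP[]//]].
by exists ('D_1 f z); apply/is_cderP; exact: DeriveDef.
Qed.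

End Caratheodory.

(** * Integrals along curves *)

Section RealIntegral.
Variable R : realType.
Local Notation mu := (@lebesgue_measure R).
Implicit Types (f g : R -> R) (a b : R).

(** Continuity is two-sided at the endpoints as well: the integrands are functions on the whole
    line, and derivatives are then taken at [a] and [b] like anywhere else. *)
Definition cont_on a b f := forall t, a <= t <= b -> {for t, continuous f}.

Lemma cont_on_within a b f : cont_on a b f -> {within `[a, b], continuous f}.
Proof.
move=> cf; apply: continuous_in_subspaceT => t; rewrite inE /= in_itv /=.
exact: cf.
Qed.

Lemma cont_on_integrable a b f : cont_on a b f ->
  mu.-integrable `[a, b] (EFin \o f).
Proof.
move=> /cont_on_within cf; apply: continuous_compact_integrable => //.
exact: segment_compact.
Qed.

Lemma Rint_split a m b f : a <= m -> m <= b -> cont_on a b f ->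
  \int[mu]_(t in `[a, b]) f t =
  \int[mu]_(t in `[a, m]) f t + \int[mu]_(t in `[m, b]) f t.
Proof.
move=> am mb cf; have if_ := cont_on_integrable cf.
have := @Rintegral_itvB R f (BLeft a) (BRight b) m if_ _ _.
rewrite !bnd_simp => /(_ am mb) /eqP; rewrite subr_eq addrC => /eqP ->.
congr (_ + _); apply: Rintegral_itv_obnd_cbnd.
apply: integrableS if_ => //; apply: subset_itv; rewrite bnd_simp //.
Qed.

Lemma Rint_FTC a b f F : a <= b -> cont_on a b f ->
  (forall t, a <= t <= b -> is_derive t 1 F (f t)) ->
  \int[mu]_(t in `[a, b]) f t = F b - F a.
Proof.
rewrite le_eqVlt => /predU1P[->|ab] cf dF.
  by rewrite subrr set_itv1 Rintegral_set1.
have cF t : a <= t <= b -> {for t, continuous F}.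
  move=> /dF[dFt _]; apply: differentiable_continuous.
  exact/derivable1_diffP.
rewrite /Rintegral (@continuous_FTC2 _ f F) //=; first exact: cont_on_within.
  split.
  - move=> t; rewrite in_itv /= => /andP[/ltW ta /ltW tb].
    by have [] := dF t; rewrite ?ta ?tb.
  - apply: cvg_at_right_filter; apply: cF; rewrite lexx ltW //.
  - apply: cvg_at_left_filter; apply: cF; rewrite lexx ltW //.
move=> t; rewrite in_itv /= => /andP[/ltW ta /ltW tb].
by rewrite derive1E; have [|_ ->] := dF t; rewrite ?ta ?tb.
Qed.

End RealIntegral.

Local Notation cI a b f := (cintegral `[a, b] f).

Section ComplexIntegral.
Variable R : realType.
Local Notation C := (Cplx R).
Local Notation mu := (@lebesgue_measure R).
Implicit Types (f g : R -> C) (a b : R) (k : C).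

Definition ccont_on a b f := forall t, a <= t <= b -> ccont f t.


Lemma ccont_on_Re a b f : ccont_on a b f -> cont_on a b (fun t => complex.Re (f t)).
Proof.
move=> cf t /cf[ct]; exact: (continuous_comp ct (@continuous_Re _ _)).
Qed.

Lemma ccont_on_Im a b f : ccont_on a b f -> cont_on a b (fun t => complex.Im (f t)).
Proof.
move=> cf t /cf[ct]; exact: (continuous_comp ct (@continuous_Im _ _)).
Qed.

Lemma ccont_on_cabs a b f : ccont_on a b f -> cont_on a b (fun t => cabs (f t)).
Proof.
move=> cf t /cf[ct]; exact: (continuous_comp ct (@continuous_cabs _ _)).
Qed.

Lemma eq_cint a b f g : (forall t, a <= t <= b -> f t = g t) ->
  cI a b f = cI a b g.
Proof.
move=> fg; rewrite /cintegral; congr (_ +i* _);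
  by apply: eq_Rintegral => t; rewrite inE /= in_itv /= => /fg ->.
Qed.

Lemma cintD a b f g : ccont_on a b f -> ccont_on a b g ->
  cI a b (fun t => f t + g t) = cI a b f + cI a b g.
Proof.
move=> cf cg; rewrite /cintegral /=.
have -> (x y z w : R) : (x +i* y) + (z +i* w) = (x + z) +i* (y + w) by [].
congr (_ +i* _).
  rewrite -RintegralD //; last 2 first.
  - exact/cont_on_integrable/ccont_on_Re.
  - exact/cont_on_integrable/ccont_on_Re.
  by apply: eq_Rintegral => t _; rewrite cReD.
rewrite -RintegralD //; last 2 first.
- exact/cont_on_integrable/ccont_on_Im.
- exact/cont_on_integrable/ccont_on_Im.
by apply: eq_Rintegral => t _; rewrite cImD.
Qed.

Lemma cintZ a b k f : ccont_on a b f -> cI a b (fun t => k * f t) = k * cI a b f.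
Proof.
move=> cf; rewrite /cintegral.
have iR := cont_on_integrable (ccont_on_Re cf).
have iI := cont_on_integrable (ccont_on_Im cf).
have iZ (c : R) (h : R -> R) : mu.-integrable `[a, b] (EFin \o h) ->
    mu.-integrable `[a, b] (EFin \o (fun t => c * h t)).
  by move=> ih; apply: (@integrableZl _ _ _ mu _ _ c _ ih).
case: k => x y /=; congr (_ +i* _).
  rewrite -!RintegralZl // -RintegralB //; try exact: iZ.
  by apply: eq_Rintegral => t _; rewrite cReM.
rewrite -!RintegralZl // -RintegralD //; try exact: iZ.
by apply: eq_Rintegral => t _; rewrite cImM.
Qed.

Lemma cintN a b f : ccont_on a b f -> cI a b (fun t => - f t) = - cI a b f.
Proof.
by move=> cf; rewrite -mulN1r -cintZ //; apply: eq_cint => t _; rewrite mulN1r.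
Qed.

Lemma cintB a b f g : ccont_on a b f -> ccont_on a b g ->
  cI a b (fun t => f t - g t) = cI a b f - cI a b g.
Proof.
move=> cf cg; rewrite -cintN // -cintD //; move=> t /cg; exact: ccontN.
Qed.

Lemma cintJ a b f : ccont_on a b f ->
  cI a b (fun t => conjc (f t)) = conjc (cI a b f).
Proof.
move=> cf; rewrite /cintegral /=; congr (_ +i* _).
  by apply: eq_Rintegral => t _; rewrite cReJ.
rewrite -mulN1r -RintegralZl //; last exact/cont_on_integrable/ccont_on_Im.
by apply: eq_Rintegral => t _; rewrite mulN1r; case: (f t).
Qed.

Lemma cint_split a m b f : a <= m -> m <= b -> ccont_on a b f ->
  cI a b f = cI a m f + cI m b f.
Proof.
move=> am mb cf; rewrite /cintegral (Rint_split am mb) ?(Rint_split am mb (f := fun t => complex.Im (f t))) //.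
  exact: ccont_on_Im.
exact: ccont_on_Re.
Qed.

Lemma Re_cint a b f : complex.Re (cI a b f) =
  \int[mu]_(t in `[a, b]) complex.Re (f t).
Proof. by []. Qed.

Lemma cabs_unit k : exists2 w : C, cabs w = 1 & w * k = (cabs k)%:C.
Proof.
have [->|k0] := eqVneq k 0.
  by exists 1; rewrite ?cabs1 // mulr0 cabs0.
have ak0 : cabs k != 0 by rewrite cabs_eq0.
exists (conjc k / (cabs k)%:C).
  by rewrite cabsM cabsV cabsJ cabsR_ge0 ?cabs_ge0 // divff.
rewrite mulrAC [conjc k * k]mulrC mulcJ rmorphXn expr2 mulfK //.
by rewrite -(rmorph0 (real_complex R)) (inj_eq (@complexI _)).
Qed.

(** A unit factor [w] rotates the integral onto the nonnegative real axis, where it is the integral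
    of the real part of [w * f t]. *)
Lemma le_cabs_cint a b f : ccont_on a b f ->
  cabs (cI a b f) <= \int[mu]_(t in `[a, b]) cabs (f t).
Proof.
move=> cf; have [w w1 wI] := cabs_unit (cI a b f).
have cwf : ccont_on a b (fun t => w * f t).
  by move=> t /cf ct; apply: ccontM => //; exact: ccont_cst.
have -> : cabs (cI a b f) = complex.Re (cI a b (fun t => w * f t)).
  by rewrite cintZ // wI.
rewrite Re_cint; apply: le_Rintegral => //.
- exact/cont_on_integrable/ccont_on_Re.
- exact/cont_on_integrable/ccont_on_cabs.
by move=> t _; apply: le_trans (Re_le _) _; rewrite cabsM w1 mul1r.
Qed.

Lemma Rint_cst a b (c : R) : a <= b -> \int[mu]_(t in `[a, b]) c = c * (b - a).
Proof.
move=> ab; rewrite Rintegral_cst //= lebesgue_measure_itv /= lte_fin.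
case: ltP => // ba; have -> : a = b by apply/le_anti; rewrite ab ba.
by rewrite subrr.
Qed.

Lemma cint_cst a b k : a <= b -> cI a b (fun=> k) = (b - a)%:C * k.
Proof.
move=> ab; rewrite /cintegral !Rint_cst //; case: k => x y.
by apply/eqP; rewrite eq_complex /=; apply/andP; split; apply/eqP; ring.
Qed.

Lemma cabs_cint_le a b f (M : R) : a <= b -> ccont_on a b f ->
  (forall t, a <= t <= b -> cabs (f t) <= M) -> cabs (cI a b f) <= M * (b - a).
Proof.
move=> ab cf fM; apply: le_trans (le_cabs_cint cf) _.
rewrite -Rint_cst //; apply: le_Rintegral => //.
- exact/cont_on_integrable/ccont_on_cabs.
- by apply: cont_on_integrable => t _; exact: cst_continuous.
Qed.

Implicit Types (c : R -> C) (t : R) (l : C).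

Lemma is_rder_Re c t l : is_rder c t l ->
  is_derive t 1 (fun t => complex.Re (c t)) (complex.Re l).
Proof.
move=> [q [[cq] <- qE]].
have h : (fun h : R => h^-1 *: (((fun t => complex.Re (c t)) \o shift t) (h *: (1 : R))
    - complex.Re (c t))) @ 0^' --> complex.Re (q t).
  have cR : {for 0, continuous (fun h => complex.Re (q (h + t)))}.
    apply: (@continuous_comp _ _ _ (fun h => q (h + t))); last exact: continuous_Re.
    apply: (@continuous_comp _ _ _ (fun h => h + t)); last by rewrite add0r.
    by apply: continuousD; [exact: id|exact: cst_continuous].
  apply/cvgrPdist_lt => e e0; rewrite near_withinE.
  have /continuousRP/(_ _ e0) := cR; apply: filterS => h hd hn.
  move: hd; rewrite add0r distrC; congr (`|_ - _| < e).
  rewrite /= /shift /= -[h *: 1]/(h * 1) mulr1 (qE (h + t)) cReD addrK cReZ.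
  by rewrite [complex.Re (c t) + _]addrC addrK -[_ *: _]/(h^-1 * (h * _)) mulKf.
split; first by apply/cvg_ex; exists (complex.Re (q t)).
exact: cvg_lim.
Qed.

Lemma is_rder_mul c t l k : is_rder c t l -> is_rder (fun t => k * c t) t (k * l).
Proof.
move=> [q [cq <- qE]]; exists (fun t => k * q t); split=> [||x].
- by apply: ccontM => //; exact: ccont_cst.
- by [].
- by rewrite (qE x); ring.
Qed.

Lemma is_rder_Im c t l : is_rder c t l ->
  is_derive t 1 (fun t => complex.Im (c t)) (complex.Im l).
Proof.
move=> /(is_rder_mul (- 'i)) /is_rder_Re.
have E z : complex.Re (- 'i * z : C) = complex.Im z.
  by case: z => x y /=; ring.
rewrite E; congr is_derive; by apply/funext => u; rewrite E.
Qed.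

Lemma cint_FTC a b c f : a <= b -> ccont_on a b f ->
  (forall t, a <= t <= b -> is_rder c t (f t)) -> cI a b f = c b - c a.
Proof.
move=> ab cf dc; rewrite /cintegral.
have -> := Rint_FTC ab (ccont_on_Re cf) (fun t ht => is_rder_Re (dc t ht)).
have -> := Rint_FTC ab (ccont_on_Im cf) (fun t ht => is_rder_Im (dc t ht)).
by case: (c b); case: (c a).
Qed.

End ComplexIntegral.

(** * Goursat's theorem for star homotopies *)

Section Bisection.
Variable R : realType.
Local Notation C := (Cplx R).
Variables (Phi : R -> R -> R -> R -> C) (a b c d : R).
Hypotheses (ab : a <= b) (cd : c <= d).
Hypothesis Phi_split1 : forall x1 m x2 y1 y2,
  a <= x1 -> x1 <= m -> m <= x2 -> x2 <= b -> c <= y1 -> y1 <= y2 -> y2 <= d ->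
  Phi x1 x2 y1 y2 = Phi x1 m y1 y2 + Phi m x2 y1 y2.
Hypothesis Phi_split2 : forall x1 x2 y1 m y2,
  a <= x1 -> x1 <= x2 -> x2 <= b -> c <= y1 -> y1 <= m -> m <= y2 -> y2 <= d ->
  Phi x1 x2 y1 y2 = Phi x1 x2 y1 m + Phi x1 x2 m y2.
Hypothesis Phi_small : forall x y, a <= x <= b -> c <= y <= d ->
  forall e, 0 < e -> exists2 r, 0 < r & forall x1 x2 y1 y2,
    a <= x1 -> x1 <= x <= x2 -> x2 <= b -> c <= y1 -> y1 <= y <= y2 -> y2 <= d ->
    x2 - x1 < r -> y2 - y1 < r ->
    cabs (Phi x1 x2 y1 y2) <= e * (x2 - x1 + (y2 - y1)) ^+ 2.

Let w n : R := (b - a) / 2 ^+ n.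
Let h n : R := (d - c) / 2 ^+ n.

Let wS n : w n = w n.+1 + w n.+1.
Proof. rewrite /w exprS; field; exact: expf_neq0. Qed.

Let hS n : h n = h n.+1 + h n.+1.
Proof. rewrite /h exprS; field; exact: expf_neq0. Qed.

Let w_ge0 n : 0 <= w n.
Proof. by rewrite divr_ge0 ?subr_ge0 // exprn_ge0. Qed.

Let h_ge0 n : 0 <= h n.
Proof. by rewrite divr_ge0 ?subr_ge0 // exprn_ge0. Qed.

Let inside n (p : R * R) :=
  [/\ a <= p.1, p.1 + w n <= b, c <= p.2 & p.2 + h n <= d].

Let val n (p : R * R) := cabs (Phi p.1 (p.1 + w n) p.2 (p.2 + h n)).

Let nested n (p q : R * R) :=
  [/\ p.1 <= q.1, q.1 + w n.+1 <= p.1 + w n, p.2 <= q.2 &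
      q.2 + h n.+1 <= p.2 + h n].

Let step n p : inside n p ->
  exists q, [/\ inside n.+1 q, nested n p q & val n p <= 4 * val n.+1 q].
Proof.
case: p => x y [/= ax xb cy yd].
have wn := wS n; have hn := hS n; have w0 := w_ge0 n.+1; have h0 := h_ge0 n.+1.
have E : val n (x, y) <= val n.+1 (x, y) + val n.+1 (x + w n.+1, y)
    + (val n.+1 (x, y + h n.+1) + val n.+1 (x + w n.+1, y + h n.+1)).
  rewrite /val /=.
  rewrite (@Phi_split2 x _ y (y + h n.+1)); try lra.
  apply: le_trans (cabsD _ _) _; apply: lerD.
    rewrite (@Phi_split1 x (x + w n.+1)); try lra.
    apply: le_trans (cabsD _ _) _; apply: lerD => //.
    by rewrite wn addrA.
  rewrite (@Phi_split1 x (x + w n.+1)); try lra.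
  apply: le_trans (cabsD _ _) _; rewrite hn wn !addrA; exact: lerD.
have [h1|h1] := leP (val n (x, y)) (4 * val n.+1 (x, y)).
  by exists (x, y); split => //; split => /=; lra.
have [h2|h2] := leP (val n (x, y)) (4 * val n.+1 (x + w n.+1, y)).
  by exists (x + w n.+1, y); split => //; split => /=; lra.
have [h3|h3] := leP (val n (x, y)) (4 * val n.+1 (x, y + h n.+1)).
  by exists (x, y + h n.+1); split => //; split => /=; lra.
exists (x + w n.+1, y + h n.+1); split => //; try (split => /=; lra).
lra.
Qed.

(** Goursat's bisection. Some quarter of each rectangle carries at least a quarter of its value, so
    [4 ^+ n * val n] never drops below the initial value, while the nested rectangles shrink to a
    point at which [Phi_small] bounds the value by [e] times the square of the half-perimeter. *)
Lemma bisection_eq0 : Phi a b c d = 0.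
Proof.
apply/eqP; rewrite -cabs_eq0; apply: contraT => /negPf P0.
set P := cabs (Phi a b c d) in P0.
have {}P0 : 0 < P by rewrite lt_def P0 cabs_ge0.
pose next n p := xget p
  [set q | [/\ inside n.+1 q, nested n p q & val n p <= 4 * val n.+1 q]].
pose fix u n : R * R := if n is m.+1 then next m (u m) else (a, c).
have nextP n p : inside n p ->
    [/\ inside n.+1 (next n p), nested n p (next n p) &
        val n p <= 4 * val n.+1 (next n p)].
  move=> /step [q hq]; rewrite /next.
  by case: xgetP => [y _ []|/(_ q)/(_ hq)].
have w0E : w 0 = b - a by rewrite /w expr0 divr1.
have h0E : h 0 = d - c by rewrite /h expr0 divr1.
have ins n : inside n (u n).
  elim: n => [|n IH]; last by have [] := nextP n _ IH.
  by split => //=; rewrite ?w0E ?h0E addrC subrK.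
have nes n : nested n (u n) (u n.+1) by have [] := nextP n _ (ins n).
have big n : P <= 4 ^+ n * val n (u n).
  elim: n => [|n IH].
    by rewrite expr0 mul1r /val /= w0E h0E ![_ + (_ - _)]addrC !subrK.
  apply: le_trans IH _; rewrite exprSr -mulrA ler_pM2l ?exprn_gt0 //.
  by have [] := nextP n _ (ins n).
have mono n m : (n <= m)%N -> [/\ (u n).1 <= (u m).1,
    (u m).1 + w m <= (u n).1 + w n, (u n).2 <= (u m).2 &
    (u m).2 + h m <= (u n).2 + h n].
  move=> /subnKC <-; elim: (m - n)%N => [|k]; first by rewrite addn0.
  rewrite addnS; case=> i1 i2 i3 i4; have [j1 j2 j3 j4] := nes (n + k)%N.
  by split; [exact: le_trans j1|exact: le_trans i2|exact: le_trans j3|exact: le_trans i4].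
have below1 n m : (u m).1 <= (u n).1 + w n.
  have [nm|/ltnW mn] := leqP n m.
    have [_ h2 _ _] := mono _ _ nm; have := w_ge0 m; lra.
  have [h1 _ _ _] := mono _ _ mn; have := w_ge0 n; lra.
have below2 n m : (u m).2 <= (u n).2 + h n.
  have [nm|/ltnW mn] := leqP n m.
    have [_ _ _ h2] := mono _ _ nm; have := h_ge0 m; lra.
  have [_ _ h1 _] := mono _ _ mn; have := h_ge0 n; lra.
pose x := sup (range (fun n => (u n).1)).
pose y := sup (range (fun n => (u n).2)).
have xlo n : (u n).1 <= x.
  apply: ub_le_sup; last by exists n.
  by exists ((u 0%N).1 + w 0) => _ [m _ <-]; exact: below1.
have ylo n : (u n).2 <= y.
  apply: ub_le_sup; last by exists n.
  by exists ((u 0%N).2 + h 0) => _ [m _ <-]; exact: below2.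
have xhi n : x <= (u n).1 + w n.
  apply: ge_sup; first by exists (u 0%N).1, 0%N.
  by move=> _ [m _ <-]; exact: below1.
have yhi n : y <= (u n).2 + h n.
  apply: ge_sup; first by exists (u 0%N).2, 0%N.
  by move=> _ [m _ <-]; exact: below2.
have xab : a <= x <= b.
  by have := xlo 0%N; have := xhi 0%N; rewrite /= w0E; lra.
have ycd : c <= y <= d.
  by have := ylo 0%N; have := yhi 0%N; rewrite /= h0E; lra.
pose S := b - a + (d - c); have S0 : 0 <= S by rewrite /S; lra.
(* Scaled back by [4 ^+ n], the local bound becomes [e * S ^+ 2]. The added 1 makes this strictly
   smaller than [P] and keeps the denominator positive when the rectangle is degenerate. *)
pose e := P / (S ^+ 2 + 1).
have S1 : 0 < S ^+ 2 + 1 by have := sqr_ge0 S; lra.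
have e0 : 0 < e by rewrite divr_gt0.
have [r r0 rP] := Phi_small xab ycd e0.
have [n nP] : exists n, S < r * 2 ^+ n.
  have := archi_boundP (divr_ge0 S0 (ltW r0)).
  set n := Num.bound _ => nP; exists n.
  rewrite mulrC -ltr_pdivrMr //; apply: lt_trans nP _.
  by rewrite -natrX ltr_nat ltn_expl.
have p2 : 0 < 2 ^+ n :> R by rewrite exprn_gt0.
have wr : w n < r by rewrite ltr_pdivrMr //; move: nP; rewrite /S; lra.
have hr : h n < r by rewrite ltr_pdivrMr //; move: nP; rewrite /S; lra.
have [i1 i2 i3 i4] := ins n.
have := rP (u n).1 ((u n).1 + w n) (u n).2 ((u n).2 + h n).
rewrite ![_ + _ - _]addrAC !subrr !add0r xlo xhi ylo yhi.
move=> /(_ i1 isT i2 i3 isT i4 wr hr) => bnd.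
have : P <= e * S ^+ 2.
  apply: le_trans (big n) _.
  apply: le_trans (ler_wpM2l (exprn_ge0 _ _) bnd) _ => //.
  have -> : w n + h n = S / 2 ^+ n by rewrite /w /h /S; ring.
  rewrite expr_div_n -exprM mulnC exprM.
  have -> : 2 ^+ 2 = 4 :> R by ring.
  rewrite mulrCA [4 ^+ n * _]mulrC divfK // expf_neq0 //.
have : e * (S ^+ 2 + 1) = P by rewrite divfK // gt_eqF.
lra.
Qed.

End Bisection.

Section StarHomotopy.
Variable R : realType.
Local Notation C := (Cplx R).
Variables (z : C) (u u' : R -> C) (a b s0 s1 : R).
Hypotheses (ab : a <= b) (s0_ge0 : 0 <= s0) (s01 : s0 <= s1) (s1_le1 : s1 <= 1).
Hypothesis du : forall t, a <= t <= b -> is_rder u t (u' t).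
Hypothesis cu' : forall t, a <= t <= b -> ccont u' t.

Implicit Types (g : C -> C) (s t : R).

Let gam s t : C := z + s%:C * u t.

(* The integral of g(x) dx along the image under gam of the boundary of the
   parameter rectangle [x1, x2] * [y1, y2]. *)
Let Phi g x1 x2 y1 y2 : C :=
  cI y1 y2 (fun t => (g (gam x2 t) * x2%:C - g (gam x1 t) * x1%:C) * u' t)
  - cI x1 x2 (fun s => g (gam s y2) * u y2 - g (gam s y1) * u y1).

Let cgam1 s t : a <= t <= b -> ccont (gam s) t.
Proof.
move=> tab; apply: ccontD; first exact: ccont_cst.
apply: ccontM; first exact: ccont_cst.
exact: is_rder_ccont (du tab).
Qed.

Let cgam2 s t : ccont (fun s => gam s t) s.
Proof.
apply: ccontD; first exact: ccont_cst.
by apply: ccontM; [apply: ccont_RtoC|exact: ccont_cst].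
Qed.

Let gcont g := forall s t, s0 <= s <= s1 -> a <= t <= b -> ccont g (gam s t).

Let cont_side1 g x1 x2 y1 y2 : gcont g -> s0 <= x1 -> x1 <= x2 -> x2 <= s1 ->
  a <= y1 -> y2 <= b ->
  ccont_on y1 y2 (fun t => (g (gam x2 t) * x2%:C - g (gam x1 t) * x1%:C) * u' t).
Proof.
move=> cg h1 h2 h3 h4 h5 t tab; have tab' : a <= t <= b by lra.
apply: ccontM; last exact: cu'.
by apply: ccontB; (apply: ccontM; last exact: ccont_cst);
  apply: ccont_comp; try exact: cgam1; apply: cg => //; lra.
Qed.

Let cont_side2 g x1 x2 y1 y2 : gcont g -> s0 <= x1 -> x2 <= s1 ->
  a <= y1 -> y1 <= y2 -> y2 <= b ->
  ccont_on x1 x2 (fun s => g (gam s y2) * u y2 - g (gam s y1) * u y1).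
Proof.
move=> cg h1 h2 h3 h4 h5 s tab.
apply: ccontB; (apply: ccontM; last exact: ccont_cst).
  apply: (@ccont_comp _ _ _ (fun s => gam s y2)); try exact: cgam2.
  by apply: cg => //; lra.
apply: (@ccont_comp _ _ _ (fun s => gam s y1)); try exact: cgam2.
by apply: cg => //; lra.
Qed.

Let PhiD f g x1 x2 y1 y2 : gcont f -> gcont g ->
  s0 <= x1 -> x1 <= x2 -> x2 <= s1 -> a <= y1 -> y1 <= y2 -> y2 <= b ->
  Phi (fun x => f x + g x) x1 x2 y1 y2 = Phi f x1 x2 y1 y2 + Phi g x1 x2 y1 y2.
Proof.
move=> cf cg h1 h2 h3 h4 h5 h6; rewrite /Phi.
have -> (p q r s : C) : (p - q) + (r - s) = (p + r) - (q + s) by ring.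
rewrite -!cintD; try exact: cont_side1; try exact: cont_side2.
by congr (_ - _); apply: eq_cint => t _; ring.
Qed.

Let is_rder_u2 t : a <= t <= b ->
  is_rder (fun t => u t ^+ 2) t (2 * u t * u' t).
Proof.
move=> tab; apply: (is_rder_comp (g := fun x => x ^+ 2) (du tab)).
have -> : (fun x : C => x ^+ 2) = (fun x => x * x) by apply/funext => x; rewrite expr2.
have -> : 2 * u t = 1 * u t + u t * 1 by ring.
by apply: is_cderM; exact: is_cder_id.
Qed.

Let is_rder_s t : is_rder (fun s => s%:C) t 1.
Proof.
exists (fun=> 1); split; [exact: ccont_cst|by []|move=> x].
by rewrite mulr1 -rmorphD addrC subrK.
Qed.

Let is_rder_s2 t : is_rder (fun s => s%:C ^+ 2) t (2 * t%:C).
Proof.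
have := is_rder_comp (g := fun x => x ^+ 2) (@is_rder_s t).
move=> /(_ (2 * t%:C)); rewrite mulr1; apply.
have -> : (fun x : C => x ^+ 2) = (fun x => x * x) by apply/funext => x; rewrite expr2.
have -> : 2 * t%:C = 1 * t%:C + t%:C * 1 :> C by ring.
by apply: is_cderM; exact: is_cder_id.
Qed.

(** An affine integrand has a quadratic primitive, so both side integrals are evaluated in closed
    form, as increments of [F] and [H], and cancel. *)
Let Phi_affine (k l : C) x1 x2 y1 y2 :
  s0 <= x1 -> x1 <= x2 -> x2 <= s1 -> a <= y1 -> y1 <= y2 -> y2 <= b ->
  Phi (fun x => k + l * (x - z)) x1 x2 y1 y2 = 0.
Proof.
move=> h1 h2 h3 h4 h5 h6.
have E s t : k + l * (gam s t - z) = k + l * s%:C * u t.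
  by rewrite /gam addrAC subrr add0r mulrA.
rewrite /Phi.
pose X1 : C := x1%:C; pose X2 : C := x2%:C.
pose F t := (k * (X2 - X1)) * u t + (l * (X2 ^+ 2 - X1 ^+ 2) / 2) * (u t ^+ 2).
have -> : cI y1 y2 (fun t => ((k + l * (gam x2 t - z)) * x2%:C -
    (k + l * (gam x1 t - z)) * x1%:C) * u' t) = F y2 - F y1.
  apply: cint_FTC; [by []|move=> t tab|move=> t tab].
    have tab' : a <= t <= b by lra.
    apply: ccontM; last exact: cu'.
    by apply: ccontB; (apply: ccontM; last exact: ccont_cst);
      (apply: ccontD; first exact: ccont_cst);
      (apply: ccontM; first exact: ccont_cst);
      (apply: ccontB; last exact: ccont_cst); exact: cgam1.
  have tab' : a <= t <= b by lra.
  rewrite !E -/X1 -/X2.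
  have -> : ((k + l * X2 * u t) * X2 - (k + l * X1 * u t) * X1) * u' t =
    (k * (X2 - X1)) * u' t + (l * (X2 ^+ 2 - X1 ^+ 2) / 2) * (2 * u t * u' t).
    by field.
  have [p [cp pE pP]] := is_rder_mul (k * (X2 - X1)) (du tab').
  have [q [cq qE qP]] := is_rder_mul (l * (X2 ^+ 2 - X1 ^+ 2) / 2) (is_rder_u2 tab').
  exists (fun t => p t + q t); split; [exact: ccontD|by rewrite pE qE|move=> x].
  by rewrite /F pP qP; ring.
pose H (s : R) := (k * (u y2 - u y1)) * s%:C
  + (l * (u y2 ^+ 2 - u y1 ^+ 2) / 2) * (s%:C ^+ 2) : C.
have -> : cI x1 x2 (fun s => (k + l * (gam s y2 - z)) * u y2 -
    (k + l * (gam s y1 - z)) * u y1) = H x2 - H x1.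
  apply: cint_FTC; [by []|move=> s sab|move=> s sab].
    apply: ccontB; (apply: ccontM; last exact: ccont_cst);
      (apply: ccontD; first exact: ccont_cst);
      (apply: ccontM; first exact: ccont_cst);
      (apply: ccontB; last exact: ccont_cst); exact: cgam2.
  rewrite !E.
  have -> : (k + l * s%:C * u y2) * u y2 - (k + l * s%:C * u y1) * u y1 =
    (k * (u y2 - u y1)) * 1 + (l * (u y2 ^+ 2 - u y1 ^+ 2) / 2) * (2 * s%:C).
    by field.
  have [p [cp pE pP]] := is_rder_mul (k * (u y2 - u y1)) (is_rder_s s).
  have [q [cq qE qP]] := is_rder_mul (l * (u y2 ^+ 2 - u y1 ^+ 2) / 2) (is_rder_s2 s).
  exists (fun t => p t + q t); split; [exact: ccontD|by rewrite pE qE|move=> x].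
  by rewrite /H pP qP; ring.
by rewrite /F /H -/X1 -/X2; field.
Qed.

Let bound : exists2 L, 1 <= L & forall t, a <= t <= b -> cabs (u t) <= L /\ cabs (u' t) <= L.
Proof.
have cu : ccont_on a b u by move=> t /du; exact: is_rder_ccont.
have [t1 _ h1] := EVT_max ab (cont_on_within (ccont_on_cabs cu)).
have [t2 _ h2] := EVT_max ab (cont_on_within (ccont_on_cabs cu')).
have i1 := cabs_ge0 (u t1); have i2 := cabs_ge0 (u' t2).
exists (1 + cabs (u t1) + cabs (u' t2)); first by lra.
move=> t tab; have := h1 t; have := h2 t; rewrite in_itv /= tab.
by move=> /(_ isT) k1 /(_ isT) k2; split; lra.
Qed.

Let lipschitz L s t : (forall t, a <= t <= b -> cabs (u t) <= L /\ cabs (u' t) <= L) ->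
  a <= s -> s <= t -> t <= b -> cabs (u t - u s) <= L * (t - s).
Proof.
move=> hL h1 h2 h3; rewrite -(cint_FTC (f := u')); [|by []| |].
- by apply: cabs_cint_le; [by []|move=> v vab; apply: cu'|move=> v vab; apply: (hL _ _).2]; lra.
- by move=> v vab; apply: cu'; lra.
- by move=> v vab; apply: du; lra.
Qed.

(** Each integrand is a difference of two terms of modulus at most [m * L], the parameters [s] being
    at most 1; hence the factor 2. *)
Let Phi_bound g (L m : R) x1 x2 y1 y2 : gcont g -> 0 <= L -> 0 <= m ->
  (forall t, a <= t <= b -> cabs (u t) <= L /\ cabs (u' t) <= L) ->
  s0 <= x1 -> x1 <= x2 -> x2 <= s1 -> a <= y1 -> y1 <= y2 -> y2 <= b ->
  (forall s t, x1 <= s <= x2 -> y1 <= t <= y2 -> cabs (g (gam s t)) <= m) ->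
  cabs (Phi g x1 x2 y1 y2) <= 2 * m * L * (x2 - x1 + (y2 - y1)).
Proof.
have H0 := s0_ge0; have H1 := s01; have H2 := s1_le1.
move=> cg L0 m0 hL h1 h2 h3 h4 h5 h6 gm; rewrite /Phi.
apply: le_trans (ler_cabsB _ _) _.
have k1 : cabs (cI y1 y2 (fun t => (g (gam x2 t) * x2%:C - g (gam x1 t) * x1%:C)
    * u' t)) <= (2 * m * L) * (y2 - y1).
  apply: cabs_cint_le; [by []|exact: cont_side1|move=> t tab]; rewrite cabsM; apply: ler_pM; rewrite ?cabs_ge0 //; last first.
    by apply: (hL _ _).2; lra.
  apply: le_trans (ler_cabsB _ _) _; rewrite !cabsM !cabsR_ge0; try lra.
  have -> : 2 * m = m * 1 + m * 1 by ring.
  by apply: lerD; apply: ler_pM; rewrite ?cabs_ge0 //; try lra;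
    apply: gm; lra.
have k2 : cabs (cI x1 x2 (fun s => g (gam s y2) * u y2 - g (gam s y1) * u y1)) <=
    (2 * m * L) * (x2 - x1).
  apply: cabs_cint_le; [by []|exact: cont_side2|move=> s sab]; apply: le_trans (ler_cabsB _ _) _; rewrite !cabsM.
  have -> : 2 * m * L = m * L + m * L by ring.
  apply: lerD; apply: ler_pM; rewrite ?cabs_ge0 //; try (apply: gm; lra).
    by apply: (hL _ _).1; lra.
  by apply: (hL _ _).1; lra.
by rewrite mulrDr addrC lerD.
Qed.

(** The sides [t = a] and [t = b] of the parameter rectangle have the same image because the curve
    is closed, so the vanishing of [Phi] compares the two remaining sides. Smallness of [Phi] at a
    point follows by splitting [g] into its affine part [A], which contributes 0, and an error [E]
    that is small compared with the distance. *)
Lemma star_homotopy g :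
  (forall s t, s0 <= s <= s1 -> a <= t <= b -> exists l, is_cder g (gam s t) l) ->
  u a = u b ->
  cI a b (fun t => g (gam s1 t) * s1%:C * u' t) =
  cI a b (fun t => g (gam s0 t) * s0%:C * u' t).
Proof.
have H0 := s0_ge0; have H1 := s01; have H2 := s1_le1; have Hab := ab.
move=> dg uab.
have cg : gcont g by move=> s t hs ht; have [l] := dg s t hs ht; exact: is_cder_ccont.
have [L L1 hL] := bound.
suff : Phi g s0 s1 a b = 0.
  rewrite /Phi uab.
  have -> : cI s0 s1 (fun s => g (gam s b) * u b - g (gam s a) * u b) = 0.
    rewrite -[RHS](mulr0 (s1 - s0)%:C) -cint_cst //; apply: eq_cint => s _.
    by rewrite /gam uab subrr.
  rewrite subr0 => /eqP; rewrite -subr_eq0 => /eqP E; apply/eqP.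
  rewrite -subr_eq0 -E subr0 -cintB.
  - by apply/eqP; apply: eq_cint => t _; ring.
  - move=> t tab; apply: ccontM; last exact: cu'.
    apply: ccontM; last exact: ccont_cst.
    apply: ccont_comp; [exact: cgam1|apply: cg => //; lra].
  - move=> t tab; apply: ccontM; last exact: cu'.
    apply: ccontM; last exact: ccont_cst.
    apply: ccont_comp; [exact: cgam1|apply: cg => //; lra].
apply: (bisection_eq0 s01 ab).
- move=> x1 m x2 y1 y2 h1 h2 h3 h4 h5 h6 h7; rewrite /Phi.
  have -> (p q r s : C) : (p - q) + (r - s) = (p + r) - (q + s) by ring.
  congr (_ - _); last by apply: cint_split; [by []|by []|apply: cont_side2; [by []|lra..]].
  rewrite -cintD.
  - by apply: eq_cint => t _; ring.
  - by apply: cont_side1; [by []|lra..].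
  - by apply: cont_side1; [by []|lra..].
- move=> x1 x2 y1 m y2 h1 h2 h3 h4 h5 h6 h7; rewrite /Phi.
  have -> (p q r s : C) : (p - q) + (r - s) = (p + r) - (q + s) by ring.
  congr (_ - _); first by apply: cint_split; [by []|by []|apply: cont_side1; [by []|lra..]].
  rewrite -cintD.
  - by apply: eq_cint => t _; ring.
  - by apply: cont_side2; [by []|lra..].
  - by apply: cont_side2; [by []|lra..].
move=> x y hx hy e e0.
have [l [q [cq ql qE]]] := dg x y hx hy; set p0 := gam x y in cq ql qE.
(* [Phi_bound] costs a factor [2 * L], and the distance of [gam s t] from [p0] another [L]. *)
pose e1 := e / (2 * L * L).
have L0 : 0 < L by lra.
have LL : 0 < 2 * L * L by rewrite !mulr_gt0.
have e10 : 0 < e1 by rewrite divr_gt0.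
have /ccontP/(_ _ e10)/nbhsCP[d d0 dP] := cq.
exists (d / (2 * L)); first by rewrite divr_gt0 ?mulr_gt0.
move=> x1 x2 y1 y2 h1 h2 h3 h4 h5 h6 hd1 hd2.
have d2 : L * (x2 - x1 + (y2 - y1)) < d.
  move: hd1 hd2; rewrite !ltr_pdivlMr ?mulr_gt0 // => hd1 hd2.
  lra.
pose A v := g p0 - l * (p0 - z) + l * (v - z).
pose E v := (v - p0) * (q v - l).
have cA : gcont A.
  move=> s t _ _; apply: ccontD; first exact: ccont_cst.
  apply: ccontM; first exact: ccont_cst.
  by apply: ccontB; [exact: ccont_id|exact: ccont_cst].
have gAE : g = (fun v => A v + E v).
  by apply/funext => v; rewrite qE /A /E; ring.
have cE : gcont E.
  have -> : E = (fun v => g v - A v).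
    by apply/funext => v; rewrite {1}gAE addrC addKr.
  by move=> s t hs ht; apply: ccontB; [exact: cg|exact: cA].
rewrite {1}gAE PhiD; [|by []|by []|lra..].
rewrite Phi_affine ?add0r; [|lra..].
have -> : e * (x2 - x1 + (y2 - y1)) ^+ 2 =
   2 * (e1 * (L * (x2 - x1 + (y2 - y1)))) * L * (x2 - x1 + (y2 - y1)).
  by rewrite /e1; field; rewrite gt_eqF.
apply: Phi_bound; [by []|lra| |by []|lra..|].
  by apply: mulr_ge0; [lra|apply: mulr_ge0; lra].
move=> s t hs ht.
have dist : cabs (gam s t - p0) <= L * (x2 - x1 + (y2 - y1)).
  have -> : gam s t - p0 = (s - x)%:C * u t + x%:C * (u t - u y).
    by rewrite /p0 /gam rmorphB; ring.
  apply: le_trans (cabsD _ _) _; rewrite !cabsM !cabsR mulrDr; apply: lerD.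
    rewrite mulrC; apply: ler_pM; rewrite ?cabs_ge0 //.
      by apply: (hL _ _).1; lra.
    by rewrite ler_norml; lra.
  rewrite -[leRHS]mul1r; apply: ler_pM; rewrite ?cabs_ge0 //.
    by rewrite ger0_norm; lra.
  have [ty|/ltW ty] := leP t y.
    rewrite cabsB; apply: le_trans (lipschitz hL _ ty _) _; try lra.
    by rewrite ler_pM2l //; lra.
  apply: le_trans (lipschitz hL _ ty _) _; try lra.
  by rewrite ler_pM2l //; lra.
rewrite /E cabsM mulrC; apply: ler_pM; rewrite ?cabs_ge0 //.
by rewrite -ql; apply/ltW/dP; apply: le_lt_trans dist d2.
Qed.

End StarHomotopy.

(** * Cauchy's formula and its consequences *)

Ltac feed H := match type of H with ?A -> _ =>
  let h := fresh in assert (h : A); [|specialize (H h); clear h] end.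

Lemma cconjM (R : realType) (x y : Cplx R) : conjc (x * y) = conjc x * conjc y.
Proof. exact: rmorphM. Qed.

Lemma cconjD (R : realType) (x y : Cplx R) : conjc (x + y) = conjc x + conjc y.
Proof. exact: rmorphD. Qed.

Lemma cconjB (R : realType) (x y : Cplx R) : conjc (x - y) = conjc x - conjc y.
Proof. exact: rmorphB. Qed.

Lemma cconjX (R : realType) (x : Cplx R) n : conjc (x ^+ n) = conjc x ^+ n.
Proof. exact: rmorphXn. Qed.

Section UnitCircle.
Variable R : realType.
Local Notation C := (Cplx R).
Implicit Types (s t : R).

Lemma cabs_expi t : cabs (expi t) = 1.
Proof. by rewrite /cabs /expi /= cos2Dsin2 sqrtr1. Qed.

Lemma expi_neq0 t : expi t != 0 :> C.
Proof. by rewrite -cabs_eq0 cabs_expi oner_eq0. Qed.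

Lemma expi0 : expi 0 = 1 :> C.
Proof. by rewrite /expi cos0 sin0. Qed.

Lemma expi2pi : expi (2 * pi) = 1 :> C.
Proof. by rewrite /expi mulr_natl cos2pi sin2pi. Qed.

Lemma conj_expi t : conjc (expi t) = (expi t)^-1 :> C.
Proof.
apply: (mulfI (expi_neq0 t)).
by rewrite mulcJ cabs_expi expr1n divff // expi_neq0.
Qed.

Lemma is_rder_expi t : is_rder (@expi R) t ('i * expi t).
Proof.
have [p [pE cp pt]] := (is_derive1_caratheodory _ _ _).1 (is_derive_cos t).
have [q [qE cq qt]] := (is_derive1_caratheodory _ _ _).1 (is_derive_sin t).
exists (fun x => p x +i* q x); split.
- by split; exact: continuous_ReIm.
- rewrite pt qt /expi; apply/eqP; rewrite eq_complex /=.
  by apply/andP; split; apply/eqP; ring.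
- move=> x; rewrite /expi; apply/eqP; rewrite eq_complex /=.
  have -> : cos x = cos t + p x * (x - t) by rewrite -pE addrC subrK.
  have -> : sin x = sin t + q x * (x - t) by rewrite -qE addrC subrK.
  by apply/andP; split; apply/eqP; ring.
Qed.

Lemma ccont_expi t : ccont (@expi R) t.
Proof. exact: is_rder_ccont (is_rder_expi t). Qed.

Lemma pi2_ge0 : 0 <= 2 * pi :> R.
Proof. by rewrite mulr_ge0 // pi_ge0. Qed.

Lemma pi2_neq0 : (2 * pi)%:C != 0 :> C.
Proof. by rewrite -cabs_eq0 cabsR_ge0 ?pi2_ge0 // mulf_neq0 // gt_eqF // pi_gt0. Qed.

End UnitCircle.

Section CauchyDisc.
Variable R : realType.
Local Notation C := (Cplx R).
Implicit Types (F G : C -> C) (a v w x : C) (r rho M : R).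

Definition hol F x := exists l, is_cder F x l.

Lemma hol_ccont F x : hol F x -> ccont F x.
Proof. by case=> l; exact: is_cder_ccont. Qed.

Lemma hol_near F G x : (\forall y \near x, F y = G y) -> hol F x -> hol G x.
Proof. by move=> FG [l dF]; exists l; exact: is_cder_near dF. Qed.

Lemma hol_cst (k : C) x : hol (fun=> k) x.
Proof. by exists 0; exact: is_cder_cst. Qed.

Lemma hol_id x : hol id x.
Proof. by exists 1; exact: is_cder_id. Qed.

Lemma holD F G x : hol F x -> hol G x -> hol (fun y => F y + G y) x.
Proof. by move=> [l dF] [m dG]; exists (l + m); exact: is_cderD. Qed.

Lemma holM F G x : hol F x -> hol G x -> hol (fun y => F y * G y) x.
Proof. by move=> [l dF] [m dG]; eexists; exact: is_cderM dF dG. Qed.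

Lemma holN F x : hol F x -> hol (fun y => - F y) x.
Proof.
move=> dF; have -> : (fun y => - F y) = (fun y => -1 * F y).
  by apply/funext => y; rewrite mulN1r.
by apply: holM => //; exact: hol_cst.
Qed.

Lemma holB F G x : hol F x -> hol G x -> hol (fun y => F y - G y) x.
Proof. by move=> dF dG; apply: holD => //; exact: holN. Qed.

Lemma holV F x : F x != 0 -> hol F x -> hol (fun y => (F y)^-1) x.
Proof. by move=> F0 [l dF]; eexists; exact: is_cderV dF. Qed.

Lemma holX F n x : hol F x -> hol (fun y => F y ^+ n) x.
Proof.
move=> dF; elim: n => [|n IH]; first exact: hol_cst.
have -> : (fun y => F y ^+ n.+1) = (fun y => F y * F y ^+ n).
  by apply/funext => y; rewrite exprS.
exact: holM.
Qed.

Lemma hol_comp F G x : hol F x -> hol G (F x) -> hol (fun y => G (F y)) x.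
Proof. by move=> [l dF] [m dG]; eexists; exact: is_cder_comp dF dG. Qed.

Lemma eq0_of_le (x : C) (K : R) :
  (forall e, 0 < e -> cabs x <= e * K) -> x = 0.
Proof.
move=> xK; apply/eqP; rewrite -cabs_eq0 eq_le cabs_ge0 andbT.
have K0 : 0 <= K by have := xK 1 ltr01; rewrite mul1r; apply: le_trans; exact: cabs_ge0.
apply/ler_addgt0Pr => e e0; rewrite add0r.
have K1 : 0 < K + 1 by lra.
apply: le_trans (xK (e / (K + 1)) _) _; first by rewrite divr_gt0.
rewrite mulrAC ler_pdivrMr // ler_pM2l //; lra.
Qed.

Lemma bounded_on (f : R -> C) (a b : R) : a <= b -> ccont_on a b f ->
  exists2 M, 0 < M & forall t, a <= t <= b -> cabs (f t) <= M.
Proof.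
move=> ab cf; have [t1 _ h1] := EVT_max ab (cont_on_within (ccont_on_cabs cf)).
exists (1 + cabs (f t1)); first by have := cabs_ge0 (f t1); lra.
by move=> t tab; have := h1 t; rewrite in_itv /= tab => /(_ isT); lra.
Qed.

(** For the integrand [F x / (x - z)] the scaling factor [s] cancels against [u' / u], so the
    integral over the curve contracted by [s] is the same for all [s] in [(0, 1]]. As [s] tends to
    0, [F] tends uniformly to [F z] along the curve; the winding integral stays as an unevaluated
    factor. *)
Lemma star_cauchy (z : C) (u u' : R -> C) (a b : R) F : a <= b ->
  (forall t, a <= t <= b -> is_rder u t (u' t)) -> ccont_on a b u' ->
  (forall t, a <= t <= b -> u t != 0) -> u a = u b ->
  (forall s t, 0 <= s <= 1 -> a <= t <= b -> hol F (z + s%:C * u t)) ->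
  cI a b (fun t => F (z + u t) * (u' t / u t)) =
  F z * cI a b (fun t => u' t / u t).
Proof.
move=> ab du cu' u0 uab dF.
have cu : ccont_on a b u by move=> t /du; exact: is_rder_ccont.
have cq : ccont_on a b (fun t => u' t / u t).
  move=> t tab; apply: ccontM; first exact: cu'.
  by apply: ccontV; [exact: u0|exact: cu].
have cF s : 0 <= s <= 1 -> ccont_on a b (fun t => F (z + s%:C * u t)).
  move=> hs t tab; apply: ccont_comp; last exact: hol_ccont (dF _ _ hs tab).
  apply: ccontD; first exact: ccont_cst.
  by apply: ccontM; [exact: ccont_cst|exact: cu].
have hom s : 0 < s -> s <= 1 -> cI a b (fun t => F (z + u t) * (u' t / u t)) =
    cI a b (fun t => F (z + s%:C * u t) * (u' t / u t)).
  move=> s0 s1.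
  have SH := star_homotopy (z := z) ab (ltW s0) s1 (lexx 1) du cu'
    (g := fun x => F x / (x - z)).
  feed SH.
    move=> s' t hs' tab; apply: holM; first by apply: dF => //; lra.
    apply: holV; last by apply: holB; [exact: hol_id|exact: hol_cst].
    rewrite addrAC subrr add0r mulf_neq0 ?u0 //.
    by rewrite -cabs_eq0 cabsR_ge0; lra.
  have := SH uab.
  have E s' : s' != 0 -> cI a b (fun t => F (z + s'%:C * u t)
      / (z + s'%:C * u t - z) * s'%:C * u' t) =
      cI a b (fun t => F (z + s'%:C * u t) * (u' t / u t)).
    move=> s'0; apply: eq_cint => t tab.
    rewrite addrAC subrr add0r; field.
    by rewrite u0 //= (inj_eq (@complexI _)).
  rewrite !E ?oner_eq0 ?gt_eqF // => <-.
  by apply: eq_cint => t _; rewrite mul1r.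
have [L L0 hL] := bounded_on ab cu.
have [M M0 hM] := bounded_on ab cq.
apply/eqP; rewrite -subr_eq0; apply/eqP.
apply: (@eq0_of_le _ (M * (b - a))) => e e0.
have aab : a <= a <= b by rewrite lexx.
have cFz : ccont F z.
  have := dF 0 a; rewrite mul0r addr0 lexx ler01 => /(_ isT aab); exact: hol_ccont.
have /ccontP/(_ _ e0)/nbhsCP[d d0 dP] := cFz.
(* With [L] bounding the curve, the contracted curve lies in the disc of radius [d] on which [F]
   differs from [F z] by less than [e]. *)
pose s := Num.min 1 (d / (2 * L)).
have s0 : 0 < s by rewrite lt_min ltr01 divr_gt0 ?mulr_gt0.
have s1 : s <= 1 by rewrite ge_min lexx.
have sd : s * L < d.
  have : s <= d / (2 * L) by rewrite ge_min lexx orbT.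
  by rewrite ler_pdivlMr ?mulr_gt0 //; lra.
have hs : 0 <= s <= 1 by rewrite ltW.
have cFs : ccont_on a b (fun t => F (z + s%:C * u t) * (u' t / u t)).
  by move=> t tab; apply: ccontM; [exact: cF|exact: cq].
rewrite (hom s) // -cintZ // -cintB //; last first.
  by move=> t tab; apply: ccontM; [exact: ccont_cst|exact: cq].
rewrite mulrA; apply: cabs_cint_le => // [t tab|t tab].
  by apply: ccontB; [exact: cFs|apply: ccontM; [exact: ccont_cst|exact: cq]].
rewrite -mulrBl cabsM; apply: ler_pM; rewrite ?cabs_ge0 //; last exact: hM.
apply/ltW/dP; rewrite addrAC subrr add0r cabsM cabsR_ge0; last exact: ltW.
by apply: le_lt_trans sd; rewrite ler_pM2l // hL.
Qed.

Lemma is_rder_circle rho v t :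
  is_rder (fun t => rho%:C * expi t - v) t ('i * (rho%:C * expi t)).
Proof.
have [q [cq qt qE]] := is_rder_mul rho%:C (is_rder_expi t).
exists q; split=> [//||x]; first by rewrite qt; ring.
by rewrite (qE x); ring.
Qed.

Lemma cabs_circle rho t : 0 <= rho -> cabs (rho%:C * expi t) = rho.
Proof. by move=> r0; rewrite cabsM cabs_expi mulr1 cabsR_ge0. Qed.

Lemma ccont_circle rho t : ccont (fun t => rho%:C * expi t) t.
Proof. by apply: ccontM; [exact: ccont_cst|exact: ccont_expi]. Qed.

Lemma i_neq0 : ('i : C) != 0.
Proof. by rewrite -cabs_eq0 cabs_i oner_eq0. Qed.

(** The circle is contracted towards [a + v] instead of its centre; convexity keeps the contraction
    in the closed disc. The weight integral on the right is evaluated later, by the mean value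
    property, which needs only [v = 0]. *)
Lemma cauchy_pre F a rho v : cabs v < rho ->
  (forall x, cabs (x - a) <= rho -> hol F x) ->
  cI 0 (2 * pi) (fun t => F (a + rho%:C * expi t) *
     (rho%:C * expi t / (rho%:C * expi t - v))) =
  F (a + v) *
    cI 0 (2 * pi) (fun t => rho%:C * expi t / (rho%:C * expi t - v)).
Proof.
move=> vr dF; have r0 : 0 < rho by apply: le_lt_trans vr; exact: cabs_ge0.
pose u t : C := rho%:C * expi t.
have uv t : u t - v != 0.
  rewrite -cabs_gt0; apply: lt_le_trans (le_cabsB _ _).
  by rewrite cabs_circle ?ltW // subr_gt0.
have cu t : ccont u t by exact: ccont_circle.
have cq t : ccont (fun t => u t / (u t - v)) t.
  apply: ccontM; first exact: cu.
  by apply: ccontV; [exact: uv|apply: ccontB; [exact: cu|exact: ccont_cst]].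
have SC := @star_cauchy (a + v) (fun t => u t - v) (fun t => 'i * u t) 0 (2 * pi) F
  (pi2_ge0 R).
feed SC; last feed SC; last feed SC; last feed SC; last feed SC.
- by move=> t _; exact: is_rder_circle.
- by move=> t _; apply: ccontM => //; exact: ccont_cst.
- by move=> t _; exact: uv.
- by rewrite /u expi0 expi2pi.
- move=> s t hs _; apply: dF.
  have -> : a + v + s%:C * (u t - v) - a = (1 - s)%:C * v + s%:C * u t.
    by rewrite rmorphB; ring.
  apply: le_trans (cabsD _ _) _.
  rewrite cabsM [cabs (s%:C * _)]cabsM (cabs_circle _ (ltW r0)).
  rewrite !cabsR_ge0; try lra.
  have sv : (1 - s) * cabs v <= (1 - s) * rho by apply: ler_wpM2l; lra.
  by apply: le_trans (lerD sv (lexx _)) _; rewrite -mulrDl subrK mul1r.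
move: SC; have -> : (fun t => F (a + v + (u t - v)) * ('i * u t / (u t - v))) =
    (fun t => 'i * (F (a + u t) * (u t / (u t - v)))).
  apply/funext => t; have -> : a + v + (u t - v) = a + u t by ring.
  by ring.
have -> : (fun t => 'i * u t / (u t - v)) = (fun t => 'i * (u t / (u t - v))).
  by apply/funext => t; rewrite -mulrA.
rewrite !cintZ.
- by rewrite mulrCA => /(mulfI i_neq0).
- by move=> t _; exact: cq.
- move=> t _; apply: ccontM => //; apply: (@ccont_comp _ _ _ (fun t => a + u t)).
    by apply: ccontD => //; exact: ccont_cst.
  by apply/hol_ccont/dF; rewrite addrAC subrr add0r cabs_circle // ltW.
Qed.

Lemma mean_value F a rho : 0 < rho ->
  (forall x, cabs (x - a) <= rho -> hol F x) ->
  cI 0 (2 * pi) (fun t => F (a + rho%:C * expi t)) = (2 * pi)%:C * F a.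
Proof.
move=> r0 dF; have v0 : cabs (0 : C) < rho by rewrite cabs0.
have := cauchy_pre v0 dF; rewrite addr0.
have E t : rho%:C * expi t / (rho%:C * expi t - 0) = 1 :> C.
  by rewrite subr0 divff // -cabs_eq0 cabs_circle ?gt_eqF // ltW.
have -> : (fun t => F (a + rho%:C * expi t) *
    (rho%:C * expi t / (rho%:C * expi t - 0))) = (fun t => F (a + rho%:C * expi t)).
  by apply/funext => t; rewrite E mulr1.
have -> : (fun t : R => rho%:C * expi t / (rho%:C * expi t - 0)) = (fun=> 1 : C).
  by apply/funext => t; rewrite E.
by move=> ->; rewrite cint_cst ?pi2_ge0 // subr0 mulr1 mulrC.
Qed.

(* The integrand is the conjugate of [1 / (1 - v^* x / rho^2)] on the circle,
   and the latter is holomorphic on the disc. *)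
Lemma cauchy_weight rho v : cabs v < rho ->
  cI 0 (2 * pi) (fun t => rho%:C * expi t / (rho%:C * expi t - v)) = (2 * pi)%:C.
Proof.
move=> vr; have r0 : 0 < rho by apply: le_lt_trans vr; exact: cabs_ge0.
pose F x : C := (1 - conjc v * x / (rho ^+ 2)%:C)^-1.
have rC : rho%:C != 0 :> C by rewrite (inj_eq (@complexI _)) gt_eqF.
have D0 x : cabs (x - 0) <= rho -> 1 - conjc v * x / (rho ^+ 2)%:C != 0.
  rewrite subr0 => xr; rewrite -cabs_gt0; apply: lt_le_trans (le_cabsB _ _).
  rewrite cabs1 subr_gt0 !cabsM cabsV cabsJ cabsR_ge0 ?sqr_ge0 //.
  rewrite ltr_pdivrMr ?exprn_gt0 // mul1r expr2.
  by apply: le_lt_trans (ler_wpM2l (cabs_ge0 _) xr) _; rewrite ltr_pM2r.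
have mv := @mean_value F 0 rho r0; feed mv.
  move=> x xr; apply: holV; first exact: D0.
  apply: holB; first exact: hol_cst.
  apply: holM; last exact: hol_cst.
  by apply: holM; [exact: hol_cst|exact: hol_id].
rewrite {2}/F mulr0 mul0r subr0 invr1 mulr1 in mv.
have := congr1 (@conjc R) mv; rewrite conjc_real => <-.
rewrite -cintJ; last first.
  move=> t _; apply: ccontV.
    by apply: D0; rewrite subr0 add0r cabs_circle // ltW.
  apply: ccontB; first exact: ccont_cst.
  apply: ccontM; last exact: ccont_cst.
  apply: ccontM; first exact: ccont_cst.
  by apply: ccontD; [exact: ccont_cst|exact: ccont_circle].
apply: eq_cint => t _; rewrite /F add0r.
rewrite conjc_inv cconjB conjc1 !cconjM conjcK conjc_inv !conjc_real conj_expi.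
have e0 : expi t != 0 :> C by exact: expi_neq0.
have vt : rho%:C * expi t - v != 0.
  rewrite -cabs_gt0; apply: lt_le_trans (le_cabsB _ _).
  by rewrite cabs_circle ?ltW // subr_gt0.
rewrite rmorphXn /=.
have -> : 1 - v * (rho%:C * (expi t)^-1) / rho%:C ^+ 2 =
   (rho%:C * expi t - v) / (rho%:C * expi t) by field; rewrite rC e0.
by rewrite invf_div.
Qed.

Lemma cauchy_disc F a rho v : cabs v < rho ->
  (forall x, cabs (x - a) <= rho -> hol F x) ->
  cI 0 (2 * pi) (fun t => F (a + rho%:C * expi t) *
     (rho%:C * expi t / (rho%:C * expi t - v))) = (2 * pi)%:C * F (a + v).
Proof. by move=> vr dF; rewrite cauchy_pre // cauchy_weight // mulrC. Qed.

End CauchyDisc.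

(** * Removable singularities, estimates of derivatives, maximum and minimum principles *)

Section LocalTheory.
Variable R : realType.
Local Notation C := (Cplx R).
Implicit Types (F G : C -> C) (a v w x : C) (r rho M : R).

Lemma hol_is_cder F x : hol F x -> is_cder F x ('D_1 F x).
Proof. by case=> l dF; have /is_cderP[_ ->] := dF. Qed.

Lemma is_cder_derive F x l : is_cder F x l -> 'D_1 F x = l.
Proof.
move=> dF; have h : hol F x by exists l.
exact: is_cder_unique (hol_is_cder h) dF.
Qed.

Lemma near_disc x r : 0 < r -> \forall y \near x, cabs (y - x) < r.
Proof. by move=> r0; apply/nbhsCP; exists r. Qed.

Lemma near_neq x y : x != y -> \forall u \near x, u != y.
Proof.
rewrite -subr_eq0 -cabs_gt0 => xy; apply: filterS (near_disc x xy) => u.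
by apply: contraTneq => ->; rewrite cabsB ltxx.
Qed.

(** [F1] is the slope of [F] at [a]. Away from [a] it is a quotient; at [a] its differentiability is
    the analyticity of [F] to second order, obtained by expanding the Cauchy kernel twice. This
    replaces power series in what follows. *)
Lemma hol_factor F a r : 0 < r -> (forall x, cabs (x - a) < r -> hol F x) ->
  exists2 F1 : C -> C, (forall x, F x = F a + (x - a) * F1 x) &
    ccont F1 a /\ forall x, hol F x -> hol F1 x.
Proof.
move=> r0 dF.
have [q [cq qa qE]] : is_cder F a ('D_1 F a).
  by apply/hol_is_cder/dF; rewrite subrr cabs0.
exists q => //; split => // x dFx.
have [->|xa] := eqVneq x a; last first.
  apply: (@hol_near _ (fun y => (F y - F a) / (y - a))).
    apply: filterS (near_neq xa) => y ya; rewrite (qE y) [F a + _]addrC addrK.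
    by rewrite mulrC mulKf // subr_eq0.
  apply: holM; first by apply: holB => //; exact: hol_cst.
  apply: holV; first by rewrite subr_eq0.
  by apply: holB; [exact: hol_id|exact: hol_cst].
pose rho := r / 2; have rho0 : 0 < rho by rewrite divr_gt0.
have rhor : rho < r by rewrite /rho; lra.
have dF' y : cabs (y - a) <= rho -> hol F y.
  by move=> h; apply: dF; apply: le_lt_trans rhor.
pose u t : C := rho%:C * expi t.
have cu t : ccont u t by exact: ccont_circle.
have au t : cabs (u t) = rho by rewrite cabs_circle // ltW.
have u0 t : u t != 0 by rewrite -cabs_eq0 au gt_eqF.
have cF t : ccont (fun t => F (a + u t)) t.
  apply: (@ccont_comp _ _ _ (fun t => a + u t)).
    by apply: ccontD; [exact: ccont_cst|exact: cu].
  by apply/hol_ccont/dF'; rewrite addrAC subrr add0r au.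
have uv v t : cabs v < rho -> u t - v != 0.
  move=> vr; rewrite -cabs_gt0; apply: lt_le_trans (le_cabsB _ _).
  by rewrite au subr_gt0.
have cuv v t : cabs v < rho -> ccont (fun t => (u t - v)^-1) t.
  move=> vr; apply: ccontV; first exact: uv.
  by apply: ccontB; [exact: cu|exact: ccont_cst].
have cuV t : ccont (fun t => (u t)^-1) t by apply: ccontV; [exact: u0|exact: cu].
pose c2 : C := (2 * pi)%:C^-1; have p2 := pi2_neq0 R.
(* First and second divided differences of the Cauchy integral: [F (a + v) = F a + v * G v] and
   [G v = G 0 + v * Q v]. *)
pose G v := c2 * cI 0 (2 * pi) (fun t => F (a + u t) * (u t - v)^-1).
pose Q v := c2 * cI 0 (2 * pi) (fun t => F (a + u t) * ((u t)^-1 * (u t - v)^-1)).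
have v0 : cabs (0 : C) < rho by rewrite cabs0.
have cG v t : cabs v < rho -> ccont (fun t => F (a + u t) * (u t - v)^-1) t.
  by move=> vr; apply: ccontM; [exact: cF|exact: cuv].
have cQ v t : cabs v < rho ->
    ccont (fun t => F (a + u t) * ((u t)^-1 * (u t - v)^-1)) t.
  by move=> vr; apply: ccontM; [exact: cF|apply: ccontM; [exact: cuV|exact: cuv]].
have FG v : cabs v < rho -> F (a + v) = F a + v * G v.
  move=> vr; have := cauchy_disc vr dF'; have := cauchy_disc v0 dF'.
  rewrite addr0 -/u => E0 E1; rewrite /G.
  rewrite -[F a](mulKf p2) -E0 -[F (a + v)](mulKf p2) -E1 mulrCA -mulrDr.
  congr (_ * _); rewrite -cintZ; last by move=> t _; exact: cG.
  rewrite -cintD.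
  - apply: eq_cint => t _; rewrite -[rho%:C * expi t]/(u t) subr0.
    by field; rewrite uv // u0.
  - move=> t _; apply: ccontM; first exact: cF.
    by apply: ccontM; [exact: cu|exact: cuv].
  - by move=> t _; apply: ccontM; [exact: ccont_cst|exact: cG].
have GQ v : cabs v < rho -> G v = G 0 + v * Q v.
  move=> vr; rewrite /G /Q mulrCA -mulrDr; congr (_ * _).
  rewrite -cintZ; last by move=> t _; exact: cQ.
  rewrite -cintD.
  - by apply: eq_cint => t _; rewrite subr0; field; rewrite uv // u0.
  - by move=> t _; exact: cG.
  - by move=> t _; apply: ccontM; [exact: ccont_cst|exact: cQ].
have cF' : ccont_on 0 (2 * pi) (fun t => F (a + u t)) by move=> t _; exact: cF.
have [M M0 hM] := bounded_on (pi2_ge0 R) cF'.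
have cQ0 : ccont Q 0.
  apply/ccontP => e e0.
  pose K := cabs c2 * (M * (2 / rho ^+ 3) * (2 * pi - 0)).
  have K0 : 0 <= K.
    rewrite !mulr_ge0 ?cabs_ge0 ?invr_ge0 ?exprn_ge0 ?(ltW M0) ?(ltW rho0) //.
    by rewrite subr0 pi2_ge0.
  have d0 : 0 < Num.min (rho / 2) (e / (K + 1)).
    by rewrite lt_min !divr_gt0 //; lra.
  apply: filterS (near_disc 0 d0) => v; rewrite subr0 lt_min => /andP[vr ve].
  have vr' : cabs v < rho by lra.
  rewrite /Q -mulrBr -cintB; try by move=> t _; exact: cQ.
  rewrite cabsM.
  apply: (@le_lt_trans _ _ (cabs v * K)); last first.
    move: ve; rewrite ltr_pdivlMr; last by lra.
    apply: le_lt_trans; rewrite ler_wpM2l ?cabs_ge0 //; lra.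
  rewrite /K mulrCA ler_wpM2l ?cabs_ge0 // mulrA.
  apply: cabs_cint_le; first exact: pi2_ge0.
    by move=> t _; apply: ccontB; exact: cQ.
  move=> t tab.
  have -> : F (a + u t) * ((u t)^-1 * (u t - v)^-1) -
      F (a + u t) * ((u t)^-1 * (u t - 0)^-1) =
      F (a + u t) * (v * ((u t)^-1 ^+ 2 * (u t - v)^-1)).
    by rewrite subr0; field; rewrite uv // u0.
  rewrite !cabsM !cabsV au mulrCA ler_wpM2l ?cabs_ge0 //.
  apply: ler_pM; rewrite ?cabs_ge0 ?hM // ?mulr_ge0 ?exprn_ge0 ?invr_ge0 ?cabs_ge0 ?(ltW rho0) //.
  (* The last factor comes from [|u t - v| >= rho / 2], valid since [|v| < rho / 2]. *)
  have -> : 2 / rho ^+ 3 = rho^-1 * rho^-1 * (rho / 2)^-1 by field; rewrite gt_eqF.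
  rewrite ler_wpM2l ?mulr_ge0 ?invr_ge0 ?(ltW rho0) // lef_pV2 ?posrE ?divr_gt0 //.
    by have := le_cabsB (u t) v; rewrite au; lra.
  by have := le_cabsB (u t) v; rewrite au; lra.
(* Near [a] this is [G (y - a)], written so that its slope at [a] is visibly the continuous function
   [Q]; it remains to identify it with [q], including at [a] itself. *)
pose P y := G 0 + (y - a) * Q (y - a).
have dP : is_cder P a (Q 0).
  exists (fun y => Q (y - a)); split; rewrite ?subrr // /P.
    apply: (@ccont_comp _ _ a (fun y => y - a)); last by rewrite subrr.
    by apply: ccontB; [exact: ccont_id|exact: ccont_cst].
  by move=> y; rewrite subrr mul0r addr0.
have FP : is_cder (fun y => F a + (y - a) * P y) a (G 0).
  exists P; split; first exact: is_cder_ccont dP.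
    by rewrite /P subrr mul0r addr0.
  by move=> y; rewrite subrr mul0r addr0.
have nFP : \forall y \near a, F a + (y - a) * P y = F y.
  apply: filterS (near_disc a rho0) => y ya; rewrite /P -GQ // -FG //.
  by rewrite addrC subrK.
have qG : q a = G 0.
  apply: (@is_cder_unique _ F a); first by exists q.
  exact: is_cder_near FP.
exists (Q 0); apply: is_cder_near dP.
apply: filterS (near_disc a rho0) => y ya.
have [->|ya0] := eqVneq y a; first by rewrite /P subrr mul0r addr0.
have ya1 : y - a != 0 by rewrite subr_eq0.
apply: (mulfI ya1); apply: (@addrI _ (F a)); rewrite -qE /P -GQ // -FG //.
by rewrite addrC subrK.
Qed.

(** The product [(x - a) * F x] is holomorphic at [a] too, with derivative [F a] by continuity; its
    factor in the sense of [hol_factor] is [F]. *)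
Lemma hol_removable F a r : 0 < r -> ccont F a ->
  (forall x, x != a -> cabs (x - a) < r -> hol F x) -> hol F a.
Proof.
move=> r0 cF dF.
pose H x := (x - a) * F x.
have Ha : H a = 0 by rewrite /H subrr mul0r.
have dHa : is_cder H a (F a).
  by exists F; split => // x; rewrite Ha add0r.
have dH x : cabs (x - a) < r -> hol H x.
  have [-> _|xa xr] := eqVneq x a; first by exists (F a).
  apply: holM; last exact: dF.
  by apply: holB; [exact: hol_id|exact: hol_cst].
have [H1 HE [cH1 dH1]] := hol_factor r0 dH.
have FH : F = H1.
  apply/funext => x; have [->|xa] := eqVneq x a.
    by apply: is_cder_unique dHa _; exists H1.
  have xa0 : x - a != 0 by rewrite subr_eq0.
  by apply: (mulfI xa0); rewrite -/(H x) HE Ha add0r.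
by rewrite FH; apply: dH1; apply: dH; rewrite subrr cabs0.
Qed.

Lemma mean_value_bound F a rho M : 0 < rho ->
  (forall x, cabs (x - a) <= rho -> hol F x) ->
  (forall x, cabs (x - a) = rho -> cabs (F x) <= M) -> cabs (F a) <= M.
Proof.
move=> r0 dF FM; have p0 : 0 < 2 * pi :> R by rewrite mulr_gt0 // pi_gt0.
have ca t : cabs (a + rho%:C * expi t - a) = rho.
  by rewrite addrAC subrr add0r cabs_circle // ltW.
have := mean_value r0 dF => /(congr1 (@cabs R)).
rewrite cabsM cabsR_ge0 ?pi2_ge0 // => E.
rewrite -(ler_pM2l p0) -E; have -> : 2 * pi * M = M * (2 * pi - 0) by ring.
apply: cabs_cint_le; first exact: pi2_ge0.
  move=> t _; apply: (@ccont_comp _ _ _ (fun t => a + rho%:C * expi t)).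
    by apply: ccontD; [exact: ccont_cst|exact: ccont_circle].
  by apply/hol_ccont/dF; rewrite ca.
by move=> t _; apply: FM; rewrite ca.
Qed.

(** The mean value bound for the inverse of [F]. It serves as the existence principle for zeros: a
    function that is smaller at the centre than on the circle must vanish in the disc. *)
Lemma min_modulus F a rho m : 0 < rho -> 0 < m ->
  (forall x, cabs (x - a) <= rho -> hol F x /\ F x != 0) ->
  (forall x, cabs (x - a) = rho -> m <= cabs (F x)) -> m <= cabs (F a).
Proof.
move=> r0 m0 dF Fm.
have Fa0 : F a != 0 by apply: (dF _ _).2; rewrite subrr cabs0 ltW.
have := @mean_value_bound (fun x => (F x)^-1) a rho m^-1 r0.
rewrite cabsV lef_pV2 ?posrE ?cabs_gt0 //; apply.
  by move=> x /dF[dFx Fx]; exact: holV.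
move=> x xr; have [|_ Fx] := dF x; first by rewrite xr.
by rewrite cabsV lef_pV2 ?posrE ?cabs_gt0 // Fm.
Qed.

(** The mean value bound is applied to the slope at [a]; the factor 2 comes from
    [|F x - F a| <= 2 * M]. *)
Lemma cauchy_estimate F a rho M : 0 < rho ->
  (forall x, cabs (x - a) <= rho -> hol F x) ->
  (forall x, cabs (x - a) <= rho -> cabs (F x) <= M) ->
  cabs ('D_1 F a) <= 2 * M / rho.
Proof.
move=> r0 dF FM.
have dF' x : cabs (x - a) < rho -> hol F x by move=> /ltW; exact: dF.
have [F1 FE [cF1 dF1]] := hol_factor r0 dF'.
have -> : 'D_1 F a = F1 a by apply: is_cder_derive; exists F1.
apply: (mean_value_bound r0) => [x /dF|x xr]; first exact: dF1.
rewrite ler_pdivlMr // -{1}xr mulrC -cabsM.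
have -> : (x - a) * F1 x = F x - F a by rewrite FE [F a + _]addrC addrK.
apply: le_trans (ler_cabsB _ _) _; have := FM x; have := FM a.
by rewrite subrr cabs0 (ltW r0) xr lexx => /(_ isT) + /(_ isT); lra.
Qed.

Lemma derive_factor F F1 a x : (forall x, F x = F a + (x - a) * F1 x) ->
  hol F1 x -> 'D_1 F x = F1 x + (x - a) * 'D_1 F1 x.
Proof.
move=> FE dF1; apply: is_cder_derive.
have -> : F = fun x => F a + (x - a) * F1 x by apply/funext.
have -> : F1 x + (x - a) * 'D_1 F1 x =
    0 + ((1 - 0) * F1 x + (x - a) * 'D_1 F1 x) by ring.
apply: is_cderD; first exact: is_cder_cst.
apply: is_cderM; last exact: hol_is_cder.
rewrite -[- 0 : C]mulN1r; apply: is_cderD; first exact: is_cder_id.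
by rewrite mulr0; exact: is_cder_cst.
Qed.

(** In [F' x = F1 x + (x - a) * F1' x] the slope [F1] is continuous at [a], and Cauchy's estimate
    bounds [F1'] near [a], so the second term tends to 0. *)
Lemma derive_ccont F a r : 0 < r -> (forall x, cabs (x - a) < r -> hol F x) ->
  ccont ('D_1 F) a.
Proof.
move=> r0 dF; have [F1 FE [cF1 dF1]] := hol_factor r0 dF.
have F1a : 'D_1 F a = F1 a by apply: is_cder_derive; exists F1.
have /ccontP/(_ _ ltr01)/nbhsCP[d d0 dP] := cF1.
pose s := Num.min r d; have s0 : 0 < s by rewrite lt_min r0.
pose M := cabs (F1 a) + 1.
have F1M x : cabs (x - a) < s -> hol F1 x /\ cabs (F1 x) <= M.
  rewrite lt_min => /andP[xr xd]; split; first by apply/dF1/dF.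
  by have := dP x xd; have := cabsD (F1 x - F1 a) (F1 a); rewrite subrK /M; lra.
have dB x : cabs (x - a) < s / 4 -> cabs ('D_1 F1 x) <= 2 * M / (s / 4).
  move=> xs; have s4 : 0 < s / 4 by rewrite divr_gt0.
  have k y : cabs (y - x) <= s / 4 -> cabs (y - a) < s.
    move=> yx; have -> : y - a = (y - x) + (x - a) by rewrite addrA subrK.
    by apply: le_lt_trans (cabsD _ _) _; lra.
  by apply: (cauchy_estimate s4) => y /k /F1M[].
set B := 2 * M / (s / 4) in dB.
have B0 : 0 <= B.
  by apply: le_trans (dB a _); rewrite ?cabs_ge0 // subrr cabs0 divr_gt0.
apply/ccontP => e e0; have e2 : 0 < e / 2 by rewrite divr_gt0.
have s4 : 0 < Num.min (s / 4) (e / 2 / (B + 1)).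
  by rewrite lt_min !divr_gt0 //; lra.
have /ccontP/(_ _ e2) := cF1.
apply: filterS2 (near_disc a s4) => x; rewrite lt_min => /andP[xs xe] F1x.
have xs' : cabs (x - a) < s by lra.
rewrite (derive_factor FE (F1M x xs').1) F1a addrAC.
apply: le_lt_trans (cabsD _ _) _.
have : cabs ((x - a) * 'D_1 F1 x) < e / 2; last by lra.
rewrite cabsM; move: xe; rewrite ltr_pdivlMr; last by lra.
apply: le_lt_trans; rewrite ler_wpM2l ?cabs_ge0 //.
by have := dB x xs; lra.
Qed.

(** The same identity once more: [F1'] is now known to be continuous at [a], hence is itself a slope
    for [(x - a) * F1' x]. *)
Lemma derive_hol F a r : 0 < r -> (forall x, cabs (x - a) < r -> hol F x) ->
  hol ('D_1 F) a.
Proof.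
move=> r0 dF; have [F1 FE [cF1 dF1]] := hol_factor r0 dF.
have dF1' x : cabs (x - a) < r -> hol F1 x by move=> /dF /dF1.
apply: (@hol_near _ (fun x => F1 x + (x - a) * 'D_1 F1 x)).
  apply: filterS (near_disc a r0) => x xr.
  by rewrite (derive_factor FE) //; exact: dF1'.
apply: holD; first by apply: dF1'; rewrite subrr cabs0.
exists ('D_1 F1 a), ('D_1 F1); split=> [||x].
- exact: derive_ccont r0 dF1'.
- by [].
- by rewrite subrr mul0r add0r.
Qed.

(** Bernoulli's inequality. It removes a constant from a family of power bounds, in the maximum
    principle and again for infinite [delta]. *)
Lemma exp_bounded_le1 (q K : R) : (forall n, q ^+ n <= K) -> q <= 1.
Proof.
move=> qK; rewrite leNgt; apply/negP => q1.
have K0 : 0 <= K by apply: le_trans (qK 0%N); rewrite expr0.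
have bern n : 1 + (q - 1) * n%:R <= q ^+ n.
  elim: n => [|n IH]; first by rewrite mulr0 addr0 expr0.
  rewrite exprS; apply: (@le_trans _ _ (q * (1 + (q - 1) * n%:R))); last first.
    by rewrite ler_pM2l //; lra.
  have : 0 <= (q - 1) ^+ 2 * n%:R by rewrite mulr_ge0 ?sqr_ge0.
  rewrite -natr1; move: (n%:R : R) => k; rewrite expr2; nra.
have qq : 0 < q - 1 by lra.
have := archi_boundP (divr_ge0 K0 (ltW qq)); set n := Num.bound _ => nP.
have := le_trans (bern n) (qK n); move: nP; rewrite ltr_pdivrMr // mulrC; lra.
Qed.

(* Cauchy's formula for F ^+ n bounds cabs (F (a + v)) ^+ n by a constant times
   M ^+ n, for every n. *)
Lemma max_modulus F a rho M v : cabs v < rho ->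
  (forall x, cabs (x - a) <= rho -> hol F x) ->
  (forall x, cabs (x - a) = rho -> cabs (F x) <= M) -> cabs (F (a + v)) <= M.
Proof.
move=> vr dF FM; have r0 : 0 < rho by apply: le_lt_trans vr; exact: cabs_ge0.
have p0 : 0 < 2 * pi :> R by rewrite mulr_gt0 // pi_gt0.
have ca t : cabs (a + rho%:C * expi t - a) = rho.
  by rewrite addrAC subrr add0r cabs_circle // ltW.
have M0 : 0 <= M by apply: le_trans (FM _ (ca 0)); exact: cabs_ge0.
have dn : 0 < rho - cabs v by rewrite subr_gt0.
have bnd n : cabs (F (a + v)) ^+ n <= M ^+ n * (rho / (rho - cabs v)).
  have dFn x : cabs (x - a) <= rho -> hol (fun x => F x ^+ n) x.
    by move=> /dF; exact: holX.
  have := cauchy_disc vr dFn => /(congr1 (@cabs R)).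
  rewrite cabsM cabsR_ge0 ?pi2_ge0 // => E.
  rewrite -cabsX -(ler_pM2l p0) -E [leRHS]mulrC.
  rewrite -[X in _ <= _ * X]subr0.
  have uv t : rho - cabs v <= cabs (rho%:C * expi t - v).
    by apply: le_trans (le_cabsB _ _); rewrite cabs_circle // ltW.
  apply: cabs_cint_le; first exact: pi2_ge0.
    move=> t _; apply: ccontM.
      apply: (@ccont_comp _ _ _ (fun t => a + rho%:C * expi t) (fun x => F x ^+ n)).
        by apply: ccontD; [exact: ccont_cst|exact: ccont_circle].
      by apply/hol_ccont/dFn; rewrite ca.
    apply: ccontM; first exact: ccont_circle.
    apply: ccontV; first by rewrite -cabs_gt0; apply: lt_le_trans (uv t).
    by apply: ccontB; [exact: ccont_circle|exact: ccont_cst].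
  move=> t _; rewrite cabsM [cabs (_ / _)]cabsM cabsV cabsX cabs_circle ?(ltW r0) //.
  apply: ler_pM; rewrite ?exprn_ge0 ?mulr_ge0 ?invr_ge0 ?cabs_ge0 ?(ltW r0) //.
    by apply: lerXn2r; rewrite ?nnegrE ?cabs_ge0 // FM // ca.
  rewrite ler_pM2l // lef_pV2 ?posrE //.
  exact: lt_le_trans (uv t).
have [M1|M1] := eqVneq M 0.
  have := bnd 1%N; rewrite !expr1 M1 mul0r; exact.
have Mp : 0 < M by rewrite lt_def M1.
have := @exp_bounded_le1 (cabs (F (a + v)) / M) (rho / (rho - cabs v)).
rewrite ler_pdivrMr // mul1r; apply => n.
by rewrite expr_div_n ler_pdivrMr ?exprn_gt0 // mulrC.
Qed.

End LocalTheory.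

(** * Polar coordinates and extrema over circles *)

Section Polar.
Variable R : realType.
Local Notation C := (Cplx R).

(** [acos] of the normalised real part is an argument in the closed upper half-plane; in the lower
    one it is reflected and shifted by a full turn. *)
Lemma polar (w : C) : exists2 t, 0 <= t <= 2 * pi & w = (cabs w)%:C * expi t.
Proof.
have [->|w0] := eqVneq w 0.
  exists 0; first by have := pi_ge0 R; lra.
  by rewrite cabs0 mul0r.
have r0 : 0 < cabs w by rewrite cabs_gt0.
case: w w0 r0 => x y w0 r0; set r := cabs _ in r0 *.
have r2 : r ^+ 2 = x ^+ 2 + y ^+ 2 by rewrite /r cabs_sqr.
have xr : -1 <= x / r <= 1.
  have := normr_Re_le (x +i* y : C); rewrite -/r /= ler_norml => h.
  by rewrite ler_pdivlMr // ler_pdivrMr // mul1r mulN1r.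
pose t := acos (x / r).
have ct : cos t = x / r by rewrite acosK.
have st : sin t = `|y| / r.
  rewrite sin_acos //.
  have -> : 1 - (x / r) ^+ 2 = (`|y| / r) ^+ 2.
    rewrite !expr_div_n real_normK ?num_real //.
    have -> : y ^+ 2 = r ^+ 2 - x ^+ 2 by rewrite r2; ring.
    by field; rewrite gt_eqF.
  by rewrite sqrtr_sqr ger0_norm // divr_ge0 // ltW.
have t0 : 0 <= t by exact: acos_ge0.
have tp : t <= pi by exact: acos_lepi.
have rn : r != 0 by rewrite gt_eqF.
have pi0 := pi_ge0 R.
exists (if 0 <= y then t else - t + pi *+ 2).
  by case: ifP => _; rewrite -?[pi *+ 2]mulr_natl; lra.
apply/eqP; rewrite eq_complex /= /expi; apply/andP; split; apply/eqP.
  case: ifP => _; rewrite ?cosD2pi ?sinD2pi ?cosN ct; by field.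
case: ifP => [y0|/negbT]; first by rewrite st ger0_norm //; field.
rewrite -ltNge => y0; rewrite sinD2pi cosD2pi cosN sinN ct st ltr0_norm //; by field.
Qed.

Lemma circleP (a x : C) (rho : R) : cabs (x - a) = rho ->
  exists2 t, 0 <= t <= 2 * pi & x = a + rho%:C * expi t.
Proof.
move=> xr; have [t ht E] := polar (x - a); exists t => //.
by rewrite -xr -E addrC subrK.
Qed.

Lemma circle_max (F : C -> C) (a : C) (rho : R) :
  (forall x, cabs (x - a) = rho -> ccont F x) ->
  exists2 M, 0 < M & forall x, cabs (x - a) = rho -> cabs (F x) <= M.
Proof.
move=> cF; have [r0|r0] := leP 0 rho; last first.
  by exists 1 => // x xr; have := cabs_ge0 (x - a); rewrite xr; lra.
have ca t : cabs (a + rho%:C * expi t - a) = rho.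
  by rewrite addrAC subrr add0r cabs_circle.
have cG : ccont_on 0 (2 * pi) (fun t => F (a + rho%:C * expi t)).
  move=> t _; apply: (@ccont_comp _ _ _ (fun t => a + rho%:C * expi t)).
    by apply: ccontD; [exact: ccont_cst|exact: ccont_circle].
  by apply: cF; rewrite ca.
have [M M0 hM] := bounded_on (pi2_ge0 R) cG.
by exists M => // x /circleP[t ht ->]; exact: hM.
Qed.

Lemma circle_min (F : C -> C) (a : C) (rho : R) :
  (forall x, cabs (x - a) = rho -> ccont F x /\ F x != 0) ->
  exists2 m, 0 < m & forall x, cabs (x - a) = rho -> m <= cabs (F x).
Proof.
move=> hF; have [|M M0 hM] := @circle_max (fun x => (F x)^-1) a rho.
  by move=> x /hF[cF F0]; exact: ccontV.
exists M^-1; first by rewrite invr_gt0.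
move=> x xr; have [_ F0] := hF _ xr.
rewrite -[leRHS]invrK lef_pV2 ?posrE ?invr_gt0 ?cabs_gt0 //.
by rewrite -cabsV hM.
Qed.

End Polar.

(** * Matrices and numerical ranges *)

Section HolomorphicMatrices.
Variable R : realType.
Local Notation C := (Cplx R).

Lemma hol_sum (I : Type) (r : seq I) (P : pred I) (F : I -> C -> C) x :
  (forall i, P i -> hol (F i) x) -> hol (fun y => \sum_(i <- r | P i) F i y) x.
Proof.
move=> hF; elim: r => [|i r IH].
  have -> : (fun y => \sum_(i <- [::] | P i) F i y) = (fun=> 0).
    by apply/funext => y; rewrite big_nil.
  exact: hol_cst.
have [Pi|Pi] := boolP (P i); last first.
  have -> // : (fun y => \sum_(i <- i :: r | P i) F i y) =
      (fun y => \sum_(i <- r | P i) F i y).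
    by apply/funext => y; rewrite big_cons (negPf Pi).
have -> : (fun y => \sum_(i <- i :: r | P i) F i y) =
    (fun y => F i y + \sum_(i <- r | P i) F i y).
  by apply/funext => y; rewrite big_cons Pi.
by apply: holD IH; exact: hF.
Qed.

Lemma hol_prod (I : Type) (r : seq I) (P : pred I) (F : I -> C -> C) x :
  (forall i, P i -> hol (F i) x) -> hol (fun y => \prod_(i <- r | P i) F i y) x.
Proof.
move=> hF; elim: r => [|i r IH].
  have -> : (fun y => \prod_(i <- [::] | P i) F i y) = (fun=> 1).
    by apply/funext => y; rewrite big_nil.
  exact: hol_cst.
have [Pi|Pi] := boolP (P i); last first.
  have -> // : (fun y => \prod_(i <- i :: r | P i) F i y) =
      (fun y => \prod_(i <- r | P i) F i y).
    by apply/funext => y; rewrite big_cons (negPf Pi).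
have -> : (fun y => \prod_(i <- i :: r | P i) F i y) =
    (fun y => F i y * \prod_(i <- r | P i) F i y).
  by apply/funext => y; rewrite big_cons Pi.
by apply: holM IH; exact: hF.
Qed.

Definition holmx (m n : nat) (M : C -> 'M[R[i]]_(m, n)) (x : C) :=
  forall i j, hol (fun y => M y i j : C) x.

Lemma hol_det n (M : C -> 'M[R[i]]_n) x :
  holmx M x -> hol (fun y => \det (M y) : C) x.
Proof.
move=> hM; apply: hol_sum => s _; apply: holM; first exact: hol_cst.
by apply: hol_prod => i _; exact: hM.
Qed.

Lemma hol_adj n (M : C -> 'M[R[i]]_n) x : holmx M x -> holmx (fun y => \adj (M y)) x.
Proof.
move=> hM i j.
have -> : (fun y => \adj (M y) i j : C) =
    (fun y => (-1) ^+ (j + i) * \det (row' j (col' i (M y))) : C).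
  by apply/funext => y; rewrite mxE.
apply: holM; first exact: hol_cst.
apply: hol_det => a b.
have -> // : (fun y => row' j (col' i (M y)) a b : C) =
    (fun y => M y (lift j a) (lift i b) : C).
by apply/funext => y; rewrite !mxE.
Qed.

Lemma hol_invmx n (M : C -> 'M[R[i]]_n) x :
  holmx M x -> M x \in unitmx -> holmx (fun y => invmx (M y)) x.
Proof.
move=> hM Mx i j; have dM := hol_det hM.
have Mx0 : (\det (M x) : C) != 0 by move: Mx; rewrite unitmxE unitfE.
have nd : \forall y \near x, (\det (M y) : C) != 0.
  have /ccontP/(_ (cabs (\det (M x)))) := hol_ccont dM; rewrite cabs_gt0.
  move=> /(_ Mx0); apply: filterS => y; apply: contraTneq => ->.
  by rewrite sub0r cabsN ltxx.
apply: (@hol_near _ (fun y => (\det (M y) : C)^-1 * (\adj (M y) i j : C))).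
  by apply: filterS nd => y y0; rewrite /invmx unitmxE unitfE y0 [RHS]mxE.
apply: (@holM _ (fun y => (\det (M y) : C)^-1) (fun y => \adj (M y) i j : C)).
  exact: holV.
exact: hol_adj.
Qed.

End HolomorphicMatrices.

Section NumericalRange.
Variables (R : realType) (N : nat).
Local Notation C := (Cplx R).
Implicit Types (A H : 'M[R[i]]_N) (x y : 'cV[R[i]]_N).

Lemma cconj_sum (I : Type) (r : seq I) (P : pred I) (F : I -> C) :
  conjc (\sum_(i <- r | P i) F i) = \sum_(i <- r | P i) conjc (F i).
Proof. exact: raddf_sum. Qed.

Lemma RtoC_sum (I : Type) (r : seq I) (P : pred I) (F : I -> R) :
  (\sum_(i <- r | P i) F i)%:C = \sum_(i <- r | P i) (F i)%:C :> C.
Proof. exact: raddf_sum. Qed.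

Definition herm x y : C := ((map_mx conjc x)^T *m y) 0 0.

Definition sqnorm x : R := \sum_i cabs (x i 0) ^+ 2.

Lemma hermE x y : herm x y = \sum_i conjc (x i 0) * y i 0.
Proof. by rewrite /herm mxE; apply: eq_bigr => i _; rewrite !mxE. Qed.

Lemma hermJ x y : conjc (herm x y) = herm y x.
Proof.
rewrite !hermE cconj_sum.
by apply: eq_bigr => i _; rewrite cconjM conjcK mulrC.
Qed.

Lemma herm_sqnorm x : herm x x = (sqnorm x)%:C.
Proof.
rewrite hermE /sqnorm RtoC_sum.
by apply: eq_bigr => i _; rewrite mulrC -mulcJ.
Qed.

Lemma herm_linear x y z (a b : C) :
  herm x (a *: y + b *: z) = a * herm x y + b * herm x z.
Proof. by rewrite /herm mulmxDr -!scalemxAr !mxE. Qed.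

Lemma herm_scale x y (a b : C) :
  herm (a *: x) (b *: y) = conjc a * b * herm x y.
Proof.
rewrite !hermE mulr_sumr; apply: eq_bigr => i _; rewrite !mxE cconjM.
by rewrite mulrACA.
Qed.

Lemma sqnorm_ge0 x : 0 <= sqnorm x.
Proof. by apply: sumr_ge0 => i _; exact: sqr_ge0. Qed.

Lemma sqnorm_eq0 x : sqnorm x = 0 -> x = 0.
Proof.
move=> /eqP; rewrite psumr_eq0 => [/allP h|i _]; last exact: sqr_ge0.
apply/matrixP => i j; rewrite ord1 mxE.
have := h i (mem_index_enum i); rewrite implyTb sqrf_eq0 cabs_eq0.
by move=> /eqP.
Qed.

Lemma field_of_values_quotient A x : x != 0 ->
  field_of_values A (herm x (A *m x) / (sqnorm x)%:C).
Proof.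
move=> x0; have s0 : 0 < sqnorm x.
  by rewrite lt_def sqnorm_ge0 andbT; apply: contra_neq x0; exact: sqnorm_eq0.
pose r := Num.sqrt (sqnorm x).
have r0 : 0 < r by rewrite sqrtr_gt0.
have r2 : r ^+ 2 = sqnorm x by rewrite sqr_sqrtr // ltW.
exists ((r^-1)%:C *: x).
  have -> : \sum_i cabs (((r^-1)%:C *: x) i 0) ^+ 2 = r ^- 2 * sqnorm x.
    rewrite mulr_sumr; apply: eq_bigr => i _; rewrite mxE cabsM exprMn.
    by rewrite cabsR_ge0 ?invr_ge0 ?ltW // exprVn.
  by rewrite -r2 mulVf ?sqrtr1 // expf_neq0 // gt_eqF.
rewrite -mulmxA -/(herm ((r^-1)%:C *: x) (A *m ((r^-1)%:C *: x))) -scalemxAr.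
rewrite herm_scale conjc_real mulrC; congr (_ * _).
by rewrite -rmorphM -fmorphV /= -invfM -expr2 r2.
Qed.

Lemma eigenvalue_field_of_values A (a : C) : eigenvalue A a -> field_of_values A a.
Proof.
move=> /eigenvalueP[v vA v0].
(* [eigenvalue] speaks of row eigenvectors; the conjugate transpose of one is a column vector whose
   quotient is [a]. *)
pose x : 'cV[R[i]]_N := (map_mx conjc v)^T.
have xv : (map_mx conjc x)^T = v by apply/matrixP => i j; rewrite !mxE conjcK.
have x0 : x != 0.
  by apply: contra_neq v0 => x0; rewrite -xv x0 map_mx0 trmx0.
have := field_of_values_quotient A x0.
have -> : herm x (A *m x) = a * (sqnorm x)%:C.
  by rewrite -herm_sqnorm /herm mulmxA xv vA -scalemxAl mxE.
rewrite mulfK // (inj_eq (@complexI _)); apply: contra_neq x0; exact: sqnorm_eq0.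
Qed.

Definition accretive H := forall x, 0 <= complex.Re (herm x (H *m x)).

(** Positivity of the Hermitian part of [H] on the vector [e_k - w * e_l], with [w] the unit that
    rotates the [(k, l)] entry of that part onto the positive axis. *)
Lemma accretive_entry H k l : accretive H ->
  cabs (H k l + conjc (H l k)) <= complex.Re (H k k) + complex.Re (H l l).
Proof.
move=> hH; have [w w1 wE] := cabs_unit (H k l + conjc (H l k) : C).
pose x : 'cV[R[i]]_N := delta_mx k 0 - w *: delta_mx l 0.
have sum_delta (F : 'I_N -> C) m : \sum_j F j * (j == m)%:R = F m.
  by rewrite (bigD1 m) //= eqxx mulr1 big1 ?addr0 // => j /negPf ->; rewrite mulr0.
have Hx j : (H *m x) j 0 = (H j k : C) - w * (H j l : C) :> C.
  rewrite mxE -(sum_delta (fun m => H j m : C) k) -(sum_delta (fun m => H j m : C) l).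
  rewrite mulr_sumr -sumrB; apply: eq_bigr => m _.
  by rewrite !mxE eqxx !andbT mulrBr mulrCA.
have := hH x; rewrite hermE.
have -> : \sum_i conjc (x i 0) * (H *m x) i 0 =
    ((H k k : C) - w * (H k l : C)) - conjc w * ((H l k : C) - w * (H l l : C)).
  rewrite -(sum_delta (fun m => (H m k : C) - w * (H m l : C)) k).
  rewrite -(sum_delta (fun m => (H m k : C) - w * (H m l : C)) l).
  rewrite mulr_sumr -sumrB; apply: eq_bigr => m _.
  rewrite Hx !mxE eqxx !andbT cconjB cconjM !conjc_nat.
  by ring.
have wn : conjc w * w = 1 by rewrite mulrC mulcJ w1 expr1n.
have -> : ((H k k : C) - w * (H k l : C)) - conjc w * ((H l k : C) - w * (H l l : C))
    = H k k + H l l - (w * H k l + conjc w * H l k).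
  have -> : conjc w * ((H l k : C) - w * (H l l : C)) =
     conjc w * H l k - (conjc w * w) * H l l by ring.
  by rewrite wn; ring.
have -> : complex.Re ((H k k : C) + H l l - (w * H k l + conjc w * H l k)) =
    complex.Re (H k k) + complex.Re (H l l) -
    complex.Re (w * (H k l + conjc (H l k))).
  rewrite cReD cReN !cReD; congr (_ - _).
  rewrite mulrDr !cReD; congr (_ + _).
  by rewrite -(cReJ (conjc w * H l k)) cconjM conjcK.
by rewrite wE subr_ge0.
Qed.

End NumericalRange.

(** * Caratheodory's coefficient estimate with a conjugate term *)

Section CoefficientBound.
Variable R : realType.
Local Notation C := (Cplx R).
Implicit Types (F T : R -> C) (f g h E : C -> C).

Lemma cabs_cint_le_Re (a b : R) F T : ccont_on a b F -> ccont_on a b T ->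
  (forall t, a <= t <= b -> cabs (F t) <= complex.Re (T t)) ->
  cabs (cI a b F) <= complex.Re (cI a b T).
Proof.
move=> cF cT FT; apply: le_trans (le_cabs_cint cF) _; rewrite Re_cint.
apply: le_Rintegral => //.
- exact/cont_on_integrable/ccont_on_cabs.
- exact/cont_on_integrable/ccont_on_Re.
Qed.

Section FixedRadius.
Variables (rho : R) (s0 : C) (n : nat).
Hypotheses (s0r : cabs s0 < rho) (n0 : (0 < n)%N).

Let u (t : R) : C := rho%:C * expi t.
(** This is the geometric tail of the [(s0 / u t) ^+ j] over [j >= n]. Averaging against it keeps
    exactly the Taylor terms of order at least [n], evaluated at [s0], and kills negative
    frequencies, that is, conjugates of holomorphic functions; their constant term is killed because
    [n > 0]. *)
Let kap t : C := (s0 / u t) ^+ n * (u t / (u t - s0)).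

Let rho_gt0 : 0 < rho. Proof. by apply: le_lt_trans s0r; exact: cabs_ge0. Qed.
Let rhoC : rho%:C != 0 :> C. Proof. by rewrite (inj_eq (@complexI _)) gt_eqF. Qed.
Let cabs_u t : cabs (u t) = rho. Proof. by rewrite cabs_circle // ltW. Qed.
Let u_neq0 t : u t != 0. Proof. by rewrite -cabs_eq0 cabs_u gt_eqF. Qed.

Let us0 t : rho - cabs s0 <= cabs (u t - s0).
Proof. by apply: le_trans (le_cabsB _ _); rewrite cabs_u. Qed.

Let us0_neq0 t : u t - s0 != 0.
Proof. by rewrite -cabs_gt0; apply: lt_le_trans (us0 t); rewrite subr_gt0. Qed.

Let ccont_u t : ccont u t. Proof. exact: ccont_circle. Qed.

Let ccont_kap t : ccont kap t.
Proof.
apply: ccontM.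
  apply: ccontX; apply: ccontM; first exact: ccont_cst.
  by apply: ccontV; [exact: u_neq0|exact: ccont_u].
apply: ccontM; first exact: ccont_u.
apply: ccontV; first exact: us0_neq0.
by apply: ccontB; [exact: ccont_u|exact: ccont_cst].
Qed.

Let cabs_kap t : cabs (kap t) <= (cabs s0 / rho) ^+ n * (rho / (rho - cabs s0)).
Proof.
rewrite /kap cabsM cabsX [cabs (s0 / _)]cabsM [cabs (u t / _)]cabsM !cabsV cabs_u.
have q0 : 0 < rho - cabs s0 by rewrite subr_gt0.
rewrite ler_wpM2l ?exprn_ge0 ?divr_ge0 ?cabs_ge0 ?(ltW rho_gt0) //.
by rewrite ler_pM2l // lef_pV2 ?posrE // (lt_le_trans q0 (us0 t)).
Qed.

Let hol_on f := forall x, cabs x <= rho -> hol f x.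

Let ccont_hol f t : hol_on f -> ccont (fun t => f (u t)) t.
Proof.
move=> df; apply: (ccont_comp (ccont_u t)).
by apply/hol_ccont/df; rewrite cabs_u.
Qed.

Let cauchy_kap f E : hol_on E -> (forall x, f x = x ^+ n * E x) ->
  cI 0 (2 * pi) (fun t => kap t * f (u t)) = (2 * pi)%:C * f s0.
Proof.
move=> dE fE.
have dE' x : cabs (x - 0) <= rho -> hol E x by rewrite subr0; exact: dE.
have := cauchy_disc s0r dE'; rewrite add0r => CE.
rewrite (fE s0) mulrCA -CE -cintZ; last first.
  move=> t _; apply: ccontM.
    apply: (@ccont_comp _ _ _ (fun t => 0 + rho%:C * expi t)).
      by apply: ccontD; [exact: ccont_cst|exact: ccont_circle].
    by apply/hol_ccont/dE; rewrite add0r cabs_u.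
  apply: ccontM; first exact: ccont_u.
  apply: ccontV; first exact: us0_neq0.
  by apply: ccontB; [exact: ccont_u|exact: ccont_cst].
apply: eq_cint => t _; rewrite add0r -/(u t) fE /kap expr_div_n.
have un : u t ^+ n != 0 by rewrite expf_neq0.
by field; rewrite us0_neq0 un.
Qed.

(* kap is the conjugate on the circle of a holomorphic function vanishing at 0 *)
Let conj_kap g : hol_on g -> cI 0 (2 * pi) (fun t => kap t * conjc (g (u t))) = 0.
Proof.
move=> dg.
pose p (x : C) : C := conjc s0 * x / (rho ^+ 2)%:C.
pose K x := (p x ^+ n * (1 - p x)^-1) * g x.
have p1 x : cabs x <= rho -> 1 - p x != 0.
  move=> xr; rewrite -cabs_gt0; apply: lt_le_trans (le_cabsB _ _).
  rewrite cabs1 subr_gt0 /p !cabsM cabsV cabsJ cabsR_ge0 ?sqr_ge0 //.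
  rewrite ltr_pdivrMr ?exprn_gt0 // mul1r expr2.
  by apply: le_lt_trans (ler_wpM2l (cabs_ge0 _) xr) _; rewrite ltr_pM2r.
have dp x : hol p x.
  apply: holM; last exact: hol_cst.
  by apply: holM; [exact: hol_cst|exact: hol_id].
have dK x : cabs (x - 0) <= rho -> hol K x.
  rewrite subr0 => xr; apply: holM; last exact: dg.
  apply: holM; first exact: holX.
  apply: holV; first exact: p1.
  by apply: holB => //; exact: hol_cst.
have := mean_value rho_gt0 dK.
have -> : K 0 = 0 by rewrite /K /p mulr0 mul0r expr0n gtn_eqF // !mul0r.
rewrite mulr0 => /(congr1 (@conjc R)); rewrite conjc0 => <-.
rewrite -cintJ; last first.
  move=> t _; apply: (@ccont_comp _ _ _ (fun t => 0 + rho%:C * expi t)).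
    by apply: ccontD; [exact: ccont_cst|exact: ccont_circle].
  by apply/hol_ccont/dK; rewrite add0r subr0 cabs_u.
apply: eq_cint => t _; rewrite add0r -/(u t) /K cconjM; congr (_ * _).
have pu : conjc (p (u t)) = s0 / u t.
  rewrite /p /u !cconjM conjcK conjc_inv !conjc_real conj_expi.
  have e0 : expi t != 0 :> C by exact: expi_neq0.
  by rewrite rmorphXn /=; field; rewrite rhoC e0.
rewrite cconjM cconjX conjc_inv cconjB conjc1 pu /kap; congr (_ * _).
by field; rewrite u_neq0 us0_neq0.
Qed.

(** The mean of [kap * (f + conjc g)] is [f s0]. It is at most the supremum of [|kap|] times the
    mean of the real part of [T], which the mean value property turns into its value at 0. *)
Lemma coefficient_bound_radius f E g (T : C -> C) :
  hol_on E -> (forall x, f x = x ^+ n * E x) -> hol_on g -> hol_on T ->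
  (forall x, cabs x = rho -> cabs (f x + conjc (g x)) <= complex.Re (T x)) ->
  cabs (f s0) <= (cabs s0 / rho) ^+ n * (rho / (rho - cabs s0)) * complex.Re (T 0).
Proof.
move=> dE fE dg dT fgT.
have df : hol_on f.
  have -> : f = (fun x => x ^+ n * E x) by apply/funext.
  by move=> x /dE dEx; apply: holM => //; apply: holX; exact: hol_id.
set c := (cabs s0 / rho) ^+ n * (rho / (rho - cabs s0)).
have p0 : 0 < 2 * pi :> R by rewrite mulr_gt0 // pi_gt0.
have I : cI 0 (2 * pi) (fun t => kap t * (f (u t) + conjc (g (u t)))) =
    (2 * pi)%:C * f s0.
  rewrite -(cauchy_kap dE fE) -[RHS]addr0 -(conj_kap dg) -cintD.
  - by apply: eq_cint => t _; rewrite mulrDr.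
  - by move=> t _; apply: ccontM; [exact: ccont_kap|exact: ccont_hol].
  - by move=> t _; apply: ccontM; [exact: ccont_kap|apply/ccontJ/ccont_hol].
have dT' x : cabs (x - 0) <= rho -> hol T x by rewrite subr0; exact: dT.
have J := mean_value rho_gt0 dT'.
have J' : cI 0 (2 * pi) (fun t => c%:C * T (u t)) = c%:C * ((2 * pi)%:C * T 0).
  rewrite -J cintZ; last by move=> t _; exact: ccont_hol.
  by congr (_ * _); apply: eq_cint => t _; rewrite add0r.
rewrite -(ler_pM2l p0).
have -> : 2 * pi * cabs (f s0) = cabs ((2 * pi)%:C * f s0).
  by rewrite cabsM cabsR_ge0 // ltW.
have -> : 2 * pi * (c * complex.Re (T 0)) = complex.Re (c%:C * ((2 * pi)%:C * T 0)).
  by rewrite !cReZ mulrCA.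
rewrite -I -J'; apply: cabs_cint_le_Re.
- move=> t _; apply: ccontM; first exact: ccont_kap.
  by apply: ccontD; [exact: ccont_hol|apply/ccontJ/ccont_hol].
- by move=> t _; apply: ccontM; [exact: ccont_cst|exact: ccont_hol].
move=> t _; rewrite cabsM cReZ; apply: ler_pM; rewrite ?cabs_ge0 //.
by apply: fgT; rewrite cabs_u.
Qed.

End FixedRadius.

Lemma coefficient_bound (n : nat) f E g (T : C -> C) (s0 : C) : (0 < n)%N -> cabs s0 < 1 ->
  (forall x, cabs x < 1 -> hol E x) -> (forall x, f x = x ^+ n * E x) ->
  (forall x, cabs x < 1 -> hol g x) -> (forall x, cabs x < 1 -> hol T x) ->
  (forall x, x != 0 -> cabs x < 1 -> cabs (f x + conjc (g x)) <= complex.Re (T x)) ->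
  cabs (f s0) <= cabs s0 ^+ n / (1 - cabs s0) * complex.Re (T 0).
Proof.
move=> n0 s01 dE fE dg dT fgT; set q := cabs s0 in s01 *.
have q0 : 0 <= q by exact: cabs_ge0.
set D := cabs (f s0); set M := complex.Re (T 0).
have H rho : q < rho -> rho < 1 -> D * (rho - q) * rho ^+ n <= q ^+ n * rho * M.
  move=> qr r1; have r0 : 0 < rho by lra.
  have hr h : (forall x, cabs x < 1 -> hol h x) -> forall x, cabs x <= rho -> hol h x.
    by move=> dh x xr; apply: dh; lra.
  have := coefficient_bound_radius qr n0 (hr _ dE) fE (hr _ dg) (hr _ dT).
  have hx x : cabs x = rho -> cabs (f x + conjc (g x)) <= complex.Re (T x).
    by move=> xr; apply: fgT; rewrite -?cabs_gt0 xr.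
  move=> /(_ hx); rewrite -/D -/M -/q.
  have rn : 0 < rho ^+ n by rewrite exprn_gt0.
  have rq : 0 < rho - q by lra.
  have -> : (q / rho) ^+ n * (rho / (rho - q)) * M =
      q ^+ n * rho * M / (rho - q) / rho ^+ n.
    by rewrite expr_div_n; field; rewrite !gt_eqF.
  by rewrite ler_pdivlMr // ler_pdivlMr // mulrAC.
rewrite -/D.
have q1 : 0 < 1 - q by lra.
rewrite mulrAC ler_pdivlMr // leNgt; apply/negP => gap.
(* Cleared of denominators, a failing bound reads [0 < P 1]; by continuity [P] is then positive at
   some radius in [(q, 1)], against [H]. *)
pose P (rho : R) := D * (rho - q) * rho ^+ n - q ^+ n * rho * M.
have P1 : 0 < P 1 by rewrite /P expr1n mulr1; lra.
have cP : {for 1, continuous P}.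
  apply: continuousB; apply: continuousM; try exact: cst_continuous.
  - apply: continuousM; first exact: cst_continuous.
    by apply: continuousB; [exact: id|exact: cst_continuous].
  - exact: exprn_continuous.
  - by apply: continuousM; [exact: cst_continuous|exact: id].
have /continuousRP/(_ _ P1)/nbhs_ballP[e /= e0 eP] := cP.
pose rho := Num.max ((1 + q) / 2) (1 - e / 2).
have r1 : rho < 1 by rewrite gt_max; apply/andP; split; lra.
have rq : (1 + q) / 2 <= rho by rewrite le_max lexx.
have re : 1 - e / 2 <= rho by rewrite le_max lexx orbT.
have qr : q < rho by lra.
have := eP rho; rewrite /ball /= ger0_norm; last by lra.
have re' : 1 - rho < e by lra.
move=> /(_ re'); rewrite ltr_norml; have := H _ qr r1; rewrite /P in P1 *; lra.
Qed.

End CoefficientBound.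

(** * Walks and powers of adjacency matrices *)

Section Walks.
Variables (R : realType) (N : nat).
Local Notation C := (Cplx R).
Implicit Types (G : wdigraph R N) (i j k l s t v : 'I_N) (m n : nat).

Definition walk G m k l := exists p : seq 'I_N,
  [/\ path (edge_rel G) k p, last k p = l & size p = m].

Lemma walk0 G k : walk G 0 k k.
Proof. by exists [::]. Qed.

Lemma walkS G m k v l : (k, v) \in edges G -> walk G m v l -> walk G m.+1 k l.
Proof.
move=> kv [p [pp pl ps]]; exists (v :: p); split=> //=; last by rewrite ps.
by rewrite pp andbT.
Qed.

Lemma walkSP G m k l : walk G m.+1 k l ->
  exists2 v, (k, v) \in edges G & walk G m v l.
Proof.
by move=> [[|v p] []] //= /andP[kv pp] pl [ps]; exists v => //; exists p.
Qed.

Definition cadjacency G : 'M[R[i]]_N := map_mx (real_complex R) (adjacency G).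

Lemma cadjacency_neq0 G k v : cadjacency G k v != 0 -> (k, v) \in edges G.
Proof. by rewrite !mxE; case: ifP => // _; rewrite rmorph0 eqxx. Qed.

(** The second argument is the identity for powers of [A] and the inverse of the pencil for the
    remainder of the Neumann expansion. *)
Definition mxpow (A : 'M[R[i]]_N) m (X : 'M[R[i]]_N) := iter m (mulmx A) X.

Lemma mxpow_walk G m k l : mxpow (cadjacency G) m 1%:M k l != 0 -> walk G m k l.
Proof.
elim: m k => [|m IH] k.
  by rewrite /mxpow /= mxE; have [-> _|_] := eqVneq k l; [exact: walk0|rewrite eqxx].
rewrite /mxpow /= mxE => h.
have [v hv] : exists v, cadjacency G k v * mxpow (cadjacency G) m 1%:M v l != 0.
  apply/existsP; apply: contraNT h => /existsPn h.
  by rewrite big1 // => v _; apply/eqP; move: (h v); rewrite negbK.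
move: hv; rewrite mulf_eq0 negb_or => /andP[/cadjacency_neq0 kv /IH].
exact: walkS.
Qed.

Lemma edited_cadjacency dE G Gt k v : edited_within dE G Gt ->
  cadjacency G k v != cadjacency Gt k v -> (k, v) \in dE.
Proof.
move=> ed; apply: contraNT => /ed[eE wE]; rewrite !mxE eE.
by case: ifP => // kv; rewrite wE.
Qed.

(** Entrywise form of the telescoping sum of the [A^i (A - At) At^j]: the walk is in [G] before the
    edited edge and in [Gt] after it, and the edge itself makes [i + j] strictly smaller than
    [m]. *)
Lemma mxpow_edited dE G Gt m k l : edited_within dE G Gt ->
  mxpow (cadjacency G) m 1%:M k l != mxpow (cadjacency Gt) m 1%:M k l ->
  exists (i j : nat) s t, [/\ (i + j < m)%N, (s, t) \in dE, walk G i k s & walk Gt j t l].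
Proof.
move=> ed; elim: m k => [|m IH] k; first by rewrite eqxx.
rewrite /mxpow /= !mxE -!/(mxpow _ _ _) => h.
have [v hv] : exists v, cadjacency G k v * mxpow (cadjacency G) m 1%:M v l !=
    cadjacency Gt k v * mxpow (cadjacency Gt) m 1%:M v l.
  apply/existsP; apply: contraNT h => /existsPn h.
  by apply/eqP; apply: eq_bigr => v _; apply/eqP; move: (h v); rewrite negbK.
have direct : cadjacency G k v != cadjacency Gt k v ->
    mxpow (cadjacency Gt) m 1%:M v l != 0 ->
    exists (i j : nat) s t, [/\ (i + j < m.+1)%N, (s, t) \in dE, walk G i k s & walk Gt j t l].
  move=> /(edited_cadjacency ed) kv /mxpow_walk vl.
  by exists 0%N, m, k, v; split => //; exact: walk0.
have [E|/IH hvl] := eqVneq (mxpow (cadjacency G) m 1%:M v l)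
    (mxpow (cadjacency Gt) m 1%:M v l).
  apply: direct; first by apply: contraNneq hv => ->; rewrite E.
  by apply: contraNneq hv => p0; rewrite E p0 !mulr0.
have [A0|/cadjacency_neq0 kv] := eqVneq (cadjacency G k v) 0.
  move: hv; rewrite A0 mul0r eq_sym mulf_eq0 negb_or => /andP[At0 p0].
  by apply: direct => //; rewrite A0 eq_sym.
have [i [j [s [t [ij st w1 w2]]]]] := hvl.
by exists i.+1, j, s, t; split; rewrite ?addSn //; exact: walkS w1.
Qed.

(** [delta] measures distances to [l] in [G], whereas [mxpow_edited] ends with a walk in [Gt].
    Cutting that walk after its last edited edge leaves a walk in [G] that starts at a tip and is no
    longer. *)
Lemma walk_edited dE G Gt m k l : edited_within dE G Gt -> walk Gt m k l ->
  walk G m k l \/ exists (j : nat) t, [/\ (j <= m)%N, t \in tips dE & walk G j t l].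
Proof.
move=> ed; elim: m k => [|m IH] k.
  by move=> [[|v p] []] //= _ <- _; left; exact: walk0.
move=> /walkSP[v kv /IH[w|[j [t [jm tT w]]]]]; last first.
  by right; exists j, t; split => //; exact: ltnW.
have [kvE|kvE] := boolP ((k, v) \in dE).
  by right; exists m, v; split => //; apply/imsetP; exists (k, v).
by left; apply: walkS w; have [<-] := ed _ kvE.
Qed.

Lemma dist_le_walk G m k l : walk G m k l -> (dist G k l <= m%:R%:E)%E.
Proof.
by move=> [p [pp pl ps]]; apply: ereal_inf_lbound; exists p; rewrite /= ?ps.
Qed.

Lemma dist_to_set_le G m k s (S : {set 'I_N}) : s \in S -> walk G m k s ->
  (dist_to_set G k S <= m%:R%:E)%E.
Proof.
by move=> sS /dist_le_walk h; apply: le_trans h; apply: bigmin_le_cond.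
Qed.

Lemma dist_from_set_le G m t l (T : {set 'I_N}) : t \in T -> walk G m t l ->
  (dist_from_set G T l <= m%:R%:E)%E.
Proof.
by move=> tT /dist_le_walk h; apply: le_trans h; apply: bigmin_le_cond.
Qed.

(** [delta] is an extended real number, while the order of vanishing has to be a natural number. *)
Definition natural_or_infinite (x : \bar R) := x = +oo%E \/ exists n, x = n%:R%:E.

Lemma dist_natural G k l : natural_or_infinite (dist G k l).
Proof.
have [[n0 hn0]|none] := pselect (exists n, walk G n k l); last first.
  left; rewrite /dist (_ : [set _ | _ in _] = set0) ?ereal_inf0 //.
  apply/seteqP; split => // x [p [pp pl] _].
  by apply: none; exists (size p), p.
have ex : exists n, `[< walk G n k l >] by exists n0; apply/asboolP.
right; exists (ex_minn ex); case: ex_minnP => n /asboolP hn nmin.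
apply/eqP; rewrite eq_le dist_le_walk //=.
apply: le_ereal_inf_tmp => _ [p [pp pl] <-].
by rewrite lee_fin ler_nat; apply: nmin; apply/asboolP; exists p.
Qed.

Lemma bigmin_natural (S : {set 'I_N}) (F : 'I_N -> \bar R) :
  (forall s, natural_or_infinite (F s)) ->
  natural_or_infinite (\big[Order.min/+oo%E]_(s in S) F s).
Proof.
move=> hF; apply: (big_ind natural_or_infinite) => [|x y hx hy|s _]; first by left.
  by rewrite minEle; case: ifP.
exact: hF.
Qed.

Lemma dist_sum_natural G k l (S T : {set 'I_N}) :
  natural_or_infinite (dist_to_set G k S + dist_from_set G T l)%E.
Proof.
have [->|[a ->]] : natural_or_infinite (dist_to_set G k S).
- by apply: bigmin_natural => s; exact: dist_natural.
- left; have [->|[b ->]] // : natural_or_infinite (dist_from_set G T l).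
  by apply: bigmin_natural => s; exact: dist_natural.
have [->|[b ->]] : natural_or_infinite (dist_from_set G T l).
- by apply: bigmin_natural => s; exact: dist_natural.
- by left.
by right; exists (a + b)%N; rewrite natrD.
Qed.

(** A difference would give [delta <= i + j < m]; the strict inequality is what admits the exponent
    [m = delta]. *)
Lemma mxpow_eq dE G Gt m k l : edited_within dE G Gt ->
  (m%:R%:E <= dist_to_set G k (sources dE) + dist_from_set G (tips dE) l)%E ->
  mxpow (cadjacency G) m 1%:M k l = mxpow (cadjacency Gt) m 1%:M k l.
Proof.
move=> ed hm; apply/eqP; apply: contraLR hm => /(mxpow_edited ed).
move=> [i [j [s [t [ij st w1 w2]]]]]; rewrite -ltNge.
have h1 : (dist_to_set G k (sources dE) <= i%:R%:E)%E.
  by apply: dist_to_set_le w1; apply/imsetP; exists (s, t).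
have h2 : (dist_from_set G (tips dE) l <= j%:R%:E)%E.
  have [w|[j' [t' [jj tT w]]]] := walk_edited ed w2.
    by apply: dist_from_set_le w; apply/imsetP; exists (s, t).
  by apply: le_trans (dist_from_set_le tT w) _; rewrite lee_fin ler_nat.
by apply: le_lt_trans (leeD h1 h2) _; rewrite -EFinD lte_fin -natrD ltr_nat.
Qed.

End Walks.

(** * Residues *)

Lemma is_rder_sub (R : realType) (c : R -> Cplx R) (a : Cplx R) (t : R) (l : Cplx R) :
  is_rder c t l -> is_rder (fun t => c t - a) t l.
Proof.
move=> [q [cq qt qE]]; exists q; split => // x.
by rewrite (qE x); ring.
Qed.

(* Scaling the curve by 1/2 multiplies the integral by 2 ^ (n + 1). *)
Lemma closed_curve_pole (R : realType) (u u' : R -> Cplx R) (a b : R) n : a <= b ->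
  (forall t, a <= t <= b -> is_rder u t (u' t)) -> ccont_on a b u' ->
  (forall t, a <= t <= b -> u t != 0) -> u a = u b ->
  cI a b (fun t => (u t)^-1 ^+ n.+2 * u' t) = 0.
Proof.
move=> ab du cu' u0 uab.
have h0 : 0 <= 2^-1 :> R by lra.
have h1 : 2^-1 <= 1 :> R by lra.
have SH := star_homotopy (z := 0) ab h0 h1 (lexx 1) du cu'
  (g := fun x => x^-1 ^+ n.+2).
feed SH.
  move=> s t hs ht; apply: holX; apply: holV; last exact: hol_id.
  by rewrite add0r mulf_neq0 ?u0 // -cabs_eq0 cabsR_ge0; lra.
set I := cI a b _; have cu t : a <= t <= b -> ccont u t.
  by move=> /du; exact: is_rder_ccont.
have cI_ : ccont_on a b (fun t => (u t)^-1 ^+ n.+2 * u' t).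
  move=> t ht; apply: ccontM; last exact: cu'.
  by apply: ccontX; apply: ccontV; [exact: u0|exact: cu].
have E : I = 2 ^+ n.+1 * I.
  rewrite {2}/I -cintZ //.
  have -> : I = cI a b (fun t => (0 + 1%:C * u t)^-1 ^+ n.+2 * 1%:C * u' t).
    by apply: eq_cint => t _; rewrite add0r mul1r mulr1.
  rewrite (SH uab); apply: eq_cint => t _.
  have hE : (2^-1)%:C = 2^-1 :> Cplx R by rewrite fmorphV /= rmorph_nat.
  rewrite add0r invfM exprMn hE invrK [2 ^+ n.+2]exprS.
  set p := 2 ^+ n.+1; set q := (u t)^-1 ^+ n.+2.
  by field.
have n1 : (1 - 2 ^+ n.+1 : Cplx R) != 0.
  rewrite subr_eq0 eq_sym -(rmorph_nat (real_complex R)) -rmorphXn /=.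
  rewrite -(rmorph1 (real_complex R)) (inj_eq (@complexI _)) gt_eqF //.
  by rewrite exprn_egt1 // ltr1n.
by apply: (mulfI n1); rewrite mulr0 mulrBl mul1r -E subrr.
Qed.

Section Residues.
Variable R : realType.
Local Notation C := (Cplx R).
Variables (U : set C) (c c' : R -> C) (Lam : seq C).
Implicit Types (F h : C -> C) (x : C) (n : nat) (l : seq C).

Hypothesis Lam_uniq : uniq Lam.
Hypothesis U_nbhs : forall a, a \in Lam ->
  exists2 r, 0 < r & forall x, cabs (x - a) < r -> U x.
Hypothesis dc : forall t, 0 <= t <= 2 * pi -> is_rder c t (c' t).
Hypothesis cc' : ccont_on 0 (2 * pi) c'.
Hypothesis c_closed : c 0 = c (2 * pi).
Hypothesis c_notin : forall t, 0 <= t <= 2 * pi -> c t \notin Lam.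
Hypothesis c_star : forall a s t, a \in Lam -> 0 <= s <= 1 -> 0 <= t <= 2 * pi ->
  U (a + s%:C * (c t - a)).
Hypothesis c_winding : forall a, a \in Lam ->
  cI 0 (2 * pi) (fun t => c' t / (c t - a)) = 2 * pi%:C * 'i.

Let holU F := forall x, U x -> hol F x.

Let contour h : C := cI 0 (2 * pi) (fun t => h (c t) * c' t).

(** A limit over shrinking circles, as in [mxfun], and not divided by [2 pi i]: a simple pole with
    coefficient 1 has residue [2 pi i] here. *)
Let residue a h (L : C) := forall e, 0 < e -> exists2 r0 : R, 0 < r0 &
  forall r, 0 < r -> r < r0 -> cabs (circle_integral a r h - L) < e.

Let regular h := forall a, a \in Lam -> exists2 r0, 0 < r0 &
  forall x, x != a -> cabs (x - a) < r0 -> hol h x.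

(** Regularity near the poles and continuity on the contour are carried along because they make the
    integrals additive; the property is then stable under linear combinations, and partial fractions
    apply. *)
Definition residue_formula h := [/\ regular h,
  forall t, 0 <= t <= 2 * pi -> ccont h (c t) &
  exists2 rho : C -> C, (forall a, a \in Lam -> residue a h (rho a)) &
    \sum_(a <- Lam) rho a = contour h].

Let separated a : exists2 r0, 0 < r0 &
  forall x, x != a -> cabs (x - a) < r0 -> x \notin Lam.
Proof.
elim: Lam => [|b l [r r0 hr]]; first by exists 1.
have [->|ab] := eqVneq b a.
  by exists r => // x xa xr; rewrite inE negb_or xa hr.
have d0 : 0 < cabs (b - a) by rewrite cabs_gt0 subr_eq0.
exists (Num.min r (cabs (b - a))); first by rewrite lt_min r0.
move=> x xa; rewrite lt_min => /andP[xr xb]; rewrite inE negb_or hr // andbT.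
by apply: contraTneq xb => ->; rewrite ltxx.
Qed.

Let cc t : 0 <= t <= 2 * pi -> ccont c t.
Proof. by move=> /dc; exact: is_rder_ccont. Qed.

Let circle_cont a r h : 0 < r -> (forall x, cabs (x - a) = r -> ccont h x) ->
  ccont_on 0 (2 * pi) (fun t => h (a + r%:C * expi t) * ('i * r%:C * expi t)).
Proof.
move=> r0 ch t _; apply: ccontM.
  apply: (@ccont_comp _ _ _ (fun t => a + r%:C * expi t)).
    by apply: ccontD; [exact: ccont_cst|exact: ccont_circle].
  by apply: ch; rewrite addrAC subrr add0r cabs_circle // ltW.
by apply: ccontM; [exact: ccont_cst|exact: ccont_expi].
Qed.

Let regular_circle h a : regular h -> a \in Lam -> exists2 r0, 0 < r0 &
  forall r x, 0 < r -> r < r0 -> cabs (x - a) = r -> ccont h x.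
Proof.
move=> rh /rh[r0 r00 hr]; exists r0 => // r x rp rr xr.
apply/hol_ccont/hr; last by rewrite xr.
by rewrite -subr_eq0 -cabs_gt0 xr.
Qed.

Let contour_cont h : (forall t, 0 <= t <= 2 * pi -> ccont h (c t)) ->
  ccont_on 0 (2 * pi) (fun t => h (c t) * c' t).
Proof.
move=> ch t ht; apply: ccontM; last exact: cc'.
by apply: ccont_comp; [exact: cc|exact: ch].
Qed.

(** Algebraic identities between rational functions fail at the poles, where inverses take the
    default value 0. The contour and all small circles avoid [Lam], so agreement elsewhere
    suffices. *)
Lemma residue_formula_ext h h' : (forall x, x \notin Lam -> h x = h' x) ->
  residue_formula h -> residue_formula h'.
Proof.
move=> hh [rh ch [rho hrho rhoE]].
have opn x : x \notin Lam -> \forall y \near x, h y = h' y.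
  move=> xL; have [r r0 hr] := separated x.
  apply: filterS (near_disc x r0) => y yr.
  by have [->|yx] := eqVneq y x; apply: hh => //; exact: hr.
split.
- move=> a aL; have [r r0 hr] := rh a aL; have [s s0 hs] := separated a.
  exists (Num.min r s); first by rewrite lt_min r0.
  move=> x xa; rewrite lt_min => /andP[xr xs].
  by apply: hol_near (opn _ (hs x xa xs)) (hr x xa xr).
- move=> t ht; exact: ccont_near (opn _ (c_notin ht)) (ch t ht).
exists rho; last first.
  by rewrite rhoE; apply: eq_cint => t ht; rewrite hh // c_notin.
move=> a aL e e0; have [r r0 hr] := hrho a aL e e0; have [s s0 hs] := separated a.
exists (Num.min r s); first by rewrite lt_min r0.
move=> q q0; rewrite lt_min => /andP[qr qs].
have <- : circle_integral a q h = circle_integral a q h'; last exact: hr.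
apply: eq_cint => t _; congr (_ * _); apply: hh; apply: hs.
  by rewrite -subr_eq0 -cabs_eq0 addrAC subrr add0r cabs_circle ?gt_eqF // ltW.
by rewrite addrAC subrr add0r cabs_circle // ltW.
Qed.

Let residue_formulaD h1 h2 : residue_formula h1 -> residue_formula h2 ->
  residue_formula (fun x => h1 x + h2 x).
Proof.
move=> [rh1 ch1 [rho1 hrho1 E1]] [rh2 ch2 [rho2 hrho2 E2]]; split.
- move=> a aL; have [r r0 hr] := rh1 a aL; have [s s0 hs] := rh2 a aL.
  exists (Num.min r s); first by rewrite lt_min r0.
  by move=> x xa; rewrite lt_min => /andP[xr xs]; apply: holD; [exact: hr|exact: hs].
- by move=> t ht; apply: ccontD; [exact: ch1|exact: ch2].
exists (fun a => rho1 a + rho2 a); last first.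
  rewrite big_split /= E1 E2 /contour -cintD; try exact: contour_cont.
  by apply: eq_cint => t _; rewrite mulrDl.
move=> a aL e e0; have e2 : 0 < e / 2 by rewrite divr_gt0.
have [r r0 hr] := hrho1 a aL _ e2; have [s s0 hs] := hrho2 a aL _ e2.
have [r1 r10 k1] := regular_circle rh1 aL; have [r2 r20 k2] := regular_circle rh2 aL.
exists (Num.min (Num.min r s) (Num.min r1 r2)); first by rewrite !lt_min r0 s0 r10.
move=> q q0; rewrite !lt_min => /andP[/andP[qr qs] /andP[q1 q2]].
have -> : circle_integral a q (fun x => h1 x + h2 x) =
    circle_integral a q h1 + circle_integral a q h2.
  rewrite /circle_integral -cintD.
  - by apply: eq_cint => t _; rewrite mulrDl.
  - by apply: circle_cont => // x; exact: k1.
  - by apply: circle_cont => // x; exact: k2.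
have -> (x y z w : C) : x + y - (z + w) = (x - z) + (y - w) by ring.
by apply: le_lt_trans (cabsD _ _) _; have := hr q q0 qr; have := hs q q0 qs; lra.
Qed.

Let residue_formulaZ k h : residue_formula h -> residue_formula (fun x => k * h x).
Proof.
move=> [rh ch [rho hrho E]]; split.
- move=> a aL; have [r r0 hr] := rh a aL; exists r => // x xa xr.
  by apply: holM; [exact: hol_cst|exact: hr].
- by move=> t ht; apply: ccontM; [exact: ccont_cst|exact: ch].
exists (fun a => k * rho a); last first.
  rewrite -mulr_sumr E /contour -cintZ; last exact: contour_cont.
  by apply: eq_cint => t _; rewrite mulrA.
move=> a aL e e0.
have k1 : 0 < cabs k + 1 by have := cabs_ge0 k; lra.
have e2 : 0 < e / (cabs k + 1) by rewrite divr_gt0.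
have [r r0 hr] := hrho a aL _ e2; have [r1 r10 h1] := regular_circle rh aL.
exists (Num.min r r1); first by rewrite lt_min r0.
move=> q q0; rewrite lt_min => /andP[qr q1].
have -> : circle_integral a q (fun x => k * h x) = k * circle_integral a q h.
  rewrite /circle_integral -cintZ; last by apply: circle_cont => // x; exact: h1.
  by apply: eq_cint => t _; rewrite mulrA.
rewrite -mulrBr cabsM; have := hr q q0 qr; rewrite ltr_pdivlMr //.
apply: le_lt_trans; rewrite mulrC ler_wpM2l ?cabs_ge0 //; lra.
Qed.

Let residue_cont h a r1 : 0 < r1 -> (forall x, cabs (x - a) < r1 -> ccont h x) ->
  residue a h 0.
Proof.
move=> r10 ch e e0; have cha : ccont h a by apply: ch; rewrite subrr cabs0.
have /ccontP/(_ _ ltr01)/nbhsCP[d d0 hd] := cha.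
pose M := (cabs (h a) + 1) * (2 * pi).
have M0 : 0 <= M.
  by rewrite mulr_ge0 ?pi2_ge0 //; have := cabs_ge0 (h a); lra.
have eM : 0 < e / (M + 1) by rewrite divr_gt0 //; lra.
exists (Num.min r1 (Num.min d (e / (M + 1)))); first by rewrite !lt_min r10 d0.
move=> q q0; rewrite !lt_min => /and3P[qr qd qe]; rewrite subr0.
have : cabs (circle_integral a q h) <= ((cabs (h a) + 1) * q) * (2 * pi - 0).
  apply: cabs_cint_le; first exact: pi2_ge0.
    by apply: circle_cont => // x xq; apply: ch; rewrite xq.
  move=> t _; rewrite cabsM -mulrA cabsM cabs_i mul1r cabs_circle ?(ltW q0) //.
  rewrite ler_pM2r //.
  have ta : cabs (a + q%:C * expi t - a) < d.
    by rewrite addrAC subrr add0r cabs_circle // ltW.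
  have := hd _ ta; set y := h _.
  by have := cabsD (y - h a) (h a); rewrite subrK; lra.
have : M * q < e.
  move: qe; rewrite ltr_pdivlMr; last by lra.
  by apply: le_lt_trans; rewrite mulrC ler_pM2l //; lra.
by rewrite subr0 -mulrA [q * _]mulrC mulrA -/M => h1 h2; apply: le_lt_trans h2 h1.
Qed.

Let residue_formula_hol F a0 : a0 \in Lam -> holU F -> residue_formula F.
Proof.
move=> a0L dF.
have c_U t : 0 <= t <= 2 * pi -> U (c t).
  move=> ht; have := c_star a0L (s := 1) _ ht; rewrite ler01 lexx mul1r.
  by rewrite addrC subrK; exact.
split.
- by move=> a /U_nbhs[r r0 hr]; exists r => // x _ /hr; exact: dF.
- by move=> t /c_U/dF; exact: hol_ccont.
exists (fun=> 0).
  move=> a /U_nbhs[r r0 hr]; apply: (residue_cont r0) => x /hr /dF; exact: hol_ccont.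
rewrite big1 //; apply/esym.
have cn t : 0 <= t <= 2 * pi -> c t - a0 != 0.
  by move=> /c_notin ca; rewrite subr_eq0; apply: contraNneq ca => ->.
(* The factor [x - a0] cancels the quotient in [star_cauchy] and makes the value at the centre
   vanish. *)
have SC := @star_cauchy R a0 (fun t => c t - a0) c' 0 (2 * pi)
  (fun x => F x * (x - a0)) (pi2_ge0 R).
feed SC; last feed SC; last feed SC; last feed SC; last feed SC.
- by move=> t ht; exact/is_rder_sub/dc.
- exact: cc'.
- exact: cn.
- by rewrite c_closed.
- move=> s t hs ht; apply: holM; first exact/dF/c_star.
  by apply: holB; [exact: hol_id|exact: hol_cst].
move: SC; rewrite subrr mulr0 mul0r => <-; apply: eq_cint => t ht.
have -> : a0 + (c t - a0) = c t by rewrite addrC subrK.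
by field; exact: cn.
Qed.

(** A simple pole contributes the winding integral, equal to [2 pi i] for the contour and for
    circles; a higher pole integrates to 0 over any closed curve that avoids it. *)
Let residue_formula_pole n a0 : a0 \in Lam ->
  residue_formula (fun x => (x - a0)^-1 ^+ n.+1).
Proof.
move=> a0L.
have cn t : 0 <= t <= 2 * pi -> c t - a0 != 0.
  by move=> /c_notin ca; rewrite subr_eq0; apply: contraNneq ca => ->.
have holp x : x != a0 -> hol (fun x => (x - a0)^-1 ^+ n.+1) x.
  move=> xa; apply: holX; apply: holV; first by rewrite subr_eq0.
  by apply: holB; [exact: hol_id|exact: hol_cst].
split.
- move=> a aL; have [->|aa] := eqVneq a a0.
    by exists 1 => // x xa _; exact: holp.
  have d0 : 0 < cabs (a0 - a) by rewrite cabs_gt0 subr_eq0 eq_sym.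
  exists (cabs (a0 - a)) => // x _ xa; apply: holp.
  by apply: contraTneq xa => ->; rewrite ltxx.
- by move=> t /cn; rewrite subr_eq0 => /holp/hol_ccont.
exists (fun a => if a == a0 then if n == 0%N then 2 * pi%:C * 'i else 0 else 0).
  move=> a aL; have [->|aa] := eqVneq a a0; last first.
    have d0 : 0 < cabs (a0 - a) by rewrite cabs_gt0 subr_eq0 eq_sym.
    apply: (residue_cont d0) => x xa; apply/hol_ccont/holp.
    by apply: contraTneq xa => ->; rewrite ltxx.
  move=> e e0; exists 1 => // q q0 _.
  have u0 t : q%:C * expi t != 0 :> C.
    by rewrite -cabs_eq0 cabs_circle ?gt_eqF // ltW.
  have E : circle_integral a0 q (fun x => (x - a0)^-1 ^+ n.+1) =
      cI 0 (2 * pi) (fun t => (q%:C * expi t)^-1 ^+ n.+1 * ('i * (q%:C * expi t))).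
    by apply: eq_cint => t _; rewrite addrAC subrr add0r -mulrA.
  rewrite E; case: (n) => [|m].
    rewrite eqxx (@eq_cint _ _ _ _ (fun=> 'i : C)); last first.
      by move=> t _; rewrite mulrCA mulVf ?mulr1 // u0.
    have p2 : (2 * pi)%:C = 2 * pi%:C :> C by rewrite rmorphM; congr (_ * _); exact: rmorph_nat.
    by rewrite cint_cst ?pi2_ge0 // subr0 p2 subrr cabs0.
  rewrite (negPf (isT : m.+1 != 0%N)).
  rewrite (@closed_curve_pole R (fun t => q%:C * expi t)) ?subrr ?cabs0 //.
  - exact: pi2_ge0.
  - move=> t _; have := is_rder_circle q 0 t.
    by congr is_rder; apply/funext => x; rewrite subr0.
  - move=> t _; apply: ccontM; first exact: ccont_cst.
    exact: ccont_circle.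
  - by rewrite expi0 expi2pi.
rewrite (bigD1_seq a0) //= eqxx big1 ?addr0; last by move=> a /negPf ->.
rewrite /contour; case: (n) => [|m].
  by rewrite eqxx -(c_winding a0L); apply: eq_cint => t _; rewrite expr1 mulrC.
rewrite (negPf (isT : m.+1 != 0%N)) (@closed_curve_pole R (fun t => c t - a0)) //.
- exact: pi2_ge0.
- by move=> t ht; exact/is_rder_sub/dc.
- by rewrite c_closed.
Qed.

Let prodp l x : C := \prod_(b <- l) (x - b).

(** Writing [F x = F a0 + (x - a0) * F1 x] splits off a pure pole and lowers the order by one. *)
Let residue_formula_pole_hol n a0 F : a0 \in Lam -> holU F ->
  residue_formula (fun x => F x * (x - a0)^-1 ^+ n).
Proof.
move=> a0L; elim: n F => [|n IH] F dF.
  have -> : (fun x => F x * (x - a0)^-1 ^+ 0) = F.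
    by apply/funext => x; rewrite mulr1.
  exact: residue_formula_hol a0L dF.
have [r r0 hr] := U_nbhs a0L.
have rF x : cabs (x - a0) < r -> hol F x by move=> /hr /dF.
have [F1 FE [cF1 dF1]] := hol_factor r0 rF.
have dF1U : holU F1 by move=> x /dF; exact: dF1.
apply: residue_formula_ext (residue_formulaD
  (residue_formulaZ (F a0) (residue_formula_pole n a0L)) (IH F1 dF1U)).
move=> x xL; have xa : x - a0 != 0.
  by rewrite subr_eq0; apply: contraNneq xL => ->.
rewrite [F x]FE mulrDl; congr (_ + _).
by rewrite exprS mulrA; congr (_ * _); rewrite mulrAC divff // mul1r.
Qed.

(** Partial fractions, with one distinguished pole [a0] of order [n]. A further factor at [a0]
    raises the order; if [n = 0], the next root becomes the distinguished pole; otherwise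
    [1 / ((x - a0) (x - b))] is split, which lowers either [l] or [n]. *)
Lemma residue_formula_rational l n a0 F : a0 \in Lam -> {subset l <= Lam} ->
  holU F -> residue_formula (fun x => F x * (x - a0)^-1 ^+ n * (prodp l x)^-1).
Proof.
move=> a0L + dF; elim: l n a0 a0L => [|b l IH] n a0 a0L lL.
  have -> : (fun x => F x * (x - a0)^-1 ^+ n * (prodp [::] x)^-1) =
      (fun x => F x * (x - a0)^-1 ^+ n).
    by apply/funext => x; rewrite /prodp big_nil invr1 mulr1.
  exact: residue_formula_pole_hol.
have bL : b \in Lam by apply: lL; rewrite mem_head.
have lL' : {subset l <= Lam} by move=> x xl; apply: lL; rewrite inE xl orbT.
have prodE x : (prodp (b :: l) x)^-1 = (x - b)^-1 * (prodp l x)^-1.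
  by rewrite /prodp big_cons invfM.
have [ba|ba] := eqVneq b a0.
  apply: residue_formula_ext (IH n.+1 a0 a0L lL') => x _.
  by rewrite prodE ba exprSr !mulrA.
elim: n => [|n IHn].
  apply: residue_formula_ext (IH 1%N b bL lL') => x _.
  by rewrite prodE expr0 expr1 mulr1 mulrA.
have ab : a0 - b != 0 by rewrite subr_eq0 eq_sym.
apply: residue_formula_ext (residue_formulaZ (a0 - b)^-1 (residue_formulaD
  (IH n.+1 a0 a0L lL') (residue_formulaZ (-1) IHn))).
move=> x xL; have xa : x - a0 != 0.
  by rewrite subr_eq0; apply: contraNneq xL => ->.
have xb : x - b != 0 by rewrite subr_eq0; apply: contraNneq xL => ->.
rewrite prodE exprSr; set p := (x - a0)^-1 ^+ n; set P := (prodp l x)^-1.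
by field; rewrite xa xb ab.
Qed.

Lemma residue_formula_cvg h : residue_formula h ->
  (fun r : R => (2 * pi%:C * 'i)^-1 *
     \sum_(a <- Lam) circle_integral a r h : C) @ 0^'+ -->
  ((2 * pi%:C * 'i)^-1 * cI 0 (2 * pi) (fun t => h (c t) * c' t) : C).
Proof.
move=> [_ _ [rho hrho rhoE]]; rewrite -/(contour h) -rhoE.
pose k : C := (2 * pi%:C * 'i)^-1.
have sums (s : seq C) : {subset s <= Lam} -> forall e, 0 < e -> exists2 r0 : R, 0 < r0 &
    forall r, 0 < r -> r < r0 ->
    cabs (\sum_(a <- s) circle_integral a r h - \sum_(a <- s) rho a) < e.
  elim: s => [|a s IH] sL e e0.
    by exists 1 => // r _ _; rewrite !big_nil subrr cabs0.
  have e2 : 0 < e / 2 by rewrite divr_gt0.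
  have [|r1 r10 h1] := IH _ _ e2.
    by move=> x xs; apply: sL; rewrite inE xs orbT.
  have [r2 r20 h2] := hrho a (sL _ (mem_head _ _)) _ e2.
  exists (Num.min r1 r2); first by rewrite lt_min r10.
  move=> r rp; rewrite lt_min => /andP[rr1 rr2]; rewrite !big_cons.
  have -> (x y z w : C) : x + y - (z + w) = (x - z) + (y - w) by ring.
  apply: le_lt_trans (cabsD _ _) _.
  by have := h1 r rp rr1; have := h2 r rp rr2; lra.
move=> P /nbhsCP[e e0 eP].
have k1 : 0 < cabs k + 1 by have := cabs_ge0 k; lra.
have ek : 0 < e / (cabs k + 1) by rewrite divr_gt0.
have [r0 r00 hr0] := sums Lam (fun _ => id) _ ek.
have near0 : \forall r \near 0^'+, 0 < r /\ r < r0.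
  near=> r; split; first by near: r; exact: nbhs_right_gt.
  by near: r; exact: nbhs_right_lt.
apply: filterS near0 => r [rp rr]; apply: eP.
rewrite -/k -mulrBr cabsM; have := hr0 r rp rr; rewrite ltr_pdivlMr //.
apply: le_lt_trans; rewrite mulrC ler_wpM2l ?cabs_ge0 //; lra.
Unshelve. all: by end_near. Qed.

End Residues.

(** * The exterior conformal map of a convex set *)

Lemma hol_conj (R : realType) (g : Cplx R -> Cplx R) (x : Cplx R) :
  hol g (conjc x) -> hol (fun y => conjc (g (conjc y))) x.
Proof.
move=> [l [q [cq ql qE]]]; exists (conjc l), (fun y => conjc (q (conjc y))).
split=> [||y].
- by apply: ccontJ; apply: (@ccont_comp _ _ _ (fun y : Cplx R => conjc y)) => //; apply/ccontJ/ccont_id.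
- by rewrite ql.
- by rewrite (qE (conjc y)) cconjD cconjM cconjB !conjcK.
Qed.

(** The mean value property along the circle run backwards, as needed when [s = 1 / w] and [w] moves
    counterclockwise. *)
Lemma mean_value_inv (R : realType) (g : Cplx R -> Cplx R) (rho : R) : 0 < rho ->
  (forall x, cabs x <= rho -> hol g x) ->
  cI 0 (2 * pi) (fun t => g (rho%:C * (expi t)^-1)) = (2 * pi)%:C * g 0.
Proof.
move=> r0 dg; have dG x : cabs (x - 0) <= rho -> hol (fun y => conjc (g (conjc y))) x.
  by rewrite subr0 => xr; apply: hol_conj; apply: dg; rewrite cabsJ.
have := mean_value r0 dG => /(congr1 (@conjc R)).
rewrite cconjM conjc_real conjcK conjc0 => <-; rewrite -cintJ.
  by apply: eq_cint => t _; rewrite add0r conjcK cconjM conjc_real conj_expi.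
move=> t _; apply: (@ccont_comp _ _ _ (fun t => 0 + rho%:C * expi t)
  (fun y => conjc (g (conjc y)))).
  by apply: ccontD; [exact: ccont_cst|exact: ccont_circle].
by apply/hol_ccont/dG; rewrite add0r subr0 cabs_circle // ltW.
Qed.

Section ConformalInverse.
Variable R : realType.
Local Notation C := (Cplx R).
Variables (Omega : set C) (phi psi : C -> C) (d : R).
Implicit Types (s w x y z : C) (M K t : R).

Hypothesis Omega_closed : forall x, ~ Omega x ->
  exists2 r, 0 < r & forall y, cabs (y - x) < r -> ~ Omega y.
Hypothesis Omega_bounded : exists M, forall x, Omega x -> cabs x <= M.
Hypothesis phi_hol : forall x, ~ Omega x -> hol phi x.
Hypothesis phi_gt1 : forall x, ~ Omega x -> 1 < cabs (phi x).
Hypothesis psiK : forall x, ~ Omega x -> psi (phi x) = x.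
Hypothesis psi_ext : forall w, 1 < cabs w -> ~ Omega (psi w) /\ phi (psi w) = w.
Hypothesis phi_infty : forall K, exists M, forall x, M < cabs x -> K < cabs (phi x).
Hypothesis d_gt0 : 0 < d.
Hypothesis phi_lim : forall e, 0 < e ->
  exists M, forall x, M < cabs x -> cabs (phi x / x - d%:C) < e.

Let phi_inj x y : ~ Omega x -> ~ Omega y -> phi x = phi y -> x = y.
Proof. by move=> hx hy /(congr1 psi); rewrite !psiK. Qed.

Let near_ext w : 1 < cabs w -> \forall v \near w, 1 < cabs v.
Proof.
rewrite -subr_gt0 => w1; apply: filterS (near_disc w w1) => v vw.
by have := le_cabsB w v; rewrite cabsB; lra.
Qed.

(** Open mapping argument: if [v] close to [w] were missed by [phi] on a small disc about [psi w],
    then [phi - v] would have no zero there, yet be smaller at the centre than on the circle. The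
    preimage found in the disc is [psi v]. *)
Lemma psi_ccont w : 1 < cabs w -> ccont psi w.
Proof.
move=> w1; have [z0E phiz0] := psi_ext w1; set z0 := psi w in z0E phiz0.
have [r r0 rP] := Omega_closed z0E.
apply/ccontP => e e0; rewrite -/z0.
pose rho := Num.min (e / 2) (r / 2).
have rho0 : 0 < rho by rewrite lt_min !divr_gt0.
have rhoe : rho < e by rewrite gt_min; apply/orP; left; lra.
have rhor : rho < r by rewrite gt_min; apply/orP; right; lra.
have inE x : cabs (x - z0) <= rho -> ~ Omega x.
  by move=> xr; apply: rP; apply: le_lt_trans rhor.
have [m m0 hm] : exists2 m, 0 < m &
    forall x, cabs (x - z0) = rho -> m <= cabs (phi x - w).
  apply: (@circle_min _ (fun x => phi x - w)) => x xr.
  have xE : ~ Omega x by apply: inE; rewrite xr.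
  split; first by apply: ccontB; [exact/hol_ccont/phi_hol|exact: ccont_cst].
  rewrite subr_eq0; apply/eqP => E.
  have xz0 : x = z0 by apply: phi_inj => //; rewrite phiz0.
  by move: xr; rewrite xz0 subrr cabs0 => E0; rewrite -E0 ltxx in rho0.
have m2 : 0 < m / 2 by rewrite divr_gt0.
apply: filterS2 (near_ext w1) (near_disc w m2) => v v1 vw.
suff [x xr xv] : exists2 x, cabs (x - z0) <= rho & phi x = v.
  by rewrite -xv psiK; [apply: le_lt_trans rhoe|exact: inE].
apply: contrapT => none.
have : m / 2 <= cabs (phi z0 - v); last by rewrite phiz0 cabsB leNgt vw.
apply: (@min_modulus _ (fun x => phi x - v) z0 rho (m / 2) rho0 m2) => x xr.
  split; first by apply: holB; [exact/phi_hol/inE|exact: hol_cst].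
  by rewrite subr_eq0; apply/eqP => xv; apply: none; exists x.
have := hm x xr; have := cabsD (phi x - v) (v - w); rewrite addrA subrK; lra.
Qed.

(** If the derivative vanished at [z0], it would vanish at every [y] near [z0]: otherwise the slope
    of [phi] at [y] has no zero in the disc, by injectivity, but is too small at [z0] for the
    minimum principle. So [phi] would be constant along a segment, against injectivity. *)
Lemma derive_phi_neq0 z0 : ~ Omega z0 -> 'D_1 phi z0 != 0.
Proof.
move=> z0E; apply/eqP => dphi0.
have [r r0 rP] := Omega_closed z0E.
have rhol x : cabs (x - z0) < r -> hol phi x by move=> /rP; exact: phi_hol.
have [q qE [cq hq]] := hol_factor r0 rhol.
have q0 : q z0 = 0 by rewrite -dphi0; apply/esym/is_cder_derive; exists q.
pose rho := r / 2; have rho0 : 0 < rho by rewrite divr_gt0.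
have rhor : rho < r by rewrite /rho; lra.
have inE x : cabs (x - z0) <= rho -> ~ Omega x.
  by move=> xr; apply: rP; apply: le_lt_trans rhor.
have [m m0 hm] : exists2 m, 0 < m &
    forall x, cabs (x - z0) = rho -> m <= cabs (q x).
  apply: circle_min => x xr.
  have xE : ~ Omega x by apply: inE; rewrite xr.
  split; first by apply/hol_ccont/hq/phi_hol.
  apply/eqP => qx; have := qE x; rewrite qx mulr0 addr0 => /(phi_inj xE z0E) E.
  by move: xr; rewrite E subrr cabs0 => E0; rewrite -E0 ltxx in rho0.
(* For [x] on the circle, [|phi x - phi y| >= m * rho / 2] and [|x - y| <= 2 * rho], so the slope at
   [y] is at least [m / 4] there. *)
have m4 : 0 < m / 4 by rewrite divr_gt0.
have mr : 0 < m * rho / 2 by rewrite divr_gt0 // mulr_gt0.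
have /ccontP/(_ _ m4) nq := cq.
have /ccontP/(_ _ mr) nphi := hol_ccont (phi_hol z0E).
have : \forall x \near z0, 'D_1 phi x = 0.
  apply: filterS3 nq nphi (near_disc z0 rho0) => y; rewrite q0 subr0 => qy phiy yr.
  have [->//|yz0] := eqVneq y z0.
  apply: contrapT => /eqP dy0.
  have yE : ~ Omega y by apply: inE; exact: ltW.
  have [p pE [cp hp]] : exists2 F1 : C -> C,
      (forall x, phi x = phi y + (x - y) * F1 x) &
      ccont F1 y /\ forall x, hol phi x -> hol F1 x.
    have [r1 r10 r1P] := Omega_closed yE.
    by apply: (hol_factor r10) => x /r1P; exact: phi_hol.
  have py : p y = 'D_1 phi y by apply/esym/is_cder_derive; exists p.
  (* One difference quotient of [phi], between [y] and [z0], read from either end. *)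
  have pz0 : p z0 = q y.
    have z0y : z0 - y != 0 by rewrite subr_eq0 eq_sym.
    apply: (mulfI z0y); have := pE z0; rewrite (qE y).
    have -> : phi z0 + (y - z0) * q y + (z0 - y) * p z0 =
      phi z0 + ((z0 - y) * p z0 - (z0 - y) * q y) by ring.
    by rewrite -{1}[phi z0]addr0 => /addrI/esym/eqP; rewrite subr_eq0 => /eqP.
  have : m / 4 <= cabs (p z0); last by rewrite pz0 leNgt qy.
  apply: (min_modulus rho0 m4) => x xr.
    have xE := inE x xr; split; first exact/hp/phi_hol.
    have [->|xy] := eqVneq x y; first by rewrite py.
    apply/eqP => px; have := pE x; rewrite px mulr0 addr0.
    by move=> /(phi_inj xE yE) /eqP; rewrite (negPf xy).
  have h1 : m * rho <= cabs (phi x - phi z0).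
    by rewrite (qE x) [phi z0 + _]addrC addrK cabsM xr mulrC ler_pM2l // hm.
  have h2 : m * rho / 2 <= cabs (phi x - phi y).
    have := cabsD (phi x - phi y) (phi y - phi z0); rewrite addrA subrK; lra.
  have h3 : cabs (x - y) <= 2 * rho.
    have := cabsD (x - z0) (z0 - y); rewrite addrA subrK xr [cabs (z0 - y)]cabsB; lra.
  move: h2; rewrite (pE x) [phi y + _]addrC addrK cabsM.
  have := ler_wpM2r (cabs_ge0 (p x)) h3; move: (cabs (p x)) => P h4 h5.
  have : rho * m <= rho * (4 * P) by lra.
  by rewrite ler_pM2l //; lra.
move=> /nbhsCP[s s0 sP].
pose h : R := Num.min s r / 2.
have sr0 : 0 < Num.min s r by rewrite lt_min s0 r0.
have h0 : 0 < h by rewrite /h; lra.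
have hs : h < s.
  have : Num.min s r <= s by rewrite ge_min lexx.
  by rewrite /h; lra.
have hr : h < r.
  have : Num.min s r <= r by rewrite ge_min lexx orbT.
  by rewrite /h; lra.
have hn t : 0 <= t <= 1 -> cabs (z0 + t%:C * h%:C - z0) <= h.
  move=> ht; rewrite addrAC subrr add0r cabsM !cabsR_ge0; try lra.
  by rewrite -[leRHS]mul1r ler_pM2r //; lra.
have FT := @cint_FTC R 0 1 (fun t => phi (z0 + t%:C * h%:C)) (fun=> 0) ler01.
feed FT; last feed FT.
- by move=> t _; exact: ccont_cst.
- move=> t ht; have hx := hn t ht.
  have xE : ~ Omega (z0 + t%:C * h%:C) by apply: rP; lra.
  have -> : 0 = 0 * h%:C :> C by rewrite mul0r.
  apply: (@is_rder_comp _ phi (fun t => z0 + t%:C * h%:C)).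
    exists (fun=> h%:C); split; [exact: ccont_cst|by []|move=> u].
    by rewrite rmorphB; ring.
  by rewrite -(sP (z0 + t%:C * h%:C)); [exact/hol_is_cder/phi_hol|lra].
have E1 : ~ Omega (z0 + 1%:C * h%:C).
  by apply: rP; have := hn 1; rewrite ler01 lexx => /(_ isT); lra.
move: FT; rewrite cint_cst // mulr0 mul0r addr0 => /esym/eqP.
rewrite subr_eq0 => /eqP /(phi_inj E1 z0E) /eqP.
by rewrite -subr_eq0 addrAC subrr add0r mul1r -cabs_eq0 cabsR_ge0 ?gt_eqF // ltW.
Qed.

Lemma psi_is_cder w : 1 < cabs w -> is_cder psi w ('D_1 phi (psi w))^-1.
Proof.
move=> w1; have [z0E phiz0] := psi_ext w1.
have [q [cq q0 qE]] := hol_is_cder (phi_hol z0E).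
have qn : q (psi w) != 0 by rewrite q0 derive_phi_neq0.
have cqpsi : ccont (fun v => q (psi v)) w by apply: ccont_comp => //; exact: psi_ccont.
have nq : \forall v \near w, q (psi v) != 0.
  have := cqpsi; move=> /ccontP/(_ (cabs (q (psi w)))); rewrite cabs_gt0.
  move=> /(_ qn); apply: filterS => x; apply: contraTneq => ->.
  by rewrite sub0r cabsN ltxx.
apply: (@is_cder_near _ (fun v => psi w + (v - w) * (q (psi v))^-1)).
  apply: filterS2 nq (near_ext w1) => v qv v1; have [_ phiv] := psi_ext v1.
  have -> : v - w = (psi v - psi w) * q (psi v).
    by have := qE (psi v); rewrite phiv phiz0 => {1}->; rewrite addrC addKr.
  by rewrite mulfK // addrC subrK.
exists (fun v => (q (psi v))^-1); split; [exact: ccontV|by rewrite q0|move=> v].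
by rewrite subrr mul0r addr0.
Qed.

Lemma psi_hol w : 1 < cabs w -> hol psi w.
Proof. by move=> w1; exists ('D_1 phi (psi w))^-1; exact: psi_is_cder. Qed.

(* The connected set |w| > K cannot cross the curve phi(|x| = M). *)
Lemma psi_infty M : exists K, forall w, K < cabs w -> M < cabs (psi w).
Proof.
have [M0 hM0] := Omega_bounded.
pose M1 := Num.max M (Num.max M0 0 + 1).
have M1M : M <= M1 by rewrite le_max lexx.
have M1M0 : M0 < M1.
  rewrite lt_max; apply/orP; right.
  have : M0 <= Num.max M0 0 by rewrite le_max lexx.
  lra.
have M10 : 0 < M1.
  rewrite lt_max; apply/orP; right.
  have : 0 <= Num.max M0 0 by rewrite le_max lexx orbT.
  lra.
have out x : cabs x = M1 -> ~ Omega x by move=> xM /hM0; rewrite xM; lra.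
have [K K0 hK] : exists2 K, 0 < K & forall x, cabs (x - 0) = M1 -> cabs (phi x) <= K.
  by apply: circle_max => x; rewrite subr0 => /out/phi_hol/hol_ccont.
exists (Num.max K 1) => w1; rewrite gt_max => /andP[Kw1 w11].
apply: (le_lt_trans M1M); rewrite ltNge; apply/negP => small.
have [M2 hM2] := phi_infty (Num.max K 1).
pose x2 : C := (Num.max M2 M1 + 1)%:C.
have x2a : cabs x2 = Num.max M2 M1 + 1.
  have : M1 <= Num.max M2 M1 by rewrite le_max lexx orbT.
  by move=> h; rewrite cabsR_ge0 //; lra.
have x2M1 : M1 < cabs x2.
  have : M1 <= Num.max M2 M1 by rewrite le_max lexx orbT.
  by rewrite x2a; lra.
have : Num.max K 1 < cabs (phi x2).
  apply: hM2; have : M2 <= Num.max M2 M1 by rewrite le_max lexx.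
  by rewrite x2a; lra.
rewrite gt_max => /andP[Kw2 w21].
have x2E : ~ Omega x2 by move=> /hM0; lra.
have psi2 := psiK x2E; set w2 := phi x2 in Kw2 w21 psi2.
have [t1 _ E1] := polar w1; have [t2 _ E2] := polar w2.
pose rad t := (1 - t) * cabs w1 + t * cabs w2.
pose ang t := (1 - t) * t1 + t * t2.
pose w t : C := (rad t)%:C * expi (ang t).
have rad_gt k t : 0 <= t <= 1 -> k < cabs w1 -> k < cabs w2 -> k < rad t.
  move=> ht k1 k2; rewrite /rad.
  have [->|t0] := eqVneq t 0; first by rewrite subr0 mul1r mul0r addr0.
  have h1 : (1 - t) * k <= (1 - t) * cabs w1 by apply: ler_wpM2l; lra.
  have tp : 0 < t by rewrite lt_def t0; lra.
  have h2 : t * k < t * cabs w2 by rewrite ltr_pM2l.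
  lra.
have wa t : 0 <= t <= 1 -> cabs (w t) = rad t.
  by move=> ht; rewrite /w cabs_circle // ltW // (lt_trans ltr01) // rad_gt.
have cr (a b t : R) : {for t, continuous (fun t => (1 - t) * a + t * b)}.
  apply: continuousD; apply: continuousM; try exact: cst_continuous; last exact: id.
  by apply: continuousB; [exact: cst_continuous|exact: id].
have cw t : ccont w t.
  apply: ccontM; first exact/ccont_RtoC/cr.
  have [ce] := ccont_expi (ang t).
  by split; apply: (@continuous_comp _ _ _ ang (@expi R)) => //; exact: cr.
have cf : cont_on 0 1 (fun t => cabs (psi (w t))).
  apply: ccont_on_cabs => t ht; apply: ccont_comp => //.
  by apply: psi_ccont; rewrite wa // rad_gt.
have w0 : w 0 = w1.
  by rewrite /w /rad /ang !subr0 !mul1r !mul0r !addr0 -E1.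
have w1' : w 1 = w2.
  by rewrite /w /rad /ang !subrr !mul1r !mul0r !add0r -E2.
have [t tI tM] : exists2 t, t \in `[0, 1] & cabs (psi (w t)) = M1.
  apply: IVT => //; first exact: cont_on_within.
  by rewrite w0 w1' psi2 ge_min small [M1 <= _]le_max (ltW x2M1) orbT.
move: tI; rewrite in_itv /= => tI.
have rt := rad_gt K t tI Kw1 Kw2.
have [|_ phit] := @psi_ext (w t); first by rewrite wa // rad_gt.
have := hK (psi (w t)); rewrite subr0 phit wa // => /(_ tM); lra.
Qed.

Hypothesis Omega_convex : forall z x t, Omega z -> Omega x -> 0 <= t <= 1 ->
  Omega (z + t%:C * (x - z)).

Let near_inv K : \forall s \near (0 : C), s != 0 -> K < cabs s^-1.
Proof.
have K1 : 0 < Num.max K 0 + 1.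
  have : 0 <= Num.max K 0 by rewrite le_max lexx orbT.
  lra.
have i0 : 0 < (Num.max K 0 + 1)^-1 by rewrite invr_gt0.
apply: filterS (near_disc 0 i0) => s; rewrite subr0 => sr s0.
have : K <= Num.max K 0 by rewrite le_max lexx.
move: sr; rewrite cabsV -[ltLHS]invrK ltf_pV2 ?posrE ?invr_gt0 ?cabs_gt0 //.
lra.
Qed.

Let ccont0_of_infty (F Z : C -> C) (l : C) :
  (forall e, 0 < e -> exists M, forall x, M < cabs x -> cabs (F x - l) < e) ->
  (forall M, \forall s \near (0 : C), s != 0 -> M < cabs (Z s)) ->
  ccont (fun s => if s == 0 then l else F (Z s)) 0.
Proof.
move=> Fl Zi; apply/ccontP => e e0; rewrite eqxx.
have [M hM] := Fl e e0; apply: filterS (Zi M) => s hs.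
case: eqP => [_|/eqP s0]; first by rewrite subrr cabs0.
exact/hM/hs.
Qed.

Let psi_near M : \forall s \near (0 : C), s != 0 -> M < cabs (psi s^-1).
Proof.
by have [K hK] := psi_infty M; apply: filterS (near_inv K) => s hs /hs /hK.
Qed.

Let ext_inv s : s != 0 -> cabs s < 1 -> 1 < cabs s^-1.
Proof. by move=> s0 s1; rewrite cabsV invf_gt1 // cabs_gt0. Qed.

Let dC_neq0 : d%:C != 0 :> C.
Proof. by rewrite -cabs_eq0 cabsR_ge0 ?ltW // gt_eqF. Qed.

(* [s * psi (1 / s)], extended by its limit at 0: the exterior map read in the
   coordinate [s = 1 / w] of the unit disc. *)
Definition inner_psi (s : C) : C := if s == 0 then d%:C^-1 else s * psi s^-1.

Local Notation chi := inner_psi.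

Lemma inner_psi0 : chi 0 = d%:C^-1.
Proof. by rewrite /inner_psi eqxx. Qed.

Lemma inner_psiE s : s != 0 -> chi s = s * psi s^-1.
Proof. by rewrite /inner_psi => /negPf ->. Qed.

(** At [x = psi (1 / s)] the quotient [phi x / x] is the inverse of [chi s], so its limit [d] at
    infinity makes [chi] continuous at 0 and the singularity removable. *)
Lemma inner_psi_hol s : cabs s < 1 -> hol chi s.
Proof.
have hol1 x : x != 0 -> cabs x < 1 -> hol chi x.
  move=> x0 x1; apply: (@hol_near _ (fun s => s * psi s^-1)).
    by apply: filterS (near_neq x0) => y /inner_psiE.
  apply: holM; first exact: hol_id.
  apply: (@hol_comp _ (fun s => s^-1)); first by apply: holV => //; exact: hol_id.
  exact/psi_hol/ext_inv.
have [-> _|] := eqVneq s 0; last exact: hol1.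
apply: (@hol_removable _ _ _ 1) => // [|x x0]; last by rewrite subr0; exact: hol1.
have := ccont0_of_infty phi_lim psi_near => /ccontV; rewrite eqxx => /(_ dC_neq0).
apply: ccont_near; apply: filterS (near_disc 0 ltr01) => x; rewrite subr0 => x1.
have [->|x0] := eqVneq x 0; first by rewrite inner_psi0.
have [_ ->] := psi_ext (ext_inv x0 x1).
by rewrite inner_psiE // invf_div invrK mulrC.
Qed.

Let disc_ball s : cabs s < 1 -> forall x, cabs (x - s) < 1 - cabs s -> cabs x < 1.
Proof. by move=> s1 x xs; have := cabsD (x - s) s; rewrite subrK; lra. Qed.

(* [psi' (1 / s)], see [derive_psi] *)
Definition inner_dpsi (s : C) : C := chi s - s * 'D_1 chi s.

Local Notation eta := inner_dpsi.

Lemma inner_dpsi_hol s : cabs s < 1 -> hol eta s.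
Proof.
move=> s1; apply: holB; first exact: inner_psi_hol.
apply: holM; first exact: hol_id.
have r0 : 0 < 1 - cabs s by rewrite subr_gt0.
by apply: (derive_hol r0) => x /(disc_ball s1); exact: inner_psi_hol.
Qed.

Lemma inner_dpsi0 : eta 0 = d%:C^-1.
Proof. by rewrite /inner_dpsi mul0r subr0 inner_psi0. Qed.

Lemma derive_psi s : s != 0 -> cabs s < 1 -> 'D_1 psi s^-1 = eta s.
Proof.
move=> s0 s1; apply: is_cder_derive.
have iV0 : s^-1 != 0 by rewrite invr_eq0.
apply: (@is_cder_near _ (fun w => w * chi w^-1)).
  apply: filterS (near_neq iV0) => w w0.
  by rewrite inner_psiE ?invr_eq0 // invrK mulrA divff // mul1r.
have dchi : is_cder chi (s^-1)^-1 ('D_1 chi s).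
  by rewrite invrK; apply/hol_is_cder/inner_psi_hol.
have := is_cderM (is_cder_id s^-1)
  (is_cder_comp (is_cderV (f := id) iV0 (is_cder_id s^-1)) dchi).
rewrite /= invrK; congr is_cder.
by rewrite /inner_dpsi; field.
Qed.

Lemma inner_dpsi_neq0 s : cabs s < 1 -> eta s != 0.
Proof.
move=> s1; have [->|s0] := eqVneq s 0; first by rewrite inner_dpsi0 invr_eq0.
have w1 := ext_inv s0 s1; have [wE _] := psi_ext w1.
by rewrite -derive_psi // (is_cder_derive (psi_is_cder w1)) invr_eq0 derive_phi_neq0.
Qed.

Lemma inner_psi_neq s z : cabs s < 1 -> (s != 0 -> psi s^-1 != z) -> chi s - s * z != 0.
Proof.
move=> s1 hz; have [->|s0] := eqVneq s 0.
  by rewrite inner_psi0 mul0r subr0 invr_eq0.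
by rewrite inner_psiE // -mulrBr mulf_neq0 // subr_eq0 hz.
Qed.

Let star_out z x t : Omega z -> ~ Omega x -> 1 <= t -> ~ Omega (z + t%:C * (x - z)).
Proof.
move=> zO xO t1 yO; apply: xO; have t0 : t != 0 by rewrite gt_eqF //; lra.
have -> : x = z + (t^-1)%:C * (z + t%:C * (x - z) - z).
  rewrite addrAC subrr add0r mulrA -rmorphM mulVf // rmorph1 mul1r.
  by rewrite addrC subrK.
by apply: Omega_convex => //; rewrite invr_ge0 invf_le1; lra.
Qed.

(* The Schwarz lemma for [w |-> phi (z + t (psi w - z))], which maps the exterior
   of the disc to itself and fixes infinity. *)
Lemma starlike z x t : Omega z -> ~ Omega x -> 1 <= t ->
  cabs (phi x) <= cabs (phi (z + t%:C * (x - z))).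
Proof.
move=> zO xO t1; have t0 : 0 < t by lra.
have tC : t%:C != 0 :> C by rewrite -cabs_eq0 cabsR_ge0 ?ltW // gt_eqF.
pose Z s := z + t%:C * (psi s^-1 - z).
have ZO s : s != 0 -> cabs s < 1 -> ~ Omega (Z s).
  by move=> s0 s1; apply: star_out => //; have [] := psi_ext (ext_inv s0 s1).
(* Near 0, [s * phi (Z s)] is the product of [phi (Z s) / Z s], with limit [d], and of [s * Z s],
   with limit [t / d]; hence the value at 0. Since [|phi| > 1], the modulus of [k] is at most
   [1 / rho] on [|s| = rho], and [rho] tends to 1. *)
pose k s := if s == 0 then t%:C^-1 else (s * phi (Z s))^-1.
have khol1 s : s != 0 -> cabs s < 1 -> hol k s.
  move=> s0 s1; apply: (@hol_near _ (fun s => (s * phi (Z s))^-1)).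
    by apply: filterS (near_neq s0) => y /negPf y0; rewrite /k y0.
  apply: holV.
    by rewrite mulf_neq0 // -cabs_gt0 (lt_trans ltr01) // phi_gt1 //; exact: ZO.
  apply: holM; first exact: hol_id.
  apply: (@hol_comp _ Z); last exact/phi_hol/ZO.
  apply: holD; first exact: hol_cst.
  apply: holM; first exact: hol_cst.
  apply: holB; last exact: hol_cst.
  apply: (@hol_comp _ (fun s => s^-1)); first by apply: holV => //; exact: hol_id.
  exact/psi_hol/ext_inv.
have khol s : cabs s < 1 -> hol k s.
  have [-> _|] := eqVneq s 0; last exact: khol1.
  apply: (@hol_removable _ _ _ 1) => // [|x' x0]; last by rewrite subr0; exact: khol1.
  have Zi M : \forall s \near (0 : C), s != 0 -> M < cabs (Z s).
    have tp : 0 < t^-1 by rewrite invr_gt0.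
    apply: filterS (psi_near ((M + cabs (z - t%:C * z)) / t)) => y hy /hy.
    rewrite ltr_pdivrMr // => hM.
    have -> : Z y = t%:C * psi y^-1 - (t%:C * z - z) by rewrite /Z; ring.
    have := le_cabsB (t%:C * psi y^-1) (t%:C * z - z).
    rewrite cabsM (cabsR_ge0 (ltW t0)) [cabs (t%:C * z - z)]cabsB; lra.
  have c1 := ccont0_of_infty phi_lim Zi.
  have c2 : ccont (fun s => s * (z - t%:C * z) + t%:C * chi s) 0.
    apply: ccontD; apply: ccontM; try exact: ccont_cst; first exact: ccont_id.
    by apply/hol_ccont/inner_psi_hol; rewrite cabs0.
  have := ccontV _ (ccontM c1 c2); rewrite eqxx inner_psi0 mul0r add0r => c3.
  have {}c3 := c3 (mulf_neq0 dC_neq0 (mulf_neq0 tC (invr_neq0 dC_neq0))).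
  apply: ccont_near c3.
  apply: filterS2 (near_disc 0 ltr01) (Zi 0) => s'; rewrite subr0 => s1 hZ.
  rewrite /k; have [->|s0] := eqVneq s' 0.
    rewrite inner_psi0 mul0r add0r; field; by rewrite dC_neq0 tC.
  have Z0 : Z s' != 0 by rewrite -cabs_gt0 hZ.
  have -> : s' * (z - t%:C * z) + t%:C * chi s' = s' * Z s'.
    by rewrite inner_psiE // /Z; ring.
  by congr (_^-1); field.
have [psiE phiE] : psi (phi x) = x /\ 1 < cabs (phi x).
  by split; [exact: psiK|exact: phi_gt1].
set w := phi x in psiE phiE; pose s := w^-1.
have w0 : w != 0 by rewrite -cabs_gt0; lra.
have s0 : s != 0 by rewrite invr_eq0.
have s1 : cabs s < 1 by rewrite cabsV invf_lt1; lra.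
have ks rho : cabs s < rho -> rho < 1 -> cabs (k s) * rho <= 1.
  move=> sr r1; have r0 : 0 < rho by apply: le_lt_trans sr; exact: cabs_ge0.
  have := @max_modulus _ k 0 rho rho^-1 s sr; rewrite add0r => mm.
  rewrite -ler_pdivlMr // div1r; apply: mm => y; rewrite subr0 => yr.
    by apply: khol; exact: le_lt_trans r1.
  have y0 : y != 0 by rewrite -cabs_gt0 yr.
  have y1 : cabs y < 1 by rewrite yr.
  rewrite /k (negPf y0) cabsV cabsM yr.
  have pZ : 1 < cabs (phi (Z y)) by apply/phi_gt1/ZO.
  rewrite lef_pV2 ?posrE ?mulr_gt0 //; last by lra.
  by rewrite ler_pMr // ltW.
have k1 : cabs (k s) <= 1.
  rewrite leNgt; apply/negP => kk.
  pose a := Num.max (cabs s) (cabs (k s))^-1.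
  have a1 : a < 1 by rewrite gt_max s1 invf_lt1; lra.
  have as_ : cabs s <= a by rewrite le_max lexx.
  have ak : (cabs (k s))^-1 <= a by rewrite le_max lexx orbT.
  have h1 : cabs s < (a + 1) / 2 by lra.
  have h2 : (a + 1) / 2 < 1 by lra.
  have h3 : 1 <= a * cabs (k s) by rewrite -ler_pdivrMr ?div1r //; lra.
  have h4 : a * cabs (k s) < (a + 1) / 2 * cabs (k s) by rewrite ltr_pM2r; lra.
  by have := ks _ h1 h2; lra.
move: k1; rewrite /k (negPf s0) /s cabsV cabsM cabsV /Z invrK psiE.
have y1 : 1 < cabs (phi (z + t%:C * (x - z))) by apply/phi_gt1/star_out.
rewrite invfM invrK ler_pdivrMr; last by lra.
by rewrite mul1r.
Qed.

(** Infinitesimal form of [starlike]: up to a positive factor, the derivative of [|phi|^2] at [x] in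
    the direction [x - z]. *)
Lemma starlike_Re z x : Omega z -> ~ Omega x ->
  0 <= complex.Re ((x - z) * 'D_1 phi x / phi x).
Proof.
move=> zO xO; have p1 := phi_gt1 xO.
have [q [cq qx qE]] := hol_is_cder (phi_hol xO).
pose A := phi x; pose X (e : R) : C := x + e%:C * (x - z).
pose B (e : R) : C := (x - z) * q (X e).
have cX (e : R) : ccont X e.
  apply: ccontD; first exact: ccont_cst.
  by apply: ccontM; [exact: ccont_RtoC|exact: ccont_cst].
have X0 : X 0 = x by rewrite /X mul0r addr0.
have cB : ccont B 0.
  apply: ccontM; first exact: ccont_cst.
  by apply: (ccont_comp (cX 0)); rewrite X0.
(* For [e > 0] its real part is [(|phi (X e)|^2 - |phi x|^2) / e]. *)
pose g (e : R) : C := 2 * (conjc A * B e) + e%:C * (B e * conjc (B e)).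
have cg : ccont g 0.
  apply: ccontD; apply: ccontM; try exact: ccont_cst.
  - by apply: ccontM; [exact: ccont_cst|exact: cB].
  - exact: ccont_RtoC.
  - by apply: ccontM; [exact: cB|exact: ccontJ].
have gpos (e : R) : 0 < e -> 0 <= complex.Re (g e).
  move=> e0.
  have e1 : 1 <= 1 + e by lra.
  have := starlike zO xO e1.
  have -> : z + (1 + e)%:C * (x - z) = X e by rewrite /X rmorphD; ring.
  have -> : phi (X e) = A + e%:C * B e.
    rewrite (qE (X e)) /B -/A.
    have -> : X e - x = e%:C * (x - z) by rewrite /X addrAC subrr add0r.
    by rewrite mulrA.
  rewrite -/A -(@ler_pXn2r _ 2%N) ?nnegrE ?cabs_ge0 // !cabs_sqr => AB.
  rewrite -(pmulr_rge0 _ e0); move: AB; rewrite /g.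
  move: (B e) (A) => [b1 b2] [a1 a2] /= AB.
  rewrite [leRHS](_ : _ = (a1 + (e * b1 - 0 * b2)) ^+ 2
    + (a2 + (e * b2 + 0 * b1)) ^+ 2 - (a1 ^+ 2 + a2 ^+ 2)); last by ring.
  by rewrite subr_ge0.
have g0 : 0 <= complex.Re (g 0).
  rewrite leNgt; apply/negP => gn.
  have gn' : 0 < - complex.Re (g 0) by lra.
  have /ccontP/(_ _ gn') /nbhs_ballP[e /= e0 eP] := cg.
  have e2 : 0 < e / 2 by rewrite divr_gt0.
  have : cabs (g (e / 2) - g 0) < - complex.Re (g 0).
    by apply: eP; rewrite /ball /= sub0r normrN ger0_norm; lra.
  have := Re_le (g (e / 2) - g 0); rewrite cReD cReN.
  have := gpos _ e2; lra.
have E : complex.Re (g 0) = 2 * complex.Re (conjc A * B 0).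
  by rewrite /g mul0r addr0 -(rmorph_nat (real_complex R)) cReZ.
have -> : (x - z) * 'D_1 phi x / phi x = (cabs A ^- 2)%:C * (conjc A * B 0).
  have A0 : A != 0 by rewrite -cabs_gt0 /A; lra.
  have cA0 : conjc A != 0 by rewrite -cabs_eq0 cabsJ cabs_eq0.
  have -> : (cabs A ^- 2)%:C = (A * conjc A)^-1 :> C by rewrite mulcJ -fmorphV.
  by rewrite /B X0 qx -/A; field; rewrite A0 cA0.
rewrite cReZ mulr_ge0 ?invr_ge0 ?exprn_ge0 ?cabs_ge0 //; lra.
Qed.

(** Were the point equal to [psi v] with [|v| > tau], then [psi w] would lie further out on the ray
    from [z], and [starlike] would give [|w| >= |v|]. *)
Lemma level_set_star tau z w t : Omega z -> 1 < cabs w -> cabs w <= tau ->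
  0 <= t <= 1 -> level_set psi tau (z + t%:C * (psi w - z)).
Proof.
move=> zO w1 wt ht [v /= tv vE].
have v1 : 1 < cabs v by lra.
have [vO phiv] := psi_ext v1; have [wO phiw] := psi_ext w1.
have t0 : t != 0.
  by apply: contra_notN vO => /eqP t0; rewrite vE t0 mul0r addr0.
have tC : t%:C != 0 :> C by rewrite (inj_eq (@complexI _)).
have := @starlike z (psi v) t^-1 zO vO.
rewrite invf_ge1; last by lra.
have -> : z + (t^-1)%:C * (psi v - z) = psi w.
  rewrite vE addrAC subrr add0r mulrA fmorphV mulVf // mul1r.
  by rewrite addrC subrK.
rewrite phiv phiw; lra.
Qed.

(** * The Faber kernel of a matrix *)

Section Pencil.
Variables (N : nat) (A : 'M[R[i]]_N).
Hypothesis A_fov : forall x, field_of_values A x -> Omega x.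

Definition pencil s : 'M[R[i]]_N := (chi s : R[i])%:M - (s : R[i]) *: A.

Let spectrum_in a : eigenvalue A a -> Omega a.
Proof. by move=> /eigenvalue_field_of_values /A_fov. Qed.

Lemma pencilE s : s != 0 -> pencil s = (s : R[i]) *: ((psi s^-1 : R[i])%:M - A).
Proof. by move=> s0; rewrite /pencil inner_psiE // scalerBr scale_scalar_mx. Qed.

Lemma pencil_unit s : cabs s < 1 -> pencil s \in unitmx.
Proof.
move=> s1; rewrite -row_free_unit -kermx_eq0; apply/rowV0P => v /sub_kermxP vM.
have [s0|s0] := eqVneq s 0.
  move: vM; rewrite /pencil s0 scale0r subr0 mul_mx_scalar inner_psi0.
  by move=> /eqP; rewrite scaler_eq0 invr_eq0 (negPf dC_neq0) /= => /eqP.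
apply: contrapT => /eqP v0; have [pO _] := psi_ext (ext_inv s0 s1).
apply/pO/spectrum_in/eigenvalueP; exists v => //.
move: vM; rewrite pencilE // -scalemxAr mulmxBr mul_mx_scalar => /eqP.
rewrite scaler_eq0 (negPf (s0 : (s : R[i]) != 0)) /= subr_eq0 => /eqP.
by move=> <-.
Qed.

Lemma pencil_hol s : cabs s < 1 -> holmx pencil s.
Proof.
move=> s1 i j.
have -> : (fun y => pencil y i j : C) =
    (fun y => chi y * ((i == j)%:R : C) - y * (A i j : C)).
  by apply/funext => y; rewrite /pencil !mxE mulr_natr.
apply: holB; (apply: holM; last exact: hol_cst); last exact: hol_id.
exact: inner_psi_hol.
Qed.

(* [w psi'(w) (psi(w) - A)^-1] at [w = 1 / s], the generating function
   [\sum_n F_n(A) s^n] of the Faber polynomials of [A]. *)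
Definition faber_kernel s : 'M[R[i]]_N := (eta s : R[i]) *: invmx (pencil s).

Lemma faber_kernel_hol s i j : cabs s < 1 -> hol (fun s => faber_kernel s i j : C) s.
Proof.
move=> s1.
have -> : (fun y => faber_kernel y i j : C) =
    (fun y => eta y * (invmx (pencil y) i j : C)).
  by apply/funext => y; rewrite /faber_kernel mxE.
apply: holM; first exact: inner_dpsi_hol.
by apply: hol_invmx; [exact: pencil_hol|exact: pencil_unit].
Qed.

Lemma faber_kernel0 : faber_kernel 0 = 1%:M.
Proof.
rewrite /faber_kernel /pencil scale0r subr0 invmx_scalar scale_scalar_mx.
by rewrite inner_psi0 inner_dpsi0 divff // invr_eq0.
Qed.

(* By [starlike_Re], the numerical range of [pencil s / eta s] lies in the right
   half-plane, hence so does that of its inverse. *)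
Lemma faber_kernel_accretive s : s != 0 -> cabs s < 1 -> accretive (faber_kernel s).
Proof.
move=> s0 s1 x; pose y := invmx (pencil s) *m x.
have xE : x = pencil s *m y by rewrite /y mulKVmx // pencil_unit.
have -> : faber_kernel s *m x = (eta s : R[i]) *: y by rewrite -scalemxAl.
have -> : herm x ((eta s : R[i]) *: y) = eta s * conjc (herm y x).
  by rewrite hermJ -{1}[x]scale1r herm_scale conjc1 mul1r.
have -> : herm y x = chi s * (sqnorm y)%:C - s * herm y (A *m y).
  rewrite {1}xE /pencil mulmxBl mul_scalar_mx -scalemxAl.
  rewrite -[X in herm y X](_ : (chi s : R[i]) *: y + (- s : R[i]) *: (A *m y) = _).
    by rewrite herm_linear herm_sqnorm mulNr.
  by rewrite scaleNr.
have [->|y0] := eqVneq y 0.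
  have -> : herm (0 : 'cV[R[i]]_N) (A *m 0) = 0.
    by rewrite hermE big1 // => i _; rewrite mulmx0 mxE mulr0.
  have -> : sqnorm (0 : 'cV[R[i]]_N) = 0.
    by rewrite /sqnorm big1 // => i _; rewrite mxE cabs0 expr0n.
  by rewrite !mulr0 subrr conjc0 mulr0.
have zO := A_fov (field_of_values_quotient A y0).
set z := _ / _ in zO.
have n0 : 0 < sqnorm y.
  by rewrite lt_def sqnorm_ge0 andbT; apply: contra_neq y0; exact: sqnorm_eq0.
have nC : (sqnorm y)%:C != 0 :> C by rewrite (inj_eq (@complexI _)) gt_eqF.
have -> : chi s * (sqnorm y)%:C - s * herm y (A *m y) =
    (sqnorm y)%:C * (chi s - s * z).
  by rewrite /z; field.
rewrite cconjM conjc_real mulrCA cReZ mulr_ge0 ?sqnorm_ge0 //.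
have w1 := ext_inv s0 s1; have [pO phip] := psi_ext w1.
have := starlike_Re zO pO; rewrite phip invrK.
have e0 := inner_dpsi_neq0 s1.
have dE : 'D_1 phi (psi s^-1) = (eta s)^-1.
  by rewrite -derive_psi // (is_cder_derive (psi_is_cder w1)) invrK.
rewrite dE; set b := chi s - s * z.
have -> : (psi s^-1 - z) / eta s * s = b / eta s.
  by rewrite /b inner_psiE //; ring.
have -> : eta s * conjc b = (cabs (eta s) ^+ 2)%:C * conjc (b / eta s).
  rewrite -mulcJ cconjM conjc_inv.
  have ce : conjc (eta s) != 0 by rewrite -cabs_eq0 cabsJ cabs_eq0.
  by field.
by rewrite cReZ cReJ => h; rewrite mulr_ge0 ?sqr_ge0.
Qed.

Lemma mxpow_linear n (a b : R[i]) (X Y : 'M[R[i]]_N) :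
  mxpow A n (a *: X + b *: Y) = a *: mxpow A n X + b *: mxpow A n Y.
Proof.
by elim: n => //= n IH; rewrite /mxpow /= -!/(mxpow _ _ _) IH mulmxDr -!scalemxAr.
Qed.

(** Iteration of [X = (1 / chi) (1 + s A X)] for the inverse [X]: a finite expansion with exact
    remainder, free of convergence questions. *)
Lemma pencil_neumann n s : cabs s < 1 -> chi s != 0 ->
  invmx (pencil s) =
  \sum_(m < n) ((s / chi s) ^+ m / chi s : R[i]) *: mxpow A m 1%:M +
  ((s / chi s) ^+ n : R[i]) *: mxpow A n (invmx (pencil s)).
Proof.
move=> s1 c0; set X := invmx _.
have XE : X = ((chi s)^-1 : R[i]) *: 1%:M + (s / chi s : R[i]) *: (A *m X).
  have := mulmxV (pencil_unit s1); rewrite -/X /pencil mulmxBl mul_scalar_mx -scalemxAl.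
  move=> /eqP; rewrite subr_eq => /eqP E.
  have -> : (s / chi s : R[i]) *: (A *m X) = ((chi s)^-1 : R[i]) *: ((s : R[i]) *: (A *m X)).
    by rewrite scalerA mulrC.
  by rewrite -scalerDr -E scalerA mulVf ?scale1r.
elim: n => [|n IH]; first by rewrite big_ord0 add0r expr0 scale1r.
rewrite {1}IH big_ord_recr /= -addrA; congr (_ + _).
rewrite {1}XE mxpow_linear scalerDr !scalerA -exprSr; congr (_ + _ *: _).
by rewrite /mxpow -iterSr.
Qed.

End Pencil.

(** * The difference of two Faber kernels *)

Section Bound.
Variables (N n : nat) (A B : 'M[R[i]]_N) (k l : 'I_N).
Hypothesis A_fov : forall x, field_of_values A x -> Omega x.
Hypothesis B_fov : forall x, field_of_values B x -> Omega x.
Hypothesis n_gt0 : (0 < n)%N.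
Hypothesis AB_pow : forall m, (m < n)%N -> mxpow A m 1%:M k l = mxpow B m 1%:M k l.

(** The first [n] Neumann terms cancel in position [(k, l)], and the remainder is [x ^+ n * e x].
    This holds only near 0, since [chi] may vanish elsewhere; away from 0 the quotient of the
    difference by [x ^+ n] takes over. *)
Lemma faber_kernel_vanish : exists2 E : C -> C,
  forall x, cabs x < 1 -> hol E x &
  forall x, (faber_kernel A x k l - faber_kernel B x k l : C) = x ^+ n * E x.
Proof.
pose D x : C := (faber_kernel A x k l : C) - faber_kernel B x k l.
pose e x : C := eta x / chi x ^+ n *
  ((mxpow A n (invmx (pencil A x)) k l : C) - mxpow B n (invmx (pencil B x)) k l).
have D_hol x : cabs x < 1 -> hol D x.
  by move=> x1; apply: holB; exact: faber_kernel_hol.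
have chi00 : chi 0 != 0 by rewrite inner_psi0 invr_eq0.
have c01 : cabs (0 : C) < 1 by rewrite cabs0.
have pow_hol (M : 'M[R[i]]_N) m : (forall x, field_of_values M x -> Omega x) ->
    holmx (fun x => mxpow M m (invmx (pencil M x))) 0.
  move=> M_fov; elim: m => [|m IH].
    by apply: hol_invmx; [exact: pencil_hol|exact: pencil_unit].
  move=> i j.
  have -> : (fun y => mxpow M m.+1 (invmx (pencil M y)) i j : C) =
      (fun y => \sum_v (M i v : C) * (mxpow M m (invmx (pencil M y)) v j : C)).
    by apply/funext => y; rewrite /mxpow /= mxE.
  by apply: hol_sum => v _; apply: holM; [exact: hol_cst|exact: IH].
have e_hol : hol e 0.
  apply: holM.
    apply: holM; first exact: inner_dpsi_hol.
    by apply: holV; [rewrite expf_neq0|apply/holX/inner_psi_hol].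
  by apply: holB; exact: pow_hol.
have chin : \forall x \near (0 : C), chi x != 0.
  have /hol_ccont/ccontP/(_ (cabs (chi 0))) := inner_psi_hol c01; rewrite cabs_gt0.
  move=> /(_ chi00); apply: filterS => x; apply: contraTneq => ->.
  by rewrite sub0r cabsN ltxx.
have De : \forall x \near (0 : C), D x = x ^+ n * e x.
  apply: filterS2 chin (near_disc 0 ltr01) => x c0; rewrite subr0 => x1.
  have H (M : 'M[R[i]]_N) : (forall y, field_of_values M y -> Omega y) ->
      (faber_kernel M x k l : C) = eta x *
      (\sum_(m < n) (x / chi x) ^+ m / chi x * (mxpow M m 1%:M k l : C) +
       (x / chi x) ^+ n * (mxpow M n (invmx (pencil M x)) k l : C)).
    move=> M_fov; rewrite /faber_kernel mxE [in LHS](pencil_neumann M_fov n x1 c0) !mxE.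
    congr (_ * (_ + _)); rewrite summxE; apply: eq_bigr => m _.
    by rewrite mxE.
  rewrite /D !H // -mulrBr opprD addrACA.
  rewrite (_ : \sum_(m < n) _ - \sum_(m < n) _ = 0) ?add0r; last first.
    by rewrite -sumrB big1 // => m _; rewrite AB_pow // subrr.
  rewrite -mulrBr /e expr_div_n.
  have cn : chi x ^+ n != 0 by rewrite expf_neq0.
  by field.
exists (fun x => if x == 0 then e 0 else D x / x ^+ n) => x.
  move=> x1; have [->|x0] := eqVneq x 0.
    apply: (@hol_near _ e) => //; apply: filterS De => y Dy.
    have [->//|y0] := eqVneq y 0.
    by rewrite Dy mulrC mulKf // expf_neq0.
  apply: (@hol_near _ (fun y => D y / y ^+ n)).
    by apply: filterS (near_neq x0) => y /negPf ->.
  apply: holM; first exact: D_hol.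
  by apply: holV; [rewrite expf_neq0|apply/holX/hol_id].
have [->|x0] := eqVneq x 0; last by rewrite mulrC divfK // expf_neq0.
exact: (nbhs_singleton De).
Qed.

(** [coefficient_bound] with the [(k, l)] difference as [f], the [(l, k)] difference as [g], and as
    [T] the diagonal entries [(k, k)] and [(l, l)] of both kernels. The triangle inequality adds the
    two majorants. *)
Lemma faber_kernel_bound s : cabs s < 1 ->
  cabs (faber_kernel A s k l - faber_kernel B s k l : C) <=
  4 * (cabs s ^+ n / (1 - cabs s)).
Proof.
move=> s1; have [E E_hol DE] := faber_kernel_vanish.
have regroup (a b x y : C) :
    a - b + conjc (x - y) = (a + conjc x) - (b + conjc y) by rewrite cconjB; ring.
have Re4 (a b x y : C) : complex.Re ((a + b) + (x + y)) =
    complex.Re a + complex.Re b + (complex.Re x + complex.Re y) by rewrite !cReD.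
pose h (M : 'M[R[i]]_N) i j x : C := faber_kernel M x i j.
pose T x : C := (h A k k x + h A l l x) + (h B k k x + h B l l x).
have T0 : complex.Re (T 0) = 4.
  rewrite /T Re4 /h !faber_kernel0 !mxE !eqxx /=; ring.
have h_hol (M : 'M[R[i]]_N) i j x : (forall y, field_of_values M y -> Omega y) ->
    cabs x < 1 -> hol (h M i j) x.
  by move=> M_fov x1; exact: faber_kernel_hol.
have hDE x : h A k l x - h B k l x = x ^+ n * E x by exact: DE.
rewrite mulrC -T0.
have := @coefficient_bound R n (fun x => h A k l x - h B k l x) E
  (fun x => h A l k x - h B l k x) T s n_gt0 s1 E_hol hDE.
apply.
- by move=> x x1; apply: holB; exact: h_hol.
- by move=> x x1; apply: holD; apply: holD; exact: h_hol.
move=> x x0 x1.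
have accA := accretive_entry k l (faber_kernel_accretive A_fov x0 x1).
have accB := accretive_entry k l (faber_kernel_accretive B_fov x0 x1).
rewrite regroup /T Re4.
by apply: le_trans (ler_cabsB _ _) (lerD accA accB).
Qed.

End Bound.

(** * Matrix functions as integrals over a level curve *)

Section MatrixFunction.
Variables (tau : R) (U : set C) (f : C -> C).
Hypothesis tau_gt1 : 1 < tau.
Hypothesis U_nbhs : forall x, U x -> exists2 r, 0 < r & forall y, cabs (y - x) < r -> U y.
Hypothesis U_level : forall x, level_set psi tau x -> U x.
Hypothesis f_hol : forall x, U x -> hol f x.

Let u (t : R) : C := tau%:C * expi t.

Let tau_gt0 : 0 < tau. Proof. by have := tau_gt1; lra. Qed.

Let cabs_u t : cabs (u t) = tau.
Proof. by rewrite cabs_circle // ltW. Qed.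

Let u_ext t : 1 < cabs (u t). Proof. by rewrite cabs_u. Qed.

Let u_neq0 t : u t != 0.
Proof. by rewrite -cabs_gt0 cabs_u. Qed.

Let cabs_uV t : cabs (u t)^-1 = tau^-1. Proof. by rewrite cabsV cabs_u. Qed.

Let uV_lt1 t : cabs (u t)^-1 < 1.
Proof. by rewrite cabs_uV invf_lt1. Qed.

Let uV_neq0 t : (u t)^-1 != 0. Proof. by rewrite invr_eq0 u_neq0. Qed.

Let ccont_uV t : ccont (fun t => (u t)^-1) t.
Proof. by apply: ccontV; [exact: u_neq0|exact: ccont_circle]. Qed.

Let c t : C := psi (u t).
Let c' t : C := 'i * (u t * eta (u t)^-1).

Let dc t : is_rder c t (c' t).
Proof.
have du : is_rder u t ('i * u t).
  have := is_rder_circle tau 0 t.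
  by congr is_rder; apply/funext => x; rewrite subr0.
have dpsi : is_cder psi (u t) (eta (u t)^-1).
  have := psi_is_cder (u_ext t).
  by rewrite -derive_psi ?uV_neq0 ?uV_lt1 // invrK => /[dup] /is_cder_derive ->.
by have := is_rder_comp du dpsi; congr is_rder; rewrite /c'; ring.
Qed.

Let c'_cont t : ccont c' t.
Proof.
apply: ccontM; first exact: ccont_cst.
apply: ccontM; first exact: ccont_circle.
by apply: (ccont_comp (ccont_uV t)); apply/hol_ccont/inner_dpsi_hol/uV_lt1.
Qed.

Let c_out t : ~ Omega (c t). Proof. by have [] := psi_ext (u_ext t). Qed.

Let c_level a (e t : R) : Omega a -> 0 <= e <= 1 -> U (a + e%:C * (c t - a)).
Proof. by move=> aO hs; apply/U_level/level_set_star; rewrite // cabs_u. Qed.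

(** In the variable [s = 1 / w] the integrand is ['i] times [g s = eta s / (chi s - s * a)], which
    is holomorphic in the disc with [g 0 = 1]; the mean value property gives the integral. *)
Let c_winding a : Omega a ->
  cI 0 (2 * pi) (fun t => c' t / (c t - a)) = 2 * pi%:C * 'i.
Proof.
move=> aO; pose g s := eta s / (chi s - s * a).
have g_hol s : cabs s <= tau^-1 -> hol g s.
  move=> st; have s1 : cabs s < 1 by apply: le_lt_trans st _; rewrite invf_lt1.
  apply: holM; first exact: inner_dpsi_hol.
  apply: holV.
    apply: inner_psi_neq => // s0; apply/eqP => E.
    by have [pO _] := psi_ext (ext_inv s0 s1); apply: pO; rewrite E.
  apply: holB; first exact: inner_psi_hol.
  by apply: holM; [exact: hol_id|exact: hol_cst].
have tV : 0 < tau^-1 by rewrite invr_gt0.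
have g0 : g 0 = 1.
  by rewrite /g inner_dpsi0 inner_psi0 mul0r subr0 divff // invr_eq0.
have := mean_value_inv tV g_hol; rewrite g0 mulr1 => E.
have -> : 2 * pi%:C * 'i = 'i * (2 * pi)%:C :> C.
  by rewrite mulrC rmorphM; congr (_ * (_ * _)); apply/esym; exact: rmorph_nat.
rewrite -E -cintZ.
  apply: eq_cint => t _.
  have -> : (tau^-1)%:C * (expi t)^-1 = (u t)^-1 :> C by rewrite /u invfM fmorphV.
  rewrite /g inner_psiE // invrK /c' -mulrA; congr (_ * _).
  have ca : c t - a != 0.
    by rewrite subr_eq0; apply/eqP => ca; apply: (@c_out t); rewrite ca.
  by rewrite -/(c t); field; rewrite ca u_neq0.
move=> t _.
have := ccont_comp (ccont_uV t) (hol_ccont (g_hol _ _)); rewrite cabs_uV lexx.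
move=> /(_ isT); congr (ccont _ t); apply/funext => x.
by rewrite /u invfM fmorphV.
Qed.

Variables (N : nat) (A : 'M[R[i]]_N) (k l : 'I_N).
Hypothesis A_fov : forall x, field_of_values A x -> Omega x.

Let det_resolvent (rs : seq R[i]) : char_poly A = \prod_(z <- rs) ('X - z%:P) ->
  forall x : R[i], \det (x%:M - A) = \prod_(z <- rs) (x - z).
Proof.
move=> E x; have <- : (char_poly A).[x] = \prod_(z <- rs) (x - z).
  by rewrite E horner_prod; apply: eq_bigr => z _; rewrite hornerXsubC.
rewrite /char_poly -[_.[x]]/(horner_eval x _) -det_map_mx; congr (\det _).
apply/matrixP => i j; rewrite !mxE /= /horner_eval hornerD hornerN hornerC.
by rewrite hornerMn hornerX.
Qed.

Let resolvent_entry x : C := f x * (invmx ((x : R[i])%:M - A) k l : C).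

(** By Cramer's rule an entry of the resolvent is a cofactor over a product of linear factors, so
    [residue_formula_rational] applies to [f] times the cofactor and moves the integral from the
    small circles to the level curve. *)
Lemma mxfun_contour : mxfun f A k l =
  (2 * pi)%:C^-1 * cI 0 (2 * pi)
    (fun t => f (psi (u t)) * (faber_kernel A (u t)^-1 k l : C)).
Proof.
have [rs] := closed_field_poly_normal (char_poly A).
rewrite (eqP (char_poly_monic A)) scale1r => rsE.
have detE := det_resolvent rsE.
have eigE a : eigenvalue A a = (a \in rs).
  by rewrite eigenvalue_root_char rsE root_prod_XsubC.
(* [rs] lists the roots with multiplicity, as the determinant requires, while each eigenvalue is
   encircled once. *)
pose Lam : seq C := undup rs.
have LamE a : (a \in Lam) = eigenvalue A a by rewrite mem_undup eigE.
have LamO a : a \in Lam -> Omega a.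
  by rewrite LamE => /eigenvalue_field_of_values /A_fov.
(* A centre for the contraction is required; the index [k] forces [N > 0], hence an eigenvalue
   exists. *)
have [a0 a0L] : exists a0, a0 \in Lam.
  case rs_ : rs rsE => [|a0 rs'] rsE; last first.
    by exists a0; rewrite mem_undup rs_ mem_head.
  have := size_char_poly A; rewrite rsE big_nil size_poly1 => -[] N0.
  by have := leq_ltn_trans (leq0n _) (ltn_ord k); rewrite -N0.
have LamU a : a \in Lam -> exists2 r, 0 < r & forall x, cabs (x - a) < r -> U x.
  move=> /LamO aO; apply: U_nbhs.
  by have := @c_level a 0 0 aO; rewrite mul0r addr0 lexx ler01; apply.
have c_notin t : 0 <= t <= 2 * pi -> c t \notin Lam.
  by move=> _; apply/negP => /LamO; exact: c_out.
have cc : c 0 = c (2 * pi) by rewrite /c /u expi0 expi2pi.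
have dc0 t : 0 <= t <= 2 * pi -> is_rder c t (c' t) by [].
have cc0 : ccont_on 0 (2 * pi) c' by move=> t _; exact: c'_cont.
have cs0 a (s t : R) : a \in Lam -> 0 <= s <= 1 -> 0 <= t <= 2 * pi ->
    U (a + s%:C * (c t - a)) by move=> /LamO aO hs _; exact: c_level.
have cw0 a : a \in Lam -> cI 0 (2 * pi) (fun t => c' t / (c t - a)) = 2 * pi%:C * 'i.
  by move=> /LamO; exact: c_winding.
pose F x : C := f x * (\adj ((x : R[i])%:M - A) k l : C).
have F_hol x : U x -> hol F x.
  move=> /f_hol fx; apply: holM => //.
  apply: (@hol_adj _ _ (fun x : C => (x : R[i])%:M - A)) => i j.
  have -> : (fun y : C => ((y : R[i])%:M - A) i j : C) =
      (fun y => y * ((i == j)%:R : C) - (A i j : C)).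
    by apply/funext => y; rewrite !mxE mulr_natr.
  apply: holB; last exact: hol_cst.
  by apply: holM; [exact: hol_id|exact: hol_cst].
have sub : {subset (rs : seq C) <= Lam} by move=> x; rewrite mem_undup.
have Lam_uniq : uniq Lam by exact: undup_uniq.
have RF : residue_formula c c' Lam resolvent_entry.
  have := residue_formula_rational Lam_uniq LamU dc0 cc0 cc c_notin cs0 cw0 0 a0L sub F_hol.
  apply: (residue_formula_ext c_notin) => x xL.
  rewrite expr0 mulr1 /F /resolvent_entry -mulrA; congr (_ * _).
  have d0 : \det ((x : R[i])%:M - A) != 0.
    rewrite detE; apply: contraNneq xL => d0.
    have : (\prod_(z <- rs) (x - z : R[i])) == 0 by rewrite d0.
    rewrite prodf_seq_eq0 => /hasP[z zrs /= ]; rewrite subr_eq0 => /eqP ->.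
    exact: sub.
  by rewrite /invmx unitmxE unitfE d0 [RHS]mxE detE mulrC.
have cv := residue_formula_cvg RF.
rewrite mxE.
have -> : (fun r : R => (2 * pi%:C * 'i)^-1 *
    \sum_(lambda \in [set a : C | eigenvalue A a])
      circle_integral lambda r (fun z => f z * invmx ((z : R[i])%:M - A) k l) : C) =
    (fun r : R => (2 * pi%:C * 'i)^-1 *
       \sum_(a <- Lam) circle_integral a r resolvent_entry : C).
  apply/funext => r; rewrite (fsbig_seq _ _ Lam_uniq); congr (_ * _).
  suff -> : [set a : C | eigenvalue A a] = [set` Lam] by [].
  by apply/seteqP; split => a /=; rewrite LamE.
rewrite (cvg_lim _ cv); last exact: norm_hausdorff.
have p2 : (2 * pi)%:C = 2 * pi%:C :> C.
  by rewrite rmorphM; congr (_ * _); exact: rmorph_nat.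
rewrite invfM -p2 -mulrA; congr (_ * _).
(* By [pencilE], [c' t] times the resolvent at [c t] is ['i] times the Faber kernel at [1 / u t]. *)
rewrite (@eq_cint _ _ _ _ (fun t => 'i * (f (psi (u t)) *
    (faber_kernel A (u t)^-1 k l : C)))).
  rewrite cintZ; last first.
    move=> t _; apply: ccontM.
      apply: (ccont_comp (is_rder_ccont (dc t))); apply/hol_ccont/f_hol.
      have := @c_level a0 1 t (LamO _ a0L).
      by rewrite mul1r [a0 + _]addrC subrK ler01 lexx; apply.
    apply: (@ccont_comp _ _ _ (fun t => (u t)^-1)
      (fun s => faber_kernel A s k l : C)); first exact: ccont_uV.
    exact/hol_ccont/faber_kernel_hol.
  by rewrite (mulKf (i_neq0 R)).
move=> t _; rewrite /resolvent_entry -/(c t) /c' /faber_kernel mxE.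
have pE := pencilE A (uV_neq0 t); have pU := pencil_unit A_fov (uV_lt1 t).
rewrite pE invmxZ ?[_ *: _ \in _]pE -?pE // mxE !invrK.
by rewrite -/(c t); ring.
Qed.

End MatrixFunction.

(** The contour formula has weight [dt / (2 pi)], whereas [level_integral] is taken against
    [tau dt]; this explains the divisor [2 pi tau]. *)
Lemma mxfun_diff_le tau (U : set C) (f : C -> C) N (A B : 'M[R[i]]_N) k l (b : R) :
  1 < tau ->
  (forall x, U x -> exists2 r, 0 < r & forall y, cabs (y - x) < r -> U y) ->
  (forall x, level_set psi tau x -> U x) -> (forall x, U x -> hol f x) ->
  (forall x, field_of_values A x -> Omega x) ->
  (forall x, field_of_values B x -> Omega x) ->
  (forall s, cabs s = tau^-1 ->
     cabs (faber_kernel A s k l - faber_kernel B s k l : C) <= b) ->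
  cabs ((mxfun f A - mxfun f B) k l) <= level_integral f psi tau * (b / (2 * pi * tau)).
Proof.
move=> t1 Un Ul fh Af Bf hb; have t0 : 0 < tau by lra.
pose u (t : R) : C := tau%:C * expi t.
have cu t : cabs (u t) = tau by rewrite cabs_circle // ltW.
have u1 t : 1 < cabs (u t) by rewrite cu.
have un t : u t != 0 by rewrite -cabs_gt0 cu.
have cuV t : cabs (u t)^-1 = tau^-1 by rewrite cabsV cu.
have uV1 t : cabs (u t)^-1 < 1 by rewrite cuV invf_lt1.
have ccu t : ccont u t by exact: ccont_circle.
pose D (M : 'M[R[i]]_N) t : C := faber_kernel M (u t)^-1 k l.
have cD (M : 'M[R[i]]_N) t : (forall x, field_of_values M x -> Omega x) -> ccont (D M) t.
  move=> Mf; apply: (@ccont_comp _ _ _ (fun t => (u t)^-1)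
    (fun s => faber_kernel M s k l : C)); first by apply: ccontV.
  exact/hol_ccont/faber_kernel_hol.
(* The contour belongs to the level set: [psi] is injective on the exterior, so [psi (u t)] is not
   of the form [psi w] with [|w| > tau]. *)
have fpsi t : U (psi (u t)).
  apply: Ul => -[w /= tw pw]; have [_ E1] := psi_ext (u1 t).
  have w1 : 1 < cabs w by lra.
  have [_ E2] := psi_ext w1; have := cu t; rewrite -E1 -pw E2; lra.
have cf t : ccont (fun t => f (psi (u t))) t.
  apply: (@ccont_comp _ _ _ (fun t => psi (u t))); last exact/hol_ccont/fh.
  by apply: (ccont_comp (ccu t)); exact: psi_ccont.
have cfD (M : 'M[R[i]]_N) : (forall x, field_of_values M x -> Omega x) ->
    ccont_on 0 (2 * pi) (fun t => f (psi (u t)) * D M t).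
  by move=> Mf t _; apply: ccontM; [exact: cf|exact: cD].
pose J (M : 'M[R[i]]_N) : C := cI 0 (2 * pi) (fun t => f (psi (u t)) * D M t).
have EA : mxfun f A k l = (2 * pi)%:C^-1 * J A by exact: (mxfun_contour t1 Un Ul fh k l Af).
have EB : mxfun f B k l = (2 * pi)%:C^-1 * J B by exact: (mxfun_contour t1 Un Ul fh k l Bf).
have sub_entry (X Y : 'M[R[i]]_N) (e x y : C) : X k l = e * x -> Y k l = e * y ->
    (X - Y) k l = e * (x - y) :> C by rewrite !mxE => -> ->; rewrite mulrBr.
have -> := sub_entry _ _ _ _ _ EA EB.
rewrite /J -cintB; [|exact: cfD|exact: cfD].
have p0 : 0 < 2 * pi :> R by rewrite mulr_gt0 // pi_gt0.
rewrite cabsM cabsV cabsR_ge0 ?(ltW p0) //.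
rewrite mulrC ler_pdivrMr //.
have -> : level_integral f psi tau * (b / (2 * pi * tau)) * (2 * pi) =
    b / tau * level_integral f psi tau.
  have tn : tau != 0 by rewrite gt_eqF.
  have pn : pi != 0 :> R by rewrite gt_eqF // pi_gt0.
  by move: (pi : R) pn => p pn; field; rewrite tn pn.
have cI0 : cont_on 0 (2 * pi) (fun t => cabs (f (psi (u t))) * tau).
  move=> t ht; apply: continuousM; last exact: cst_continuous.
  exact: (ccont_on_cabs (fun t _ => cf t) ht).
rewrite /level_integral -RintegralZl //; last exact: cont_on_integrable cI0.
have cF : ccont_on 0 (2 * pi) (fun t => f (psi (u t)) * D A t - f (psi (u t)) * D B t).
  by move=> t ht; apply: ccontB; [exact: cfD ht|exact: cfD ht].
apply: le_trans (le_cabs_cint cF) _; apply: le_Rintegral => //.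
- exact/cont_on_integrable/ccont_on_cabs.
- apply: cont_on_integrable => t ht.
  by apply: continuousM; [exact: cst_continuous|exact: cI0].
move=> t _; rewrite -mulrBr cabsM mulrC.
have -> : b / tau * (cabs (f (psi (tau%:C * expi t))) * tau) =
    b * cabs (f (psi (u t))).
  by rewrite /u; field; rewrite gt_eqF.
by rewrite ler_wpM2r ?cabs_ge0 // hb.
Qed.

End ConformalInverse.

(** * The decay estimate for finite and infinite [delta] *)

Lemma decay_natural (R : realType) (tau : R) (m : nat) : 0 < tau ->
  decay tau m%:R%:E = tau^-1 ^+ m.+2.
Proof.
move=> t0; rewrite /decay div1r.
have -> : m%:R + 2 = (m.+2)%:R :> R by rewrite -[2]/(2%:R) -natrD addn2.
by rewrite powR_mulrn // invr_ge0 ltW.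
Qed.

Theorem theorem5p3 (R : realType) (N : nat) (G Gt : wdigraph R N)
    (dE : {set 'I_N * 'I_N}) (k l : 'I_N)
    (Omega : set (Cplx R)) (phi psi : Cplx R -> Cplx R)
    (tau : R) (f : Cplx R -> Cplx R) :
  let A : 'M[R[i]]_N := map_mx (real_complex R) (adjacency G) in
  let At : 'M[R[i]]_N := map_mx (real_complex R) (adjacency Gt) in
  let delta : \bar R :=
    (dist_to_set G k (sources dE) + dist_from_set G (tips dE) l)%E in
  edited_within dE G Gt ->
  continuum Omega ->
  convex_set Omega ->
  field_of_values A `<=` Omega ->
  field_of_values At `<=` Omega ->
  conformal_exterior Omega phi ->
  (forall z, ~ Omega z -> psi (phi z) = z) ->
  1 < tau ->
  analytic_in (level_set psi tau) f ->
  cabs ((mxfun f A - mxfun f At) k l) <=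
    level_integral f psi tau * (2 / pi) * (tau / (tau - 1)) * decay tau delta.
Proof.
move=> A At delta ed [Ocpt _ [a [_ [Oa _ _]]]] Oconv AO AtO.
move=> [phi_holo phi_bij phi_oo [d d0 phi_d]] psiK tau1 [U [Uopen Ulev f_holo]].
have Oclosed : forall x, ~ Omega x ->
    exists2 r : R, 0 < r & forall y, cabs (y - x) < r -> ~ Omega y.
  move=> x xO; have Ocl : closed Omega.
    by apply: compact_closed Ocpt; exact: norm_hausdorff.
  have : nbhs x (~` Omega).
    by apply: open_nbhs_nbhs; split => //; exact: closed_openC.
  by move=> /nbhsCP.
have Obounded : exists M : R, forall x, Omega x -> cabs x <= M.
  have cw : {within Omega, continuous (@cabs R)}.
    by apply: continuous_subspaceT; exact: continuous_cabs.
  have [m _ hm] := compact_EVT_max (ex_intro _ a Oa) Ocpt cw.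
  by exists (cabs m) => x xO; apply: hm; rewrite inE.
have phi_hol : forall x, ~ Omega x -> hol phi x.
  by move=> x xO; apply/derivable_is_cder; exact: phi_holo.
have [phi_fun phi_inj phi_surj] := phi_bij.
have phi_gt1 : forall x, ~ Omega x -> 1 < cabs (phi x).
  by move=> x xO; exact: phi_fun.
have psi_ext : forall w, 1 < cabs w -> ~ Omega (psi w) /\ phi (psi w) = w.
  by move=> w w1; have [x xO <-] := phi_surj w w1; rewrite psiK.
have phi_infty : forall K : R, exists M : R, forall x, M < cabs x -> K < cabs (phi x).
  move=> K; have : (@cinfty R) [set z | K < cabs z] by exists K.
  by move=> /phi_oo.
have phi_lim : forall e : R, 0 < e ->
    exists M : R, forall x, M < cabs x -> cabs (phi x / x - d%:C) < e.
  move=> e e0; have : nbhs (d%:C : Cplx R) [set z | cabs (z - d%:C) < e].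
    by apply/nbhsCP; exists e.
  by move=> /phi_d.
have Oconvex : forall (z x : Cplx R) (t : R),
    Omega z -> Omega x -> 0 <= t <= 1 -> Omega (z + t%:C * (x - z)).
  move=> z x t Oz Ox /andP[t0 t1].
  have tC0 : 0 <= (t%:C : R[i]) by rewrite ler0c.
  have tC1 : (t%:C : R[i]) <= 1 by rewrite -(rmorph1 (real_complex R)) lecR.
  have := Oconv x z (Itv01 tC0 tC1); rewrite !inE => /(_ Ox Oz).
  congr Omega.
  change ((t%:C : Cplx R) * x + (1 - t%:C) * z = z + t%:C * (x - z)).
  by ring.
have Unbhs : forall x, U x -> exists2 r : R, 0 < r & forall y, cabs (y - x) < r -> U y.
  by move=> x Ux; apply/nbhsCP; apply: open_nbhs_nbhs.
have f_hol : forall x, U x -> hol f x.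
  by move=> x /f_holo fx; apply/derivable_is_cder.
have tau0 : 0 < tau by lra.
have q1 : tau^-1 < 1 by rewrite invf_lt1.
have q0 : 0 < tau^-1 by rewrite invr_gt0.
have level_ge0 : 0 <= level_integral f psi tau.
  by apply: Rintegral_ge0 => t _; rewrite mulr_ge0 ?cabs_ge0 ?ltW.
(* Stated for every admissible order of vanishing: a finite [delta] uses one [n], an infinite one
   uses all. *)
have bound n : (0 < n)%N ->
    (forall m, (m < n)%N -> mxpow A m 1%:M k l = mxpow At m 1%:M k l) ->
    cabs ((mxfun f A - mxfun f At) k l) <=
    level_integral f psi tau * (2 / pi) * (tau / (tau - 1)) * tau^-1 ^+ n.+1.
  move=> n0 pw.
  have := mxfun_diff_le Oclosed Obounded phi_hol phi_gt1 psiK psi_ext phi_infty d0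
    phi_lim Oconvex tau1 Unbhs Ulev f_hol AO AtO
    (k := k) (l := l) (b := 4 * (tau^-1 ^+ n / (1 - tau^-1))).
  move=> H; feed H.
    move=> s st; have s1 : cabs s < 1 by rewrite st.
    have := faber_kernel_bound Oclosed Obounded phi_hol phi_gt1 psiK psi_ext
      phi_infty d0 phi_lim Oconvex AO AtO n0 pw s1.
    by rewrite st.
  apply: le_trans H _; rewrite -!mulrA ler_wpM2l //.
  rewrite le_eqVlt; apply/orP; left; apply/eqP.
  have tn : tau != 0 by rewrite gt_eqF.
  have tn1 : tau - 1 != 0 by rewrite subr_eq0 gt_eqF.
  have pn : pi != 0 :> R by rewrite gt_eqF // pi_gt0.
  rewrite exprS; move: (pi : R) (tau^-1 ^+ n) pn => p q pn.
  by field; rewrite tn tn1 pn.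
have := dist_sum_natural G k l (sources dE) (tips dE).
rewrite -/delta => -[deltaE|[m deltaE]]; last first.
  (* The powers agree up to the exponent [m] included, so the order is [m + 1] and the resulting
     exponent [m + 2]. *)
  rewrite deltaE decay_natural //; apply: bound => // i im.
  by apply: mxpow_eq ed _; rewrite -/delta deltaE lee_fin ler_nat.
rewrite deltaE /decay mulr0.
have pw n i : (i < n)%N -> mxpow A i 1%:M k l = mxpow At i 1%:M k l.
  by move=> _; apply: mxpow_eq ed _; rewrite -/delta deltaE leey.
rewrite leNgt; apply/negP => X0; set X := cabs _ in X0.
set K := level_integral f psi tau * (2 / pi) * (tau / (tau - 1)) in bound.
(* Here the order of vanishing is arbitrary, so a nonzero difference would bound all powers of
   [tau], although [tau > 1]. *)
have Kb n : tau ^+ n <= K / X.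
  rewrite ler_pdivlMr // mulrC -ler_pdivlMr ?exprn_gt0 // -exprVn.
  have := bound n.+1 isT (pw n.+1).
  have K0 : 0 <= K.
    by rewrite /K !mulr_ge0 ?invr_ge0 ?pi_ge0 //; lra.
  move=> /le_trans; apply; rewrite ler_wpM2l //.
  by apply: ler_wiXn2l; rewrite ?ltW // (leqW (leqnSn n)).
have := exp_bounded_le1 Kb; lra.
Qed.
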